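(* Let $T,L>0$, $0\le a<b\le L$. Let $\lambda_1,\lambda_2,f_1,f_2\in C^\infty(\mathbb{R}^2)$ satisfy $\lambda_1(y)<\lambda_2(y)$, $\lambda_1(y)\ne0$, $\lambda_2(y)\neq 0$ for all $y\in\mathbb{R}^2$, and $f_1(0)=f_2(0)=0$. Set $\Lambda(y)=\operatorname{diag}(\lambda_1(y),\lambda_2(y))$, $f=(f_1,f_2)$, $e_1=(1,0)$, and consider $$ \left\{\begin{array}{l} y_t+\Lambda(y)y_x+f(y)=e_1\Theta,\quad (t,x)\in[0,T]\times[0,L],\\ y(t,L)=y(t,0),\quad t\in[0,T],\\ y(0,x)=y^0(x),\quad x\in[0,L], \end{array}\right.\qquad (Q) $$ with state $y=(y_1,y_2)$ valued in $\mathbb{R}^2$ and scalar control $\Theta$. Assume that $$ T>\big(L-(b-a)\big)\max\left\{\frac1{|\lambda_1(0)|},\frac1{|\lambda_2(0)|}\right\} \qquad\text{and}\qquad \frac{\partial f_2}{\partial y_1}(0)\ne0 . $$ Then, for every $\epsilon>0$, there exists $\mu>0$ such that, for every $y^0,y^1\in C^6_L([0,L])^2$ that satisfy $\|y^0\|_{C^6}\le\mu$ and $\|y^1\|_{C^6}\le\mu$, there exists a control $\Theta\in C^1_L([0,T]\times[0,L])$ that satisfies $$ \operatorname{supp}\Theta\subset[\delta,T-\delta]\times[a+\delta,b-\delta],\qquad \|\Theta\|_{C^1}\le\epsilon, $$ for every $0<\delta<\min(T,(b-a)/2)/4$ such that $$ T-4\delta>\big(L-(b-a-8\delta)\big)\max\left\{\frac1{|\lambda_1(0)|},\frac1{|\lambda_2(0)|}\right\},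 $$ and such that the corresponding solution $y\in C^1_L([0,T]\times[0,L])^2$ to $(Q)$ satisfies $$ y(T,x)=y^1(x)\quad\forall x\in[0,L],\qquad \|y\|_{C^1}\le\epsilon. $$
   Context: For $k\in\mathbb{N}$ and $p\in\mathbb{N}^*$, $C^k_L([0,T]\times[0,L])^p$ (resp. $C^k_L([0,L])^p$) is the Banach space of $y\in C^k([0,T]\times[0,L])^p$ (resp. $y\in C^k([0,L])^p$) that are $L$-periodic with respect to $x$, i.e. $\partial_x^iy(t,0)=\partial_x^iy(t,L)$ for all $t\in[0,T]$, $0\le i\le k$ (resp. $y^{(i)}(0)=y^{(i)}(L)$ for $0\le i\le k$). Solutions are understood in the classical sense. *)

(* Defs.v *)
From HB Require Import structures.
From mathcomp Require Import all_boot all_order all_algebra.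
From mathcomp Require Import all_classical all_reals all_analysis.

Set Implicit Arguments.
Unset Strict Implicit.
Unset Printing Implicit Defensive.

Import Order.TTheory GRing.Theory Num.Theory.
Import numFieldNormedType.Exports.

Local Open Scope classical_set_scope.
Local Open Scope ring_scope.

(* Functions on [0, L] or [0, T] x [0, L] are total functions on R or R * R of
   which only the values on the domain matter. Accordingly, derivatives are
   taken relative to the domain: they are one-sided at the endpoints. The norm
   of 'cV[R]_p is the maximum of the absolute values of the entries, so that
   the spaces C^k( . )^p are obtained with V := 'cV[R]_p. *)

Section OneVariable.
Context {R : realType} {V : normedModType R}.
Implicit Types (D : set R) (f : R -> V) (x : R).

Definition diff_quot_in D f x : set_system V :=
  h^-1 *: (f (h + x) - f x) @[h --> within [set h | D (h + x)] 0^'].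

Definition derivable_in D f x : Prop := cvg (diff_quot_in D f x).

Definition derive_in D f x : V := lim (diff_quot_in D f x).

End OneVariable.

Definition sup_norm {R : realType} {U : Type} {V : normedModType R}
  (A : set U) (f : U -> V) : R := sup [set `|f u| | u in A].

Section Segment.
Context {R : realType} {V : normedModType R}.
Implicit Types (L : R) (f : R -> V) (k : nat).

Definition segment L : set R := `[0, L].

Definition dn L (n : nat) f : R -> V := iter n (derive_in (segment L)) f.

Definition Ck1 L k f : Prop :=
  (forall i, (i <= k)%N -> {within segment L, continuous (dn L i f)}) /\
  (forall i, (i < k)%N ->
    forall x, segment L x -> derivable_in (segment L) (dn L i f) x).

(* C^k_L([0, L]) *)
Definition CkL1 L k f : Prop :=
  Ck1 L k f /\ (forall i, (i <= k)%N -> dn L i f 0 = dn L i f L).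

Definition Ck1_norm L k f : R :=
  \big[Num.max/0]_(i < k.+1) sup_norm (segment L) (dn L i f).

End Segment.

Section Rectangle.
Context {R : realType} {V : normedModType R}.
Implicit Types (T L : R) (f : R * R -> V) (k : nat).

Definition rect T L : set (R * R) := segment T `*` segment L.

Definition dt T f : R * R -> V :=
  fun p => derive_in (segment T) (fun t => f (t, p.2)) p.1.

Definition dx L f : R * R -> V :=
  fun p => derive_in (segment L) (fun x => f (p.1, x)) p.2.

Fixpoint Ck2 T L k f : Prop :=
  {within rect T L, continuous f} /\
  if k is k'.+1 then
    [/\ forall p, rect T L p ->
          derivable_in (segment T) (fun t => f (t, p.2)) p.1,
        forall p, rect T L p ->
          derivable_in (segment L) (fun x => f (p.1, x)) p.2,
        Ck2 T L k' (dt T f) & Ck2 T L k' (dx L f)]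
  else True.

(* C^k_L([0, T] x [0, L]) *)
Definition CkL2 T L k f : Prop :=
  Ck2 T L k f /\
  (forall i, (i <= k)%N -> forall t, segment T t ->
    iter i (dx L) f (t, 0) = iter i (dx L) f (t, L)).

Definition Ck2_norm T L k f : R :=
  \big[Num.max/0]_(i < k.+1) \big[Num.max/0]_(j < k.+1 | (i + j <= k)%N)
    sup_norm (rect T L) (iter i (dt T) (iter j (dx L) f)).

Definition supp T L f : set (R * R) :=
  closure [set p | rect T L p /\ f p != 0].

End Rectangle.

Definition unitv {R : realType} {n : nat} (i : 'I_n) : 'cV[R]_n := delta_mx i 0.

Definition partial {R : realType} {n : nat} (i : 'I_n) (f : 'cV[R]_n -> R) :
  'cV[R]_n -> R := 'D_(unitv i) f.

Fixpoint Ck {R : realType} {n : nat} (k : nat) (f : 'cV[R]_n -> R) : Prop :=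
  continuous f /\
  if k is k'.+1 then
    forall i : 'I_n,
      (forall y, derivable f y (unitv i)) /\ Ck k' (partial i f)
  else True.

Definition smooth {R : realType} {n : nat} (f : 'cV[R]_n -> R) : Prop :=
  forall k, Ck k f.

Definition vec2 {R : realType} (u v : R) : 'cV[R]_2 :=
  \col_i (if i == 0 then u else v).

Section System.
Context {R : realType}.
Variables (T L : R) (lambda1 lambda2 f1 f2 : 'cV[R]_2 -> R).

Definition Lambda (y : 'cV[R]_2) : 'M[R]_2 :=
  diag_mx (vec2 (lambda1 y) (lambda2 y))^T.

Definition source (y : 'cV[R]_2) : 'cV[R]_2 := vec2 (f1 y) (f2 y).

Definition solution (Theta : R * R -> R) (y0 : R -> 'cV[R]_2)
    (y : R * R -> 'cV[R]_2) : Prop :=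
  [/\ CkL2 T L 1 y,
      forall p, rect T L p ->
        dt T y p + Lambda (y p) *m dx L y p + source (y p)
          = Theta p *: unitv 0,
      forall t, segment T t -> y (t, L) = y (t, 0) &
      forall x, segment L x -> y (0, x) = y0 x].

(* Solutions that coincide on the rectangle are identified. *)
Definition the_solution (Theta : R * R -> R) (y0 : R -> 'cV[R]_2)
    (y : R * R -> 'cV[R]_2) : Prop :=
  solution Theta y0 y /\
  (forall z, solution Theta y0 z -> forall p, rect T L p -> z p = y p).

End System.

(* Main.v *)
(** Solve the system without control from [y0] at time [0] and, backwards, from
    [y1] at time [T], and glue the two solutions by a cut-off in time.  Viewing
    the space interval as a circle, take the values of the glued field on the
    line [x = x0] through the middle of the complement of (a, b) as initial
    data and, exchanging the roles of [t] and [x], solve the system sideways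
    across this complement.  Since [T] is large, finite speed of propagation
    shows that the sideways solution coincides with the two given ones near
    [t = 0] and near [t = T].  A cut-off in [x], inside (a, b), thus yields a
    small field that solves the system outside a compact subset of
    (0, T) x (a, b).  Only its second component is kept: because
    [partial 0 f2 0 != 0], the second equation can be solved for [y_1] in terms
    of [y_2] and its first derivatives, and the first equation then defines the
    control, which vanishes wherever the field was already a solution.

    The quasilinear Cauchy problem is solved by the Lax-Friedrichs scheme: its
    iterates satisfy uniform bounds in [C^k] for small data, and a limit along an
    ultrafilter provides the solution at the cost of one derivative. *)

Require Import Defs.
From mathcomp Require Import all_boot all_order all_algebra.
From mathcomp Require Import all_classical all_reals all_analysis.
From mathcomp Require Import ring lra.

Set Implicit Arguments.
Unset Strict Implicit.
Unset Printing Implicit Defensive.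

Import Order.TTheory GRing.Theory Num.Theory.
Import numFieldNormedType.Exports.

Local Open Scope classical_set_scope.
Local Open Scope ring_scope.

(** * Calculus *)

(** The exponent 6 counts derivatives. The class of order [k] asks for bounded derivatives up to
    order [k], the last ones not necessarily continuous. The Cauchy problem turns data of order 6
    into a field of order 5, the sideways problem on a line of that field gives order 4, solving the
    second equation for [y_1] leaves order 3, and the control, which contains derivatives of [y_1],
    has order 2: just enough for a [C^1] function. All estimates are linear in the size [M] of the
    data under a condition [C * M <= 1]; since 0 is a stationary solution, trajectory and control
    become small with the data. The scheme suits this because a step is, up to a source, a convex
    combination of translates, and so is its derivative; and limits along one ultrafilter exist
    pointwise for all bounded sequences at once, with no compactness argument in function spaces.
    Uniqueness must hold against every [C^1] solution on the rectangle, whereas the propagation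
    argument uses two bounded derivatives on the plane; hence a separate maximum principle. *)

Section Derivatives.
Context {R : realType} {V : normedModType R}.
Implicit Types (f g : V -> R) (x e : V) (D : set V).

(** Multiplying the difference quotient by [h] gives a form without division that includes [h = 0]
    and combines with the triangle inequality. *)
Lemma is_derive_epsP f x e (d : R) : is_derive x e f d <->
  forall eps : R, 0 < eps -> exists2 del : R, 0 < del & forall h : R, `|h| < del ->
    `|f (h *: e + x) - f x - h * d| <= eps * `|h|.
Proof.
have quot (h : R) : h != 0 -> f (h *: e + x) - f x - h * d =
    - h * (d - h^-1 *: (f (h *: e + x) - f x)).
  by move=> h0; rewrite -[h^-1 *: _]/(h^-1 * _); field.
split.
  move=> [/cvg_ex[l fl] fd] eps eps0.
  have ld : l = d by rewrite -fd; apply/esym/cvg_lim.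
  move/cvgrPdist_le : fl => /(_ eps eps0)[/= del del0 H].
  exists del => // h hdel; have [->|h0] := eqVneq h 0.
    by rewrite scale0r add0r subrr mul0r subr0 normr0 mulr0.
  rewrite quot// normrM normrN mulrC ler_wpM2r// -ld.
  by apply: H => //; rewrite /= sub0r normrN.
move=> H.
have fd : (fun h => h^-1 *: ((f \o shift x) (h *: e) - f x)) @ 0^' --> d.
  apply/cvgrPdist_le => eps eps0; have [del del0 {}H] := H eps eps0.
  exists del => //= h; rewrite /= sub0r normrN => hdel h0.
  have := H h hdel; rewrite quot// normrM normrN mulrC.
  by rewrite ler_pM2r ?normr_gt0.
by split; [apply/cvg_ex; exists d | exact: cvg_lim].
Qed.

Lemma is_derive_sqr f x e d C del : 0 < del ->
  (forall h : R, `|h| < del -> `|f (h *: e + x) - f x - h * d| <= C * h ^+ 2) ->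
  is_derive x e f d.
Proof.
move=> del0 H; apply/is_derive_epsP => eps eps0.
have C0 : 0 < `|C| + 1 by rewrite ltr_wpDl.
exists (Num.min del (eps / (`|C| + 1))); first by rewrite lt_min del0 divr_gt0.
move=> h; rewrite lt_min => /andP[hdel]; rewrite ltr_pdivlMr// => heps.
apply: (le_trans (H h hdel)); rewrite -[h ^+ 2]ger0_norm ?sqr_ge0//.
rewrite normrX expr2 mulrA ler_wpM2r//.
have := ler_norm C; have := normr_ge0 h; nra.
Qed.

Lemma is_derive_sqr_glob f x e (d C : R) :
  (forall h : R, `|f (h *: e + x) - f x - h * d| <= C * h ^+ 2) ->
  is_derive x e f d.
Proof. by move=> H; apply: (@is_derive_sqr _ _ _ _ C 1). Qed.

Lemma is_derive_near f g x e (d : R) : (\near x, f x = g x) ->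
  is_derive x e f d -> is_derive x e g d.
Proof. exact: near_eq_is_derive. Qed.

Lemma is_derive_on D f g x e (d : R) : open D -> D x ->
  (forall z, D z -> f z = g z) -> is_derive x e f d -> is_derive x e g d.
Proof.
move=> oD Dx fg; apply: near_eq_is_derive.
by apply: filterS fg _; exact: open_nbhs_nbhs.
Qed.

Lemma is_derive_uniq f x e (d d' : R) :
  is_derive x e f d -> is_derive x e f d' -> d = d'.
Proof. by move=> [_ <-] [_ <-]. Qed.

Lemma is_derive_add f g x e (a b : R) : is_derive x e f a -> is_derive x e g b ->
  is_derive x e (fun x => f x + g x) (a + b).
Proof. by move=> fa gb; exact: is_deriveD. Qed.

Lemma is_derive_scale f x e (a c : R) : is_derive x e f a ->
  is_derive x e (fun x => c * f x) (c * a).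
Proof. by move=> fa; exact: is_deriveZ. Qed.

Lemma is_derive_sub f g x e (a b : R) : is_derive x e f a -> is_derive x e g b ->
  is_derive x e (fun x => f x - g x) (a - b).
Proof. by move=> fa gb; exact: is_deriveB. Qed.

Lemma is_derive_mul f g x e (a b : R) : is_derive x e f a -> is_derive x e g b ->
  is_derive x e (fun x => f x * g x) (a * g x + f x * b).
Proof.
move=> fa gb; have := is_deriveM fa gb.
by rewrite -![_ *: _]/(_ * _) addrC [g x * _]mulrC.
Qed.

Lemma is_derive_inv f x e (a : R) : f x != 0 -> is_derive x e f a ->
  is_derive x e (fun x => (f x)^-1) (- a * ((f x)^-1 * (f x)^-1)).
Proof.
move=> fx0 [fa fE]; split; first exact: derivableV.
by rewrite deriveV// fE -[_ *: _]/(_ * _) -invfM mulNr mulNr mulrC expr2.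
Qed.

Lemma is_derive_const (c : R) x e : is_derive x e (fun _ : V => c) 0.
Proof. exact: is_derive_cst. Qed.

End Derivatives.

Lemma mvt {R : realType} (f df : R -> R) (a b : R) :
  (forall x : R, is_derive x 1 f (df x)) ->
  exists2 c : R, Num.min a b <= c <= Num.max a b & f b - f a = df c * (b - a).
Proof.
move=> fd.
have cf z : {for z, continuous f}.
  by apply/differentiable_continuous/derivable1_diffP; case: (fd z).
wlog ab : a b / a <= b => [W|].
  have /orP[/W//|/W[c cab E]] := le_total a b.
  by exists c; [rewrite minC maxC|lra].
have [|c /itvP cab E] := MVT_segment ab (fun x _ => fd x).
  exact: continuous_subspaceT.
by exists c; rewrite // min_l// max_r// !cab.
Qed.

Lemma mvt_le {R : realType} (f df : R -> R) (a b M : R) :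
  (forall x : R, is_derive x 1 f (df x)) -> (forall x, `|df x| <= M) ->
  `|f b - f a| <= M * `|b - a|.
Proof.
move=> fd dM; have [c _ ->] := mvt a b fd.
by rewrite normrM ler_wpM2r.
Qed.

Section Line.
Context {R : realType} {V : normedModType R}.
Implicit Types (f g : V -> R) (x e : V).

Lemma is_derive_line f e x (s d : R) : is_derive (s *: e + x) e f d ->
  is_derive s 1 (fun r : R => f (r *: e + x)) d.
Proof.
move=> /is_derive_epsP H; apply/is_derive_epsP => eps /H[del del0 {}H].
by exists del => // h /H; rewrite addrA -scalerDl -[h *: 1]/(h * 1) mulr1.
Qed.

Lemma mvt_dir f df e x (h M : R) : (forall z, is_derive z e f (df z)) ->
  (forall z, `|df z| <= M) -> `|f (h *: e + x) - f x| <= M * `|h|.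
Proof.
move=> fd dM.
have := @mvt_le _ (fun r => f (r *: e + x)) (fun r => df (r *: e + x)) 0 h M.
by rewrite scale0r add0r subr0; apply=> s //; exact: is_derive_line.
Qed.

Lemma taylor_dir f df ddf e x (h M : R) : (forall z, is_derive z e f (df z)) ->
  (forall z, is_derive z e df (ddf z)) -> (forall z, `|ddf z| <= M) ->
  `|f (h *: e + x) - f x - h * df x| <= M * h ^+ 2.
Proof.
move=> fd dfd dM.
have M0 : 0 <= M by apply: le_trans (dM x).
have [] := @mvt _ (fun r => f (r *: e + x)) (fun r => df (r *: e + x)) 0 h.
  by move=> s; exact: is_derive_line.
move=> c cb; rewrite scale0r add0r subr0 => ->.
rewrite mulrC -mulrBr normrM -normr_id -[h ^+ 2]ger0_norm ?sqr_ge0// normrX.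
rewrite normr_id expr2 mulrA mulrC ler_wpM2r//.
apply: (le_trans (mvt_dir x c dfd dM)); apply: ler_wpM2l => //.
case/andP: cb; rewrite ge_min le_max; case: (lerP 0 h) => h0.
  rewrite (ger0_norm h0) => /orP[] ? /orP[] ?; rewrite ler_norml; lra.
rewrite (ltr0_norm h0) => /orP[] ? /orP[] ?; rewrite ler_norml; lra.
Qed.

End Line.

(** * Differentiability and the chain rule for smooth functions of two variables *)

Section SmoothCoefficients.
Context {R : realType}.
Implicit Types (F G : 'cV[R]_2 -> R) (y z : 'cV[R]_2) (i : 'I_2).

Lemma vec2_0 (u v : R) : vec2 u v 0 0 = u. Proof. by rewrite mxE. Qed.
Lemma vec2_1 (u v : R) : vec2 u v 1 0 = v. Proof. by rewrite mxE. Qed.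

Lemma ord2P (P : 'I_2 -> Prop) : P 0 -> P 1 -> forall i, P i.
Proof.
move=> P0 P1 i; have [->//|i0] := eqVneq i 0.
have -> // : i = 1.
by apply/val_inj; move: i i0 => [[|[|]]].
Qed.

Lemma vec2E y : y = vec2 (y 0 0) (y 1 0).
Proof. by apply/colP; apply: ord2P; rewrite mxE. Qed.

Lemma Ck_continuous k F : Ck k F -> continuous F.
Proof. by case: k => [|k] []. Qed.

Lemma CkS k F : Ck k.+1 F -> Ck k F.
Proof.
elim: k F => [|k IH] F [cF dF]; first by split.
by split=> // i; have [d /IH] := dF i.
Qed.

Lemma smooth_continuous F : smooth F -> continuous F.
Proof. by move=> /(_ 0%N)/Ck_continuous. Qed.

Lemma smooth_partial F i : smooth F -> smooth (partial i F).
Proof. by move=> sF k; have [_ /(_ i)[]] := sF k.+1. Qed.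

Lemma smooth_is_derive F i y : smooth F ->
  is_derive y (unitv i) F (partial i F y).
Proof. by move=> /(_ 1%N)[_ /(_ i)[+ _]] => /(_ y)/derivableP. Qed.

Lemma smooth_is_derive0 F (a b : R) : smooth F ->
  is_derive a 1 (fun s => F (vec2 s b)) (partial 0 F (vec2 a b)).
Proof.
move=> sF; have /is_derive_epsP H := smooth_is_derive 0 (vec2 a b) sF.
apply/is_derive_epsP => eps /H[del del0 {}H]; exists del => // h /H.
suff -> : h *: unitv 0 + vec2 a b = vec2 (h *: 1 + a) b :> 'cV[R]_2 by [].
apply/colP; apply: ord2P; rewrite !mxE//= ?mulr1// mulr0 add0r//.
Qed.

Lemma smooth_is_derive1 F (a b : R) : smooth F ->
  is_derive b 1 (fun s => F (vec2 a s)) (partial 1 F (vec2 a b)).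
Proof.
move=> sF; have /is_derive_epsP H := smooth_is_derive 1 (vec2 a b) sF.
apply/is_derive_epsP => eps /H[del del0 {}H]; exists del => // h /H.
suff -> : h *: unitv 1 + vec2 a b = vec2 a (h *: 1 + b) :> 'cV[R]_2 by [].
apply/colP; apply: ord2P; rewrite !mxE//= ?mulr1// mulr0 add0r//.
Qed.

Lemma continuous_cvP F y : continuous F -> forall eps : R, 0 < eps ->
  exists2 del : R, 0 < del & forall z, (forall i, `|z i 0 - y i 0| < del) ->
    `|F z - F y| <= eps.
Proof.
move=> /(_ y)/cvgrPdist_le cF eps /cF/nbhs_ballP[/= del del0 H].
exists del => // z zy; rewrite distrC; apply: H.
rewrite mx_norm_ball /ball_/= /Num.Def.normr/= mx_normrE.
apply: bigmax_lt => // -[i j] _ /=; rewrite !mxE ord1 distrC; exact: zy.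
Qed.

Lemma norm_between (a b c y del : R) : Num.min a b <= c <= Num.max a b ->
  `|a - y| < del -> `|b - y| < del -> `|c - y| < del.
Proof.
by rewrite !ltr_norml ge_min le_max => /andP[/orP[]? /orP[]?]; lra.
Qed.

Lemma norm_between_le (a b c M : R) : Num.min a b <= c <= Num.max a b ->
  `|a| <= M -> `|b| <= M -> `|c| <= M.
Proof.
by rewrite !ler_norml ge_min le_max => /andP[/orP[]? /orP[]?]; lra.
Qed.

(** Moving one coordinate at a time, along two sides of a rectangle, uses only the directional
    derivatives that [smooth] provides. With the continuity of the partial derivatives this yields
    total differentiability in [smooth_expand]. *)
Lemma smooth_mvt F y z : smooth F -> exists c d : R,
  [/\ Num.min (y 0 0) (z 0 0) <= c <= Num.max (y 0 0) (z 0 0),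
     Num.min (y 1 0) (z 1 0) <= d <= Num.max (y 1 0) (z 1 0) &
  F z - F y = partial 0 F (vec2 c (z 1 0)) * (z 0 0 - y 0 0) +
              partial 1 F (vec2 (y 0 0) d) * (z 1 0 - y 1 0)].
Proof.
move=> sF.
have [c cyz E0] := @mvt _ _ _ (y 0 0) (z 0 0)
  (fun s => smooth_is_derive0 s (z 1 0) sF).
have [d dyz E1] := @mvt _ _ _ (y 1 0) (z 1 0)
  (fun s => smooth_is_derive1 (y 0 0) s sF).
exists c, d; split=> //; rewrite -E0 -E1 -!vec2E; lra.
Qed.

Lemma smooth_expand F y : smooth F -> forall eps : R, 0 < eps ->
  exists2 del : R, 0 < del & forall z, (forall i, `|z i 0 - y i 0| < del) ->
  `|F z - F y - (partial 0 F y * (z 0 0 - y 0 0) +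
                 partial 1 F y * (z 1 0 - y 1 0))|
    <= eps * (`|z 0 0 - y 0 0| + `|z 1 0 - y 1 0|).
Proof.
move=> sF eps eps0.
have [d0 d00 H0] := continuous_cvP y
  (smooth_continuous (smooth_partial 0 sF)) eps0.
have [d1 d10 H1] := continuous_cvP y
  (smooth_continuous (smooth_partial 1 sF)) eps0.
exists (Num.min d0 d1); first by rewrite lt_min d00.
move=> z zy; have [c [d [cb db E]]] := smooth_mvt y z sF.
have zy0 i : `|z i 0 - y i 0| < d0 by have := zy i; rewrite lt_min => /andP[].
have zy1 i : `|z i 0 - y i 0| < d1 by have := zy i; rewrite lt_min => /andP[].
rewrite E (_ : _ + _ - _ = (partial 0 F (vec2 c (z 1 0)) - partial 0 F y) *
   (z 0 0 - y 0 0) + (partial 1 F (vec2 (y 0 0) d) - partial 1 F y) *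
   (z 1 0 - y 1 0)); last by ring.
rewrite [leRHS]mulrDr (le_trans (ler_normD _ _))// !normrM lerD// ler_wpM2r//.
  apply: H0; apply: ord2P; rewrite ?vec2_0 ?vec2_1//.
  by apply: norm_between cb _ _; rewrite ?subrr ?normr0.
apply: H1; apply: ord2P; rewrite ?vec2_0 ?vec2_1 ?subrr ?normr0//.
by apply: norm_between db _ _; rewrite ?subrr ?normr0.
Qed.

Definition cv {U : Type} (u : 'I_2 -> U -> R) (x : U) : 'cV[R]_2 :=
  \col_i u i x.

Lemma cvE {U : Type} (u : 'I_2 -> U -> R) (x : U) i : cv u x i 0 = u i x.
Proof. by rewrite mxE. Qed.

Lemma is_derive_comp {V : normedModType R} F (u : 'I_2 -> V -> R)
    (du : 'I_2 -> R) x e :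
  smooth F -> (forall i, is_derive x e (u i) (du i)) ->
  is_derive x e (fun x => F (cv u x))
    (partial 0 F (cv u x) * du 0 + partial 1 F (cv u x) * du 1).
Proof.
move=> sF ud; apply/is_derive_epsP => eps eps0.
set p0 := partial 0 F _; set p1 := partial 1 F _.
pose A : R := `|du 0| + `|du 1| + 2; pose B : R := `|p0| + `|p1| + 1.
have A0 : 0 < A by rewrite ltr_wpDl// addr_ge0.
have B0 : 0 < B by rewrite ltr_wpDl// addr_ge0.
(* Half of [eps] is spent on the remainder of [F], half on the remainders of the [u i]; the bound 1
   on [e2] keeps the increments of the [u i] below [A * |h|]. *)
pose e1 := eps / (2 * A); pose e2 := Num.min 1 (eps / (4 * B)).
have e10 : 0 < e1 by rewrite divr_gt0// mulr_gt0.
have e20 : 0 < e2 by rewrite lt_min ltr01 divr_gt0// mulr_gt0.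
have [d d0 Hd] := smooth_expand (cv u x) sF e10.
have ude i := (is_derive_epsP _ _ _ _).1 (ud i) _ e20.
have [del0 del00 Hu0] := ude 0; have [del1 del10 Hu1] := ude 1.
have q0 : 0 < d / A by rewrite divr_gt0.
exists (Num.min (d / A) (Num.min del0 del1)); first by rewrite !lt_min q0 del00.
move=> h; rewrite !lt_min => /and3P[hq /Hu0 {}Hu0 /Hu1 {}Hu1].
have e21 : e2 <= 1 by rewrite ge_min lexx.
have Hui (a b c : R) : `|a - b - h * c| <= e2 * `|h| ->
    `|a - b| <= (`|c| + 1) * `|h|.
  move=> H; rewrite -[_ - _](subrK (h * c)) (le_trans (ler_normD _ _))//.
  rewrite mulrDl [`|h * _|]normrM [`|h| * _]mulrC addrC lerD2l.
  by rewrite (le_trans H)// ler_wpM2r.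
have L0 := Hui _ _ _ Hu0; have L1 := Hui _ _ _ Hu1.
move: hq; rewrite ltr_pdivlMr// => hq.
have := Hd (cv u (h *: e + x)); rewrite !cvE => /(_ _)H.
have {H} : `|F (cv u (h *: e + x)) - F (cv u x) -
      (p0 * (u 0 (h *: e + x) - u 0 x) + p1 * (u 1 (h *: e + x) - u 1 x))| <=
   e1 * (`|u 0 (h *: e + x) - u 0 x| + `|u 1 (h *: e + x) - u 1 x|).
  apply: H; apply: ord2P; rewrite !cvE.
    apply: le_lt_trans L0 _; apply: le_lt_trans hq.
    by rewrite mulrC ler_wpM2l// /A; have := normr_ge0 (du 1); lra.
  apply: le_lt_trans L1 _; apply: le_lt_trans hq.
  by rewrite mulrC ler_wpM2l// /A; have := normr_ge0 (du 0); lra.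
move: Hu0 Hu1 L0 L1; set a0 := u 0 _ - u 0 _; set a1 := u 1 _ - u 1 _.
set DF := F _ - F _ => Hu0 Hu1 L0 L1 H.
have -> : DF - h * (p0 * du 0 + p1 * du 1) = (DF - (p0 * a0 + p1 * a1)) +
   (p0 * (a0 - h * du 0) + p1 * (a1 - h * du 1)) by ring.
have S1 : e1 * (`|a0| + `|a1|) <= eps / 2 * `|h|.
  have -> : eps / 2 = e1 * A by rewrite /e1; field; rewrite ?gt_eqF.
  by rewrite -mulrA ler_wpM2l ?(ltW e10)// /A; lra.
have S2 : `|p0 * (a0 - h * du 0) + p1 * (a1 - h * du 1)| <= eps / 2 * `|h|.
  rewrite (le_trans (ler_normD _ _))// !normrM.
  have : B * (e2 * `|h|) <= eps / 2 * `|h|.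
    rewrite mulrA ler_wpM2r// mulrC -ler_pdivlMr//.
    apply: (@le_trans _ _ (eps / (4 * B))); first by rewrite ge_min lexx orbT.
    by rewrite -mulrA -invfM ler_wpM2l ?(ltW eps0)// lef_pV2 ?posrE ?mulr_gt0//; lra.
  apply: le_trans; rewrite /B !mulrDl -[leLHS]addr0.
  rewrite !lerD// ?ler_wpM2l//.
  by rewrite mul1r mulr_ge0// ltW.
by rewrite (le_trans (ler_normD _ _))// (splitr eps) mulrDl lerD// (le_trans H).
Qed.

Lemma vec2_continuous : continuous (fun p : R * R => vec2 p.1 p.2).
Proof.
move=> p; apply/cvgrPdist_le => eps eps0; near=> q.
rewrite /Num.Def.normr/= mx_normrE; apply: bigmax_le; first exact: ltW.
move=> [i j] _ /=; rewrite !mxE; case: ifP => _.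
  near: q; apply: (@cvgr_dist_le _ _ _ (nbhs p)) => //; exact: cvg_fst.
near: q; apply: (@cvgr_dist_le _ _ _ (nbhs p)) => //; exact: cvg_snd.
Unshelve. all: by end_near. Qed.

Lemma continuous_box_bounded F (r : R) : continuous F ->
  exists2 C : R, 0 <= C & forall y, (forall i, `|y i 0| <= r) -> `|F y| <= C.
Proof.
move=> cF.
pose K : set (R * R) := `[- r, r] `*` `[- r, r].
have cK : compact K by apply: compact_setX; exact: segment_compact.
have cG : continuous (fun p : R * R => F (vec2 p.1 p.2)).
  by move=> p; apply: continuous_comp; [exact: vec2_continuous|exact: cF].
have /compact_bounded[M [_ /(_ (`|M| + 1))]] := continuous_compact
  (continuous_subspaceT cG) cK.
rewrite (le_lt_trans (ler_norm _))// ?ltrDl// => /(_ isT) H.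
exists (`|M| + 1) => [|y yr]; first by rewrite addr_ge0.
apply: H; exists (y 0 0, y 1 0); last by rewrite /= -vec2E.
by split; rewrite /= in_itv /= -ler_norml.
Qed.

Lemma smooth_box_lip F (r : R) : smooth F -> exists2 C : R, 0 <= C & forall y z,
  (forall i, `|y i 0| <= r) -> (forall i, `|z i 0| <= r) ->
  forall M : R, (forall i, `|y i 0 - z i 0| <= M) -> `|F y - F z| <= C * M.
Proof.
move=> sF.
have [C0 C00 H0] := continuous_box_bounded r
  (smooth_continuous (smooth_partial 0 sF)).
have [C1 C10 H1] := continuous_box_bounded r
  (smooth_continuous (smooth_partial 1 sF)).
exists (C0 + C1) => [|y z yr zr M yzM]; first exact: addr_ge0.
have [c [d [cb db ->]]] := smooth_mvt z y sF.
rewrite mulrDl (le_trans (ler_normD _ _))// !normrM lerD// ler_pM//.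
  apply: H0; apply: ord2P; rewrite ?vec2_0 ?vec2_1//.
  exact: norm_between_le cb _ _.
apply: H1; apply: ord2P; rewrite ?vec2_0 ?vec2_1//.
exact: norm_between_le db _ _.
Qed.

End SmoothCoefficients.

(** * Classes of functions with bounded derivatives *)

Section BoundClasses.
Context {R : realType} {V : normedModType R}.
Implicit Types (D E : set V) (P : R -> (V -> R) -> Prop) (f g : V -> R).

Definition Bo D (M : R) f : Prop := forall x, D x -> `|f x| <= M.

(** Iterated from [Bo], this describes a ball in the space of functions with [n] bounded derivatives
    in the directions of [E]: one [M] bounds all orders, and the derivatives of top order need not
    be continuous. *)
Definition Der D E P (M : R) f : Prop := P M f /\ forall e, E e ->
  exists2 g, (forall x, D x -> is_derive x e f (g x)) & P M g.

Definition Dern D E n := iter n (Der D E) (Bo D).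

(* These properties pass from [P] to [Der D E P], so that an estimate using only
   them is proved for all orders of differentiation at once. *)
Record nice D P : Prop := Nice {
  nice_ext : forall (M : R) f g, (forall x, D x -> f x = g x) -> P M f -> P M g;
  nice_mono : forall (M N : R) f, M <= N -> P M f -> P N f;
  nice_pos : forall (M : R) f, P M f -> 0 <= M;
  nice_bound : forall (M : R) f, P M f -> Bo D M f;
  nice_cst : forall c : R, P `|c| (fun=> c);
  nice_add : forall (M N : R) f g, P M f -> P N g ->
    P (M + N) (fun x => f x + g x);
  nice_scale : forall (c M : R) f, P M f -> P (`|c| * M) (fun x => c * f x);
  nice_mul : exists2 C : R, 0 <= C & forall (M N : R) f g, P M f -> P N g ->
    P (C * M * N) (fun x => f x * g x);
  nice_inv : forall c M : R, 0 < c -> exists2 C : R, 0 <= C & forall g, P M g ->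
    (forall x, D x -> c <= `|g x|) -> P C (fun x => (g x)^-1);
  nice_comp : forall F, smooth F -> exists2 C : R, 0 <= C &
    forall u v : 'I_2 -> V -> R, (forall i, P 1 (u i)) -> (forall i, P 1 (v i)) ->
    forall M : R, (forall i, P M (fun x => u i x - v i x)) ->
    P (C * M) (fun x => F (cv u x) - F (cv v x)) }.

Lemma nice_Bo D : D !=set0 -> nice D (Bo D).
Proof.
move=> [a Da]; split.
- by move=> M f g fg Hf x Dx; rewrite -fg//; exact: Hf.
- by move=> M N f MN Hf x Dx; rewrite (le_trans (Hf _ Dx)).
- by move=> M f /(_ a Da); apply: le_trans.
- by [].
- by move=> c x _.
- by move=> M N f g Hf Hg x Dx; rewrite (le_trans (ler_normD _ _))// lerD ?Hf ?Hg.
- by move=> c M f Hf x Dx; rewrite normrM ler_wpM2l// Hf.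
- by exists 1 => // M N f g Hf Hg x Dx; rewrite mul1r normrM ler_pM ?Hf ?Hg.
- move=> c M c0; exists c^-1 => [|g _ Hg x Dx]; first by rewrite invr_ge0 ltW.
  rewrite normfV lef_pV2 ?Hg ?posrE//; exact: lt_le_trans c0 (Hg _ Dx).
- move=> F sF; have [C C0 H] := smooth_box_lip 1 sF.
  exists C => // u v Hu Hv M Huv x Dx.
  apply: H => i; rewrite !cvE; [exact: Hu|exact: Hv|exact: Huv].
Qed.

Section NiceTheory.
Variables (D : set V) (P : R -> (V -> R) -> Prop).
Hypothesis nP : nice D P.

Lemma nice_opp (M : R) f : P M f -> P M (fun x => - f x).
Proof.
move=> Pf; have := nice_scale nP (-1) Pf; rewrite normrN1 mul1r.
by apply: (nice_ext nP) => // x _; rewrite mulN1r.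
Qed.

Lemma nice_sub (M N : R) f g : P M f -> P N g -> P (M + N) (fun x => f x - g x).
Proof. by move=> Pf /nice_opp; exact: (nice_add nP). Qed.

Lemma nice_0 : P 0 (fun=> 0).
Proof. by rewrite -{1}(normr0 R); exact: (nice_cst nP). Qed.

Lemma nice_cst_le (c M : R) : `|c| <= M -> P M (fun=> c).
Proof. by move=> cM; apply: (nice_mono nP) (nice_cst nP c). Qed.

Lemma nice_compb F : smooth F -> exists2 C : R, 0 <= C &
  forall u : 'I_2 -> V -> R, (forall i, P 1 (u i)) -> P C (fun x => F (cv u x)).
Proof.
move=> sF; have [C C0 H] := nice_comp nP sF.
exists (C + `|F 0|) => [|u Pu]; first exact: addr_ge0.
pose z := fun (i : 'I_2) (x : V) => 0 : R.
have Pz i : P 1 (z i) by apply: nice_cst_le; rewrite normr0.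
have Puz i : P 1 (fun x => u i x - z i x).
  by apply: (nice_ext nP) (Pu i) => // x _; rewrite subr0.
have := nice_add nP (H _ _ Pu Pz 1 Puz) (nice_cst nP (F 0)).
rewrite mulr1; apply: (nice_ext nP) => // x _.
suff -> : cv z x = 0 by rewrite subrK.
by apply/colP => i; rewrite cvE mxE.
Qed.

Lemma nice_comps F : smooth F -> F 0 = 0 -> exists2 C : R, 0 <= C &
  forall (u : 'I_2 -> V -> R) (M : R), M <= 1 -> (forall i, P M (u i)) ->
  P (C * M) (fun x => F (cv u x)).
Proof.
move=> sF F0; have [C C0 H] := nice_comp nP sF.
exists C => // u M M1 Pu.
pose z := fun (i : 'I_2) (x : V) => 0 : R.
have Pz i : P 1 (z i) by apply: nice_cst_le; rewrite normr0.
have Puz i : P M (fun x => u i x - z i x).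
  by apply: (nice_ext nP) (Pu i) => // x _; rewrite subr0.
have Pu1 i : P 1 (u i) by apply: (nice_mono nP) (Pu i).
have := H _ _ Pu1 Pz M Puz; apply: (nice_ext nP) => // x _.
suff -> : cv z x = 0 by rewrite F0 subr0.
by apply/colP => i; rewrite cvE mxE.
Qed.

(** The derivative of a sum, product, inverse or composite is built from the functions and their
    derivatives by the operations of the record, so each field at the next order follows from the
    fields at this order. A composite calls for [partial i F], whence [F] smooth of all orders. *)
Lemma nice_Der E : open D -> nice D (Der D E P).
Proof.
move=> oD; split.
- move=> M f g fg [Pf df]; split; first by apply: (nice_ext nP) Pf.
  move=> e /df[f' ff' Pf']; exists f' => // x Dx.
  by apply: is_derive_on fg _ => //; exact: ff'.
- move=> M N f MN [Pf df]; split; first exact: (nice_mono nP) Pf.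
  by move=> e /df[f' ff' Pf']; exists f' => //; exact: (nice_mono nP) Pf'.
- by move=> M f [/(nice_pos nP)].
- by move=> M f [/(nice_bound nP)].
- move=> c; split; first exact: (nice_cst nP).
  move=> e _; exists (fun=> 0) => [x _|]; first exact: is_derive_const.
  by apply: nice_cst_le; rewrite normr0.
- move=> M N f g [Pf df] [Pg dg]; split; first exact: (nice_add nP).
  move=> e Ee; have [f' ff' Pf'] := df e Ee; have [g' gg' Pg'] := dg e Ee.
  exists (fun x => f' x + g' x) => [x Dx|]; last exact: (nice_add nP).
  by apply: is_derive_add; [exact: ff'|exact: gg'].
- move=> c M f [Pf df]; split; first exact: (nice_scale nP).
  move=> e /df[f' ff' Pf']; exists (fun x => c * f' x); last exact: (nice_scale nP).
  by move=> x Dx; apply: is_derive_scale; exact: ff'.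
- have [C C0 H] := nice_mul nP; exists (C + C) => [|M N f g [Pf df] [Pg dg]].
    exact: addr_ge0.
  have M0 := nice_pos nP Pf; have N0 := nice_pos nP Pg.
  split.
    apply: (nice_mono nP) (H _ _ _ _ Pf Pg) => //.
    by rewrite !mulrDl lerDl !mulr_ge0.
  move=> e Ee; have [f' ff' Pf'] := df e Ee; have [g' gg' Pg'] := dg e Ee.
  exists (fun x => f' x * g x + f x * g' x) => [x Dx|].
    by apply: is_derive_mul; [exact: ff'|exact: gg'].
  by rewrite !mulrDl; apply: (nice_add nP) => //; exact: H.
- move=> c M c0; have [C C0 H] := nice_inv nP M c0; have [Cm Cm0 Hm] := nice_mul nP.
  pose C1 := Cm * `|M| * (Cm * C * C).
  have C10 : 0 <= C1 by rewrite !mulr_ge0.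
  exists (C + C1) => [|g [Pg dg] gc]; first exact: addr_ge0.
  have PV := H g Pg gc; split; first by apply: (nice_mono nP) PV; rewrite // lerDl.
  move=> e /dg[g' gg' Pg'].
  exists (fun x => - g' x * ((g x)^-1 * (g x)^-1)) => [x Dx|].
    apply: is_derive_inv; last exact: gg'.
    by rewrite -normr_gt0; apply: lt_le_trans (gc _ Dx).
  have := Hm _ _ _ _ (nice_opp Pg') (Hm _ _ _ _ PV PV); apply: (nice_mono nP) => //.
  by rewrite -{1}(ger0_norm (nice_pos nP Pg)) -/C1 lerDr.
- move=> F sF; have [C C0 H] := nice_comp nP sF; have [Cm Cm0 Hm] := nice_mul nP.
  have [B0 B00 Hb0] := nice_compb (smooth_partial 0 sF).
  have [B1 B10 Hb1] := nice_compb (smooth_partial 1 sF).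
  have [C1 C10 Hc0] := nice_comp nP (smooth_partial 0 sF).
  have [C2 C20 Hc1] := nice_comp nP (smooth_partial 1 sF).
  pose K : R := (Cm * B0 + Cm * C1) + (Cm * B1 + Cm * C2).
  have K0 : 0 <= K by rewrite !addr_ge0// mulr_ge0.
  exists (C + K) => [|u v Hu Hv M Huv]; first exact: addr_ge0.
  have M0 : 0 <= M by have [/(nice_pos nP)] := Huv 0.
  have Pu i : P 1 (u i) by case: (Hu i).
  have Pv i : P 1 (v i) by case: (Hv i).
  have Puv i : P M (fun x => u i x - v i x) by case: (Huv i).
  split.
    by apply: (nice_mono nP) (H _ _ Pu Pv _ Puv); rewrite // mulrDl lerDl mulr_ge0.
  move=> e Ee.
  have /choice[du du'] i : exists g, (forall x, D x -> is_derive x e (u i) (g x))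
      /\ P 1 g by have [_ /(_ e Ee)[g]] := Hu i; exists g.
  have /choice[dv dv'] i : exists g, (forall x, D x -> is_derive x e (v i) (g x))
      /\ P 1 g by have [_ /(_ e Ee)[g]] := Hv i; exists g.
  have duv i : P M (fun x => du i x - dv i x).
    have [_ /(_ e Ee)[g Hg Pg]] := Huv i; apply: (nice_ext nP) Pg => // x Dx.
    apply: is_derive_uniq (Hg x Dx) _; apply: is_derive_sub.
      by have [+ _] := du' i; apply.
    by have [+ _] := dv' i; apply.
  (* The derivative of [F (cv u x) - F (cv v x)], regrouped so that every product contains one
     difference, either of derivatives or of values of a partial derivative of [F]; each such factor
     contributes the [M]. *)
  exists (fun x =>
     (partial 0 F (cv u x) * (du 0 x - dv 0 x) +
     (partial 0 F (cv u x) - partial 0 F (cv v x)) * dv 0 x) +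
     (partial 1 F (cv u x) * (du 1 x - dv 1 x) +
     (partial 1 F (cv u x) - partial 1 F (cv v x)) * dv 1 x)) => [x Dx|].
    have Du : is_derive x e (fun x => F (cv u x))
        (partial 0 F (cv u x) * du 0 x + partial 1 F (cv u x) * du 1 x).
      by apply: (@is_derive_comp R V F u (du^~ x)) => // i; apply: (du' i).1.
    have Dv : is_derive x e (fun x => F (cv v x))
        (partial 0 F (cv v x) * dv 0 x + partial 1 F (cv v x) * dv 1 x).
      by apply: (@is_derive_comp R V F v (dv^~ x)) => // i; apply: (dv' i).1.
    have := is_derive_sub Du Dv.
    set a0 := partial 0 F _; set a1 := partial 1 F _.
    set b0 := partial 0 F _; set b1 := partial 1 F _.
    by congr (is_derive _ _ _ _); ring.
  apply: (nice_mono nP (M := K * M)).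
    by rewrite ler_wpM2r// lerDr.
  rewrite /K !mulrDl; apply: (nice_add nP) => //; apply: (nice_add nP) => //.
  - by apply: Hm; [exact: Hb0|exact: duv].
  - have := Hm _ _ _ _ (Hc0 _ _ Pu Pv _ Puv) (dv' 0).2.
    by rewrite mulr1 mulrA.
  - by apply: Hm; [exact: Hb1|exact: duv].
  - have := Hm _ _ _ _ (Hc1 _ _ Pu Pv _ Puv) (dv' 1).2.
    by rewrite mulr1 mulrA.
Qed.

End NiceTheory.

Lemma nice_iter D E P n : open D -> nice D P -> nice D (iter n (Der D E) P).
Proof. by move=> oD nP; elim: n => //= n IH; exact: nice_Der. Qed.

Lemma nice_Dern D E n : open D -> D !=set0 -> nice D (Dern D E n).
Proof. by move=> oD D0; apply: nice_iter => //; exact: nice_Bo. Qed.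

(** Unfolds the iteration from the inside: the base class for [f] and class [n] for its derivatives,
    the shape in which inductions on the order are carried out. *)
Lemma iter_DerP D E P n (M : R) f :
  iter n.+1 (Der D E) P M f <-> P M f /\ forall e, E e ->
  exists2 g, (forall x, D x -> is_derive x e f (g x)) &
    iter n (Der D E) P M g.
Proof.
split.
  elim: n f => [//|n IH] f [/IH[Pf _] df]; split=> //.
elim: n f => [//|n IH] f [Pf df]; split.
  apply: IH; split=> // e /df[g fg [Pg _]]; by exists g.
exact: df.
Qed.

Lemma iter_DerW D E P n (M : R) f :
  iter n.+1 (Der D E) P M f -> iter n (Der D E) P M f.
Proof. by case. Qed.

Lemma Dern_le D E n m (M : R) f : (m <= n)%N -> Dern D E n M f -> Dern D E m M f.
Proof.
elim: n => [|n IH]; first by rewrite leqn0 => /eqP ->.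
by rewrite leq_eqVlt => /orP[/eqP ->//|/IH H] [/H].
Qed.

Lemma Dern_sub (D D' E : set V) n (M : R) f : (forall x, D' x -> D x) ->
  Dern D E n M f -> Dern D' E n M f.
Proof.
move=> DD; elim: n f => [|n IH] f; first by move=> H x /DD; exact: H.
move=> /iter_DerP[Hf df]; apply/iter_DerP; split; first by move=> x /DD; exact: Hf.
by move=> e /df[g fg Hg]; exists g => [x /DD|]; [exact: fg|exact: IH].
Qed.

End BoundClasses.

(** * The Lax-Friedrichs scheme *)

Section OneDimensional.
Context {R : realType}.
Implicit Types (f g w : R -> R) (M N c h x : R).

Definition Bd (k : nat) : R -> (R -> R) -> Prop :=
  Dern (setT : set R) [set (1 : R)] k.

Lemma nice_Bd k : nice setT (Bd k).
Proof. by apply: nice_Dern; [exact: openT|exists 0]. Qed.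

Lemma Bd_bound k M f x : Bd k M f -> `|f x| <= M.
Proof. by move=> /(nice_bound (nice_Bd k)); apply. Qed.

Lemma BdS k M f : Bd k.+1 M f <-> Bo setT M f /\
  exists2 g, (forall x, is_derive x 1 f (g x)) & Bd k M g.
Proof.
split=> [/iter_DerP[Hf /(_ 1 erefl)[g fg Hg]]|[Hf [g fg Hg]]].
  by split=> //; exists g => // x; exact: fg.
by apply/iter_DerP; split=> // _ ->; exists g.
Qed.

Lemma Bd_derive k M f : Bd k.+1 M f ->
  (forall x, is_derive x 1 f ('D_1 f x)) /\ Bd k M ('D_1 f).
Proof.
move=> /BdS[_ [g fg Hg]].
have E : 'D_1 f = g by apply/funext => x; have [_ <-] := fg x.
by rewrite E; split.
Qed.

Lemma BdW k M f : Bd k.+1 M f -> Bd k M f.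
Proof. exact: iter_DerW. Qed.

Lemma Bd_le k m M f : (m <= k)%N -> Bd k M f -> Bd m M f.
Proof. exact: Dern_le. Qed.

Lemma is_derive_translate f c x (d : R) : is_derive (x + c) 1 f d ->
  is_derive x 1 (fun x => f (x + c)) d.
Proof.
move=> /is_derive_epsP H; apply/is_derive_epsP => eps /H[del del0 {}H].
by exists del => // h /H; rewrite addrA.
Qed.

Lemma Bd_translate k c M f : Bd k M f -> Bd k M (fun x => f (x + c)).
Proof.
elim: k f => [|k IH] f; first by move=> Hf x _; exact: Hf.
move=> /BdS[Hf [g fg /IH Hg]]; apply/BdS; split; first by move=> x _; exact: Hf.
by exists (fun x => g (x + c)) => // x; exact: is_derive_translate.
Qed.

Lemma Bd_increment k c M f : Bd k.+1 M f ->
  Bd k (M * `|c|) (fun x => f (x + c) - f x).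
Proof.
elim: k f => [|k IH] f.
  move=> /BdS[_ [g fg Hg]] x _.
  have := @mvt_le _ f g x (x + c) M fg (fun z => Hg z I).
  by rewrite addrAC subrr add0r.
move=> Hf; have /(nice_bound (nice_Bd k)) Hb := IH f (BdW Hf).
have [_ [g fg Hg]] := (BdS _ _ _).1 Hf; apply/BdS; split=> //.
exists (fun x => g (x + c) - g x); last exact: IH.
by move=> x; apply: is_derive_sub => //; exact: is_derive_translate.
Qed.

Lemma Bd_taylor k c M f df : Bd k.+2 M f -> (forall x, is_derive x 1 f (df x)) ->
  Bd k (M * c ^+ 2) (fun x => f (x + c) - f x - c * df x).
Proof.
elim: k f df => [|k IH] f df Hf fd.
  have [_ [g fg /BdS[_ [g' gg' Hg']]]] := (BdS _ _ _).1 Hf.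
  move=> x _.
  have gE : g = df by apply/funext => z; exact: is_derive_uniq (fg z) (fd z).
  have := @taylor_dir _ _ f df g' 1 x c M fd.
  rewrite -gE [c *: 1]mulr1 [c + x]addrC.
  by apply=> // z; exact: Hg'.
have [_ [g fg Hg]] := (BdS _ _ _).1 Hf.
have gE : g = df by apply/funext => z; exact: is_derive_uniq (fg z) (fd z).
have [dg Hdg] := Bd_derive Hg.
have Hf' := IH f df (BdW Hf) fd.
apply/BdS; split; first exact: (nice_bound (nice_Bd k) Hf').
exists (fun x => g (x + c) - g x - c * 'D_1 g x); last exact: IH.
move=> x; apply: is_derive_sub; last by apply: is_derive_scale; rewrite -gE.
by apply: is_derive_sub => //; exact: is_derive_translate.
Qed.

(** A convex combination of translates does not increase the supremum. Its derivative is the same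
    combination of translates of [w'], plus [h * th' * q], where the difference quotient [q] of [w]
    is bounded by the derivative of [w] independently of [h]; the induction absorbs this term into
    the source. So, apart from the source, one step multiplies the bounds of all orders by
    [1 + O(h)]. *)
Lemma Bd_linear_step k (Lam : R) : 0 <= Lam -> exists2 C : R, 0 <= C &
  forall h (th w r : R -> R) (M K N : R), 0 < h ->
    (forall x, 0 <= th x <= 1) -> Bd k K th -> Bd k M w -> Bd k N r ->
  Bd k (M + h * (C * (K * M + N))) (fun x =>
    (1 - th x) * w (x - Lam * h) + th x * w (x + Lam * h) + h * r x).
Proof.
move=> Lam0; elim: k => [|k [C C0 IH]].
  exists 1 => // h th w r M K N h0 th01 Hth Hw Hr x _.
  have K0 : 0 <= K by exact: (nice_pos (nice_Bd 0) Hth).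
  have M0 : 0 <= M by exact: (nice_pos (nice_Bd 0) Hw).
  have [/andP[t0 t1]] := th01 x.
  have /ler_normlP[] := Hw (x - Lam * h) I; have /ler_normlP[] := Hw (x + Lam * h) I.
  have /ler_normlP[] := Hr x I; move: (th x) t0 t1 (w _) (w _) (r x) => t t0 t1 a b c.
  move=> c1 c2 a1 a2 b1 b2; rewrite mul1r ler_norml.
  have KM : 0 <= h * (K * M) by rewrite !mulr_ge0// ltW.
  have := @ler_wpM2l _ h (ltW h0) _ _ c1; have := @ler_wpM2l _ h (ltW h0) _ _ c2.
  have t1' : 0 <= 1 - t by lra.
  have := @ler_wpM2l _ t t0 _ _ b1; have := @ler_wpM2l _ t t0 _ _ b2.
  have := @ler_wpM2l _ (1 - t) t1' _ _ a1; have := @ler_wpM2l _ (1 - t) t1' _ _ a2.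
  have := @ler_wpM2l _ t t0 _ _ a1; have := @ler_wpM2l _ t t0 _ _ a2.
  have := @ler_wpM2l _ (1 - t) t1' _ _ b1; have := @ler_wpM2l _ (1 - t) t1' _ _ b2.
  rewrite !mulrDr; lra.
have [Cm Cm0 Hm] := nice_mul (nice_Bd k).
exists (C + C * (Cm * (2 * Lam))) => [|h th w r M K N h0 th01 Hth Hw Hr].
  by rewrite addr_ge0// !mulr_ge0.
have K0 : 0 <= K by exact: (nice_pos (nice_Bd _) Hth).
have M0 : 0 <= M by exact: (nice_pos (nice_Bd _) Hw).
have N0 : 0 <= N by exact: (nice_pos (nice_Bd _) Hr).
have le1 : C * (K * M + N) <= (C + C * (Cm * (2 * Lam))) * (K * M + N).
  by rewrite ler_wpM2r ?addr_ge0 ?mulr_ge0// lerDl !mulr_ge0.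
have low := IH _ _ _ _ _ _ _ h0 th01 (BdW Hth) (BdW Hw) (BdW Hr).
apply/BdS; split.
  move=> x _; apply: (le_trans (Bd_bound x low)).
  by rewrite lerD2l ler_wpM2l// ltW.
have [dth Hdth] := Bd_derive Hth; have [dw Hdw] := Bd_derive Hw.
have [dr Hdr] := Bd_derive Hr.
pose q x := h^-1 * (w (x + Lam * h) - w (x - Lam * h)).
have Hq : Bd k (2 * Lam * M) q.
  have := Bd_translate (- (Lam * h)) (Bd_increment (2 * (Lam * h)) Hw).
  move=> /(nice_scale (nice_Bd k) h^-1).
  rewrite !ger0_norm ?invr_ge0 ?mulr_ge0 ?(ltW h0)//.
  rewrite (_ : h^-1 * _ = 2 * Lam * M); last by field; rewrite gt_eqF.
  apply: (nice_ext (nice_Bd k)) => x _; rewrite /q; congr (_ * (w _ - w _)); ring.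
exists (fun x => (1 - th x) * 'D_1 w (x - Lam * h) + th x * 'D_1 w (x + Lam * h)
   + h * ('D_1 r x + 'D_1 th x * q x)).
  move=> x.
  have := is_derive_add (is_derive_add (is_derive_mul
     (is_derive_sub (is_derive_const 1 x 1) (dth x))
     (is_derive_translate (dw (x - Lam * h))))
     (is_derive_mul (dth x) (is_derive_translate (dw (x + Lam * h)))))
     (is_derive_scale h (dr x)).
  congr (is_derive _ _ _ _); rewrite /q; field; rewrite gt_eqF//.
have := IH _ _ _ _ _ _ _ h0 th01 (BdW Hth) Hdw
  (nice_add (nice_Bd k) Hdr (Hm _ _ _ _ Hdth Hq)).
apply: (nice_mono (nice_Bd k)); rewrite lerD2l ler_wpM2l ?(ltW h0)//.
rewrite mulrDl -subr_ge0 (_ : _ - _ = C * (Cm * (2 * Lam)) * N); last by ring.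
by rewrite !mulr_ge0.
Qed.

End OneDimensional.

(** * Stability and consistency of the scheme *)

Section Scheme.
Context {R : realType}.
Variables (lam f : 'I_2 -> 'cV[R]_2 -> R) (Lam : R).
Hypotheses (lam_smooth : forall i, smooth (lam i))
  (f_smooth : forall i, smooth (f i)) (f0 : forall i, f i 0 = 0)
  (Lam0 : 0 < Lam)
  (lam_le : forall i (y : 'cV[R]_2), (forall j, `|y j 0| <= 1) -> `|lam i y| <= Lam).
Implicit Types (u v : 'I_2 -> R -> R) (h M x : R) (i : 'I_2).

Definition weight u i x : R := 2^-1 * (1 - Lam^-1 * lam i (cv u x)).

(* One Lax-Friedrichs step of length [h], with space increment [Lam * h]; the
   weights make it monotone and consistent with speed [lam i]. *)
Definition step h u i x : R :=
  (1 - weight u i x) * u i (x - Lam * h) + weight u i x * u i (x + Lam * h)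
  + h * - f i (cv u x).

Definition rhs u i x : R := - (lam i (cv u x) * 'D_1 (u i) x + f i (cv u x)).

Lemma weight01 u i x : (forall j, `|u j x| <= 1) -> 0 <= weight u i x <= 1.
Proof.
move=> u1; have : `|Lam^-1 * lam i (cv u x)| <= 1.
  rewrite normrM gtr0_norm ?invr_gt0// mulrC ler_pdivrMr// mul1r.
  by apply: lam_le => j; rewrite cvE.
by rewrite /weight ler_norml => /andP[? ?]; apply/andP; lra.
Qed.

Lemma weight_Bd k : exists2 C : R, 0 <= C & forall u, (forall i, Bd k 1 (u i)) ->
  forall i, Bd k C (weight u i).
Proof.
have nk := nice_Bd (R := R) k.
have /choice[C HC] i : exists C : R, 0 <= C /\ forall u, (forall i, Bd k 1 (u i)) ->
    Bd k C (fun x => lam i (cv u x)).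
  by have [C C0 H] := nice_compb nk (lam_smooth i); exists C.
exists (\sum_i `|2^-1| * (`|1| + `|- Lam^-1| * C i)) => [|u Hu i].
  by apply: sumr_ge0 => i _; rewrite mulr_ge0// addr_ge0// mulr_ge0// (HC i).1.
have := nice_scale nk (2^-1)
  (nice_add nk (nice_cst nk 1) (nice_scale nk (- Lam^-1) ((HC i).2 u Hu))).
move=> /(nice_ext nk (g := weight u i)) H.
apply: (nice_mono nk _ (H _)) => [|x _]; last by rewrite mulNr.
rewrite (bigD1 i)//= lerDl; apply: sumr_ge0 => j _.
by rewrite mulr_ge0// addr_ge0// mulr_ge0// (HC j).1.
Qed.

Lemma f_Bd k : exists2 C : R, 0 <= C & forall u M, M <= 1 ->
  (forall i, Bd k M (u i)) -> forall i, Bd k (C * M) (fun x => - f i (cv u x)).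
Proof.
have nk := nice_Bd (R := R) k.
have /choice[C HC] i : exists C : R, 0 <= C /\ forall u M, M <= 1 ->
    (forall i, Bd k M (u i)) -> Bd k (C * M) (fun x => f i (cv u x)).
  by have [C C0 H] := nice_comps nk (f_smooth i) (f0 i); exists C.
exists (\sum_i C i) => [|u M M1 Hu i].
  by apply: sumr_ge0 => i _; exact: (HC i).1.
have M0 := nice_pos nk (Hu i).
apply: (nice_mono nk _ (nice_opp nk ((HC i).2 u M M1 Hu))); rewrite ler_wpM2r//.
by rewrite (bigD1 i)//= lerDl; apply: sumr_ge0 => j _; exact: (HC j).1.
Qed.

(** The increase is linear in [M] because [f i 0 = 0]; for [M <= 1] the weights lie in [[0, 1]] and
    their derivatives are uniformly bounded. *)
Lemma step_bound k : exists2 C : R, 0 <= C & forall h M u, 0 < h -> M <= 1 ->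
  (forall i, Bd k M (u i)) -> forall i, Bd k (M * (1 + h * C)) (step h u i).
Proof.
have nk := nice_Bd (R := R) k.
have [C C0 HC] := Bd_linear_step k (ltW Lam0).
have [K K0 HK] := weight_Bd k; have [N N0 HN] := f_Bd k.
exists (C * (K + N)) => [|h M u h0 M1 Hu i]; first by rewrite mulr_ge0// addr_ge0.
have Hu1 j : Bd k 1 (u j) by apply: (nice_mono nk _ (Hu j)).
have := HC _ _ _ _ _ _ _ h0 _ (HK u Hu1 i) (Hu i) (HN u M M1 Hu i).
rewrite (_ : M + _ = M * (1 + h * (C * (K + N)))); last by ring.
by apply=> x; apply: weight01 => j; exact: Bd_bound (Hu1 j).
Qed.

Lemma step_lip k : exists2 C : R, 0 <= C & forall h u, 0 < h ->
  (forall i, Bd k.+1 1 (u i)) -> forall i, Bd k (C * h) (fun x => step h u i x - u i x).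
Proof.
have nk := nice_Bd (R := R) k; have [Cm Cm0 Hm] := nice_mul nk.
have [K K0 HK] := weight_Bd k; have [N N0 HN] := f_Bd k.
exists (Cm * (1 + K) * Lam + Cm * K * Lam + N) => [|h u h0 Hu i].
  by rewrite !addr_ge0// !mulr_ge0// ?(ltW Lam0)// addr_ge0.
have Hu1 j : Bd k 1 (u j) by apply: BdW.
have Hw := HK u Hu1 i.
have Hw' := nice_sub nk (nice_cst nk 1) Hw; rewrite normr1 in Hw'.
have := nice_add nk (nice_add nk
  (Hm _ _ _ _ Hw' (Bd_increment (- (Lam * h)) (Hu i)))
  (Hm _ _ _ _ Hw (Bd_increment (Lam * h) (Hu i))))
  (nice_scale nk h (HN u 1 (lexx _) Hu1 i)).
rewrite normrN !ger0_norm ?mulr_ge0 ?(ltW Lam0) ?(ltW h0)//.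
rewrite [X in Bd k X _ -> _](_ : _ = (Cm * (1 + K) * Lam + Cm * K * Lam + N) * h); last by ring.
by apply: (nice_ext nk) => x _; rewrite /step; ring.
Qed.

Lemma step_cons k : exists2 C : R, 0 <= C & forall h u, 0 < h ->
  (forall i, Bd k.+2 1 (u i)) ->
  forall i, Bd k (C * h ^+ 2) (fun x => step h u i x - u i x - h * rhs u i x).
Proof.
have nk := nice_Bd (R := R) k; have [Cm Cm0 Hm] := nice_mul nk.
have [K K0 HK] := weight_Bd k.
exists ((Cm * (1 + K) + Cm * K) * Lam ^+ 2) => [|h u h0 Hu i].
  by rewrite mulr_ge0 ?sqr_ge0// addr_ge0// mulr_ge0// addr_ge0.
have Hu1 j : Bd k 1 (u j) by apply/BdW/BdW.
have Hw := HK u Hu1 i.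
have Hw' := nice_sub nk (nice_cst nk 1) Hw; rewrite normr1 in Hw'.
have [du _] := Bd_derive (Hu i).
have := nice_add nk (Hm _ _ _ _ Hw' (Bd_taylor (- (Lam * h)) (Hu i) du))
  (Hm _ _ _ _ Hw (Bd_taylor (Lam * h) (Hu i) du)).
rewrite [X in Bd k X _ -> _](_ : _ = (Cm * (1 + K) + Cm * K) * Lam ^+ 2 * h ^+ 2); last by ring.
apply: (nice_ext nk) => x _; rewrite /step /rhs.
(* The definition of the weights, solved for the speed: the first-order terms of the two Taylor
   expansions then add up to [- h * lam i * u']. *)
have -> : lam i (cv u x) = Lam * (1 - 2 * weight u i x).
  by rewrite /weight; field; rewrite gt_eqF.
ring.
Qed.

Lemma rhs_bound k : exists2 C : R, 0 <= C & forall u M, M <= 1 ->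
  (forall i, Bd k.+1 M (u i)) -> forall i, Bd k (C * M) (rhs u i).
Proof.
have nk := nice_Bd (R := R) k; have [Cm Cm0 Hm] := nice_mul nk.
have [N N0 HN] := f_Bd k.
have /choice[A HA] i : exists C : R, 0 <= C /\ forall u, (forall i, Bd k 1 (u i)) ->
    Bd k C (fun x => lam i (cv u x)).
  by have [C C0 H] := nice_compb nk (lam_smooth i); exists C.
exists (\sum_i Cm * A i + N) => [|u M M1 Hu i].
  by apply: addr_ge0 => //; apply: sumr_ge0 => i _; rewrite mulr_ge0// (HA i).1.
have M0 := nice_pos nk (BdW (Hu i)).
have Hu1 j : Bd k 1 (u j) by apply: (nice_mono nk _ (BdW (Hu j))).
have Hu' j : Bd k M (u j) by apply: BdW.
have [_ Hdu] := Bd_derive (Hu i).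
have H := nice_add nk (nice_opp nk (Hm _ _ _ _ ((HA i).2 u Hu1) Hdu)) (HN u M M1 Hu' i).
have {}H : Bd k (Cm * A i * M + N * M) (rhs u i).
  by apply: (nice_ext nk) H => x _; rewrite /rhs opprD.
apply: (nice_mono nk _ H); rewrite [leRHS]mulrDl lerD2r ler_wpM2r//.
rewrite (bigD1 i)//= lerDl; apply: sumr_ge0 => j _; rewrite mulr_ge0//.
exact: (HA j).1.
Qed.

Lemma rhs_lip k : exists2 C : R, 0 <= C & forall u v M,
  (forall i, Bd k.+1 1 (u i)) -> (forall i, Bd k.+1 1 (v i)) ->
  (forall i, Bd k.+1 M (fun x => u i x - v i x)) ->
  forall i, Bd k (C * M) (fun x => rhs u i x - rhs v i x).
Proof.
have nk := nice_Bd (R := R) k; have [Cm Cm0 Hm] := nice_mul nk.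
have /choice[A HA] i : exists C : R, 0 <= C /\ forall u, (forall i, Bd k 1 (u i)) ->
    Bd k C (fun x => lam i (cv u x)).
  by have [C C0 H] := nice_compb nk (lam_smooth i); exists C.
have /choice[L HL] i : exists C : R, 0 <= C /\ forall u v,
    (forall i, Bd k 1 (u i)) -> (forall i, Bd k 1 (v i)) ->
    forall M, (forall i, Bd k M (fun x => u i x - v i x)) ->
    Bd k (C * M) (fun x => lam i (cv u x) - lam i (cv v x)).
  by have [C C0 H] := nice_comp nk (lam_smooth i); exists C.
have /choice[G HG] i : exists C : R, 0 <= C /\ forall u v,
    (forall i, Bd k 1 (u i)) -> (forall i, Bd k 1 (v i)) ->
    forall M, (forall i, Bd k M (fun x => u i x - v i x)) ->
    Bd k (C * M) (fun x => f i (cv u x) - f i (cv v x)).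
  by have [C C0 H] := nice_comp nk (f_smooth i); exists C.
pose C i := Cm * A i + Cm * L i + G i.
have C0 i : 0 <= C i.
  rewrite !addr_ge0 ?mulr_ge0//; [exact: (HA i).1|exact: (HL i).1|exact: (HG i).1].
exists (\sum_i C i) => [|u v M Hu Hv Huv i]; first exact: sumr_ge0.
have Hu1 j : Bd k 1 (u j) by apply: BdW.
have Hv1 j : Bd k 1 (v j) by apply: BdW.
have Huv1 j : Bd k M (fun x => u j x - v j x) by apply: BdW.
have M0 := nice_pos nk (Huv1 i).
have [du _] := Bd_derive (Hu i); have [dv Hdv] := Bd_derive (Hv i).
have [duv Hduv] := Bd_derive (Huv i).
have E x : 'D_1 (fun x => u i x - v i x) x = 'D_1 (u i) x - 'D_1 (v i) x.
  by apply: is_derive_uniq (duv x) _; exact: is_derive_sub.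
have H := nice_opp nk (nice_add nk (nice_add nk
  (Hm _ _ _ _ ((HA i).2 u Hu1) Hduv)
  (Hm _ _ _ _ ((HL i).2 u v Hu1 Hv1 M Huv1) Hdv))
  ((HG i).2 u v Hu1 Hv1 M Huv1)).
have {}H : Bd k (C i * M) (fun x => rhs u i x - rhs v i x).
  rewrite (_ : C i * M = Cm * A i * M + Cm * (L i * M) * 1 + G i * M); last first.
    by rewrite /C; ring.
  by apply: (nice_ext nk) H => x _; rewrite E /rhs; ring.
apply: (nice_mono nk _ H); rewrite ler_wpM2r// (bigD1 i)//= lerDl.
exact: sumr_ge0.
Qed.

(** Discrete Gronwall inequality, from [1 + h * C <= expR (h * C)]. The smallness of [M] keeps all
    iterates up to time [T] below 1, the range in which [step_bound] applies. *)
Lemma iter_step_bound k : exists2 C : R, 0 <= C & forall T h M u n, 0 < h ->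
  M * expR (C * T) <= 1 -> n%:R * h <= T -> (forall i, Bd k M (u i)) ->
  forall i, Bd k (M * expR (C * (n%:R * h))) (iter n (step h) u i).
Proof.
have nk := nice_Bd (R := R) k; have [C C0 HC] := step_bound k.
exists C => // T h M u n h0 MT nT Hu.
have M0 := nice_pos nk (Hu 0).
elim: n nT => [|n IH] nT i; first by rewrite mul0r mulr0 expR0 mulr1; exact: Hu.
have nT' : n%:R * h <= T.
  by apply: le_trans nT; rewrite ler_wpM2r ?(ltW h0)// ler_nat.
have M1 : M * expR (C * (n%:R * h)) <= 1.
  by apply: le_trans MT; rewrite ler_wpM2l// ler_expR ler_wpM2l.
apply: (nice_mono nk _ (HC _ _ _ h0 M1 (IH nT') i)).
rewrite -mulrA ler_wpM2l// -addn1 natrD mulrDl mul1r mulrDr expRD.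
by rewrite ler_wpM2l ?expR_ge0// mulrC expR_ge1Dx.
Qed.

Lemma iter_step_lip k : exists2 C : R, 0 <= C & forall h u n, 0 < h ->
  (forall m, (m < n)%N -> forall i, Bd k.+1 1 (iter m (step h) u i)) ->
  forall i, Bd k (C * (n%:R * h)) (fun x => iter n (step h) u i x - u i x).
Proof.
have nk := nice_Bd (R := R) k; have [C C0 HC] := step_lip k.
exists C => // h u n h0; elim: n => [_ i|n IH Hn i].
  rewrite mul0r mulr0; apply: (nice_ext nk) (nice_0 nk) => x _; by rewrite subrr.
have := nice_add nk (HC _ _ h0 (Hn n (ltnSn n)) i) (IH (fun m mn => Hn m (ltnW mn)) i).
rewrite (_ : _ + _ = C * (n.+1%:R * h)); last by rewrite -addn1 natrD; ring.
by apply: (nice_ext nk) => x _; rewrite iterS; ring.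
Qed.

(** Consistency over many steps: the remainder is quadratic in the total time [n * h] with a
    constant independent of [h], so the estimate survives [h -> 0] and yields the equation in the
    limit. *)
Lemma iter_step_expand k : exists2 C : R, 0 <= C & forall h u n, 0 < h ->
  (forall m, (m <= n)%N -> forall i, Bd k.+2 1 (iter m (step h) u i)) ->
  forall i, Bd k (C * (n%:R * h) ^+ 2)
    (fun x => iter n (step h) u i x - u i x - n%:R * h * rhs u i x).
Proof.
have nk := nice_Bd (R := R) k; have [C1 C10 H1] := step_cons k.
have [C2 C20 H2] := rhs_lip k; have [C3 C30 H3] := iter_step_lip k.+1.
(* [C1] pays for the consistency error of a step, [C2 * C3] for the drift of the right-hand side,
   which after [n] steps is at most [C2 * C3 * n * h]. *)
pose C := C1 + C2 * C3; have C0 : 0 <= C by rewrite addr_ge0// mulr_ge0.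
exists C => // h u n h0; elim: n => [_ i|n IH Hn i].
  rewrite mul0r expr0n mulr0; apply: (nice_ext nk) (nice_0 nk) => x _.
  by rewrite mul0r subrr subr0.
have Hn' m (mn : (m <= n)%N) := Hn m (leq_trans mn (leqnSn n)).
have Hnn := Hn' n (leqnn n).
have Hlip := H3 h u n h0 (fun m mn => Hn' m (ltnW mn)).
have Hr := H2 (iter n (step h) u) u _ (fun j => BdW (Hnn j))
  (fun j => BdW (Hn' 0%N (leq0n n) j)) Hlip i.
have H := nice_add nk (nice_add nk (H1 _ _ h0 Hnn i) (IH Hn' i)) (nice_scale nk h Hr).
apply: (nice_mono nk _ (nice_ext nk _ H)); last first.
  by move=> x _; rewrite iterS -(addn1 n) natrD; ring.
rewrite gtr0_norm// -(addn1 n) natrD -subr_ge0.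
have -> : C * ((n%:R + 1) * h) ^+ 2 - (C1 * h ^+ 2 + C * (n%:R * h) ^+ 2 +
  h * (C2 * (C3 * (n%:R * h)))) =
  (C2 * C3 + n%:R * (C1 + C1 + C2 * C3)) * h ^+ 2 by rewrite /C; ring.
by rewrite mulr_ge0 ?sqr_ge0// addr_ge0 ?mulr_ge0// !addr_ge0 ?mulr_ge0.
Qed.

End Scheme.

(** * Limits along an ultrafilter *)

Section UltrafilterLimits.
Context {R : realType}.
Variable G : set_system nat.
Hypothesis ultraG : UltraFilter G.
Implicit Types (a : nat -> R) (u : nat -> R -> R).

#[local] Existing Instance ultraG.

Lemma bounded_ultra_cvg a (M : R) : (forall m, `|a m| <= M) ->
  a @ G --> lim (a @ G).
Proof.
move=> aM; apply/cvg_ex => /=.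
have aF : (a @ G) `[- M, M]%classic.
  have H m : `[- M, M]%classic (a m) by rewrite /= in_itv /= -ler_norml.
  exact: (@filterE _ G _ _ H).
have [p [_ clp]] := @segment_compact R (- M) M (a @ G) _ aF.
exists p => A Ap.
have [//|nGA] := in_ultra_setVsetC (a @^-1` A) ultraG.
by have [x []] := clp (~` A) A nGA Ap.
Qed.

Lemma ultra_lim_le (a b : nat -> R) (l m : R) : a @ G --> l -> b @ G --> m ->
  (forall n, a n <= b n) -> l <= m.
Proof. by move=> al bm ab; apply: ler_cvg_to al bm _; exact: nearW. Qed.

(** Taylor's inequality with a uniform quadratic remainder is a closed condition: the limits of the
    functions and of their derivatives satisfy it at each point, without any uniform convergence. *)
Lemma is_derive_ultra u (M : R) : (forall m, Bd 2 M (u m)) -> forall x : R,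
  is_derive x 1 (fun x => lim (u^~ x @ G)) (lim ((fun m => 'D_1 (u m) x) @ G)).
Proof.
move=> Hu x; apply: (@is_derive_sqr_glob _ _ _ _ _ _ M) => h.
have Hc z := bounded_ultra_cvg (fun m => Bd_bound z (Hu m)).
have Hd := bounded_ultra_cvg (fun m => Bd_bound x (Bd_derive (Hu m)).2).
apply: (@ultra_lim_le
  (fun m => `|u m (h *: 1 + x) - u m x - h * 'D_1 (u m) x|)
  (fun=> M * h ^+ 2)) => [||m].
- exact: cvg_norm (cvgB (cvgB (Hc (h *: 1 + x)) (Hc x)) (cvgM (cvg_cst h) Hd)).
- exact: cvg_cst.
have [_ [g fg /BdS[_ [g' gg' Hg']]]] := (BdS _ _ _).1 (Hu m).
have -> : 'D_1 (u m) x = g x by have [_ <-] := fg x.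
by apply: taylor_dir fg gg' _ => z; exact: Hg'.
Qed.

(** The bound [M], of one order more than the conclusion, provides differentiability in the limit;
    the quantitative bounds are the [N m], which pass to the limit. *)
Lemma Bd_ultra k u (M : R) (N : nat -> R) (N' : R) :
  (forall m, Bd k.+1 M (u m)) -> (forall m, Bd k (N m) (u m)) ->
  N @ G --> N' -> Bd k N' (fun x => lim (u^~ x @ G)).
Proof.
move=> Hu HN NN'; elim: k u Hu HN => [|k IH] u Hu HN.
  move=> x _; have /cvg_norm C := bounded_ultra_cvg (fun m => Bd_bound x (Hu m)).
  by apply: ultra_lim_le C NN' _ => m; exact: Bd_bound (HN m).
have B m := BdW (HN m).
have /(nice_bound (nice_Bd k)) Hb := IH u (fun m => BdW (Hu m)) B.
apply/BdS; split=> //.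
exists (fun x => lim ((fun m => 'D_1 (u m) x) @ G)).
  by apply: is_derive_ultra => m; exact: Bd_le (Hu m).
apply: (IH (fun m => 'D_1 (u m))) => m.
  exact: (Bd_derive (Hu m)).2.
exact: (Bd_derive (HN m)).2.
Qed.

End UltrafilterLimits.

(** * Solutions for positive times *)

Section ForwardProblem.
Context {R : realType}.
Variables (lam f : 'I_2 -> 'cV[R]_2 -> R).
Hypotheses (lam_smooth : forall i, smooth (lam i))
  (f_smooth : forall i, smooth (f i)) (f0 : forall i, f i 0 = 0).
Implicit Types (u v : 'I_2 -> R -> R).

Lemma cvg_cv (G : set_system nat) (FG : ProperFilter G)
    (F : 'cV[R]_2 -> R) (a : nat -> 'I_2 -> R -> R) (u : 'I_2 -> R -> R) x :
  continuous F -> (forall i, a^~ i ^~ x @ G --> u i x) ->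
  (fun m => F (cv (a m) x)) @ G --> F (cv u x).
Proof.
move=> cF au; apply/cvgrPdist_le => eps eps0.
have [del del0 H] := continuous_cvP (cv u x) cF eps0.
have /cvgrPdist_lt/(_ _ del0) A0 := au 0.
have /cvgrPdist_lt/(_ _ del0) A1 := au 1.
near=> m; rewrite distrC; apply: H.
by apply: ord2P; rewrite !cvE distrC; near: m.
Unshelve. all: by end_near. Qed.

Lemma speed_bound : exists2 Lam : R, 0 < Lam & forall i (y : 'cV[R]_2),
  (forall j, `|y j 0| <= 1) -> `|lam i y| <= Lam.
Proof.
have [C0 C00 H0] := continuous_box_bounded 1 (smooth_continuous (lam_smooth 0)).
have [C1 C10 H1] := continuous_box_bounded 1 (smooth_continuous (lam_smooth 1)).
exists (C0 + C1 + 1) => [|i y y1]; first by rewrite ltr_wpDl// addr_ge0.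
move: i; apply: ord2P.
  by apply: le_trans (H0 y y1) _; rewrite -addrA lerDl addr_ge0.
by apply: le_trans (H1 y y1) _; rewrite [C0 + _]addrC -addrA lerDl addr_ge0.
Qed.

Lemma truncn_scale_itv (t : R) m (h := m.+1%:R^-1 : R) : 0 <= t ->
  (Num.truncn (t * m.+1%:R))%:R * h <= t < (Num.truncn (t * m.+1%:R))%:R * h + h.
Proof.
rewrite /h; set q : R := m.+1%:R => t0; have q0 : 0 < q by rewrite ltr0n.
have /andP[a b] := truncn_itv (mulr_ge0 t0 (ltW q0)).
rewrite ler_pdivrMr// a /= -{2}[q^-1]mul1r -mulrDl ltr_pdivlMr//.
by rewrite natr1.
Qed.

Lemma truncn_scale_cvg (G : set_system nat) (FG : ProperFilter G) (t : R) :
  \oo `<=` G -> 0 <= t ->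
  (fun m => (Num.truncn (t * m.+1%:R))%:R * m.+1%:R^-1) @ G --> t.
Proof.
move=> eG t0; apply/cvgrPdist_le => eps eps0.
have /cvgrPdist_lt/(_ _ eps0) A := @cvg_harmonic R.
apply: filterS (eG _ A) => m /=; rewrite sub0r normrN ger0_norm// => hm.
have /andP[a b] := truncn_scale_itv m t0.
rewrite ger0_norm ?subr_ge0// lerBlDr addrC; apply/ltW/(lt_trans b).
by rewrite ltrD2l.
Qed.

(** For data of order [k.+2] the iterates keep this order uniformly and the limit keeps [k.+1]. The
    equation is recorded as an expansion in time with quadratic remainder, valid in the class of
    order [k], so that it can later be differentiated in [x]. *)
Lemma forward_solution k (T : R) : 0 <= T -> exists2 C : R, 0 <= C &
  forall M u0, C * M <= 1 -> (forall i, Bd k.+2 M (u0 i)) ->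
  exists U : R -> 'I_2 -> R -> R,
  [/\ U 0 = u0,
      forall t : R, 0 <= t <= T -> forall i, Bd k.+1 (C * M) (U t i),
      forall s t : R, 0 <= s <= t -> t <= T -> forall i,
        Bd k.+1 (C * (t - s)) (fun x => U t i x - U s i x),
      forall s t : R, 0 <= s <= t -> t <= T -> forall i,
        Bd k (C * (t - s) ^+ 2)
          (fun x => U t i x - U s i x - (t - s) * rhs lam f (U s) i x) &
      forall p, (forall i x, u0 i (x + p) = u0 i x) ->
        forall t i x, U t i (x + p) = U t i x].
Proof.
move=> T0.
(* A single ultrafilter finer than the neighbourhoods of infinity gives the limits for all [t], [i],
   [x] and all derivatives, so that they are mutually compatible. *)
have [G [ultraG eG]] := @ultraFilterLemma nat \oo _.
have [Lam Lam0 lam_le] := speed_bound.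
have [C1 C10 H1] := iter_step_bound lam_smooth f_smooth f0 Lam0 lam_le k.+2.
have [C2 C20 H2] := iter_step_lip lam_smooth f_smooth f0 Lam0 k.+1.
have [C3 C30 H3] := iter_step_expand lam_smooth f_smooth f0 Lam0 k.
have [C4 C40 H4] := rhs_bound lam_smooth f_smooth f0 k.+1.
pose C := expR (C1 * T) + C2 + C3.
have C0 : 0 <= C by rewrite !addr_ge0// expR_ge0.
have C1C : expR (C1 * T) <= C by rewrite /C -addrA lerDl addr_ge0.
have C2C : C2 <= C by rewrite /C addrAC lerDr addr_ge0// expR_ge0.
have C3C : C3 <= C by rewrite /C lerDr addr_ge0// expR_ge0.
exists C => // M u0 CM Hu0.
have M0 : 0 <= M by exact: (nice_pos (nice_Bd _) (Hu0 0)).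
have MT : M * expR (C1 * T) <= 1.
  by apply: le_trans CM; rewrite mulrC ler_wpM2r.
pose h m : R := m.+1%:R^-1.
have h0 m : 0 < h m by rewrite invr_gt0.
pose N (t : R) m := Num.truncn (t * m.+1%:R).
pose S m n := iter n (step lam f Lam (h m)) u0.
pose U t i x := lim ((fun m => S m (N t m) i x) @ G).
have NT (t : R) m n : 0 <= t <= T -> (n <= N t m)%N -> n%:R * h m <= T.
  move=> /andP[t0 tT] nN; apply: le_trans tT.
  have /andP[a _] := truncn_scale_itv m t0; apply: le_trans a.
  by rewrite ler_wpM2r ?(ltW (h0 m))// ler_nat.
have SM (t : R) m n i : 0 <= t <= T -> (n <= N t m)%N ->
    Bd k.+2 (M * expR (C1 * T)) (S m n i).
  move=> tT nN; have nT := NT t m n tT nN.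
  apply: (nice_mono (nice_Bd _) _ (H1 T (h m) M u0 n (h0 m) MT nT Hu0 i)).
  by rewrite ler_wpM2l// ler_expR ler_wpM2l.
have S1 (t : R) m n i : 0 <= t <= T -> (n <= N t m)%N -> Bd k.+2 1 (S m n i).
  by move=> tT nN; apply: (nice_mono (nice_Bd _) MT (SM t m n i tT nN)).
have cU (t : R) i x : 0 <= t <= T -> (fun m => S m (N t m) i x) @ G --> U t i x.
  move=> tT; apply: (@bounded_ultra_cvg _ _ ultraG _ 1) => m.
  exact: Bd_bound (S1 t m (N t m) i tT (leqnn _)).
pose n s t m := (N t m - N s m)%N.
have Nst (s t : R) m : 0 <= s <= t -> (n s t m + N s m)%N = N t m.
  move=> /andP[s0 st]; rewrite /n subnK// /N; apply: le_truncn.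
  by rewrite ler_wpM2r.
have Sst (s t : R) m : 0 <= s <= t ->
    S m (N t m) = iter (n s t m) (step lam f Lam (h m)) (S m (N s m)).
  by move=> st; rewrite -(Nst s t m st) /S iterD.
have cn (s t : R) : 0 <= s <= t -> (fun m => (n s t m)%:R * h m) @ G --> t - s.
  move=> /andP[s0 st].
  rewrite (_ : (fun m => _) = fun m => (N t m)%:R * h m - (N s m)%:R * h m).
    apply: cvgB; first exact: truncn_scale_cvg eG (le_trans s0 st).
    exact: truncn_scale_cvg eG s0.
  by apply/funext => m; rewrite -(Nst s t m) ?s0// natrD mulrDl addrK.
have S1n (s t : R) m j i : 0 <= s <= t -> t <= T -> (j <= n s t m)%N ->
    Bd k.+2 1 (iter j (step lam f Lam (h m)) (S m (N s m)) i).
  move=> /andP[s0 st] tT jn; rewrite /S -iterD; apply: (S1 t).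
    by rewrite (le_trans s0 st).
  by rewrite -(Nst s t m) ?s0// leq_add2r.
have cI (s t : R) : 0 <= s <= t -> t <= T -> (0 <= s <= T) * (0 <= t <= T).
  by move=> /andP[s0 st] tT; rewrite s0 tT (le_trans st tT) (le_trans s0 st).
exists U; split.
- apply/funext => i; apply/funext => x; rewrite /U.
  under eq_fun do rewrite /N mul0r truncn0 /S /=.
  exact: lim_cst.
- move=> t tT i; apply: (@Bd_ultra _ _ ultraG _ _ 1 (fun=> C * M)).
  + by move=> m; exact: (S1 t m _ i tT (leqnn _)).
  + move=> m; apply: (nice_mono (nice_Bd _) _ (BdW (SM t m _ i tT (leqnn _)))).
    by rewrite mulrC ler_wpM2r.
  + exact: cvg_cst.
- move=> s t st tT i; have [sT tT'] := cI s t st tT.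
  have H : Bd k.+1 (C * (t - s)) (fun x => lim ((fun m => S m (N t m) i x - S m (N s m) i x) @ G)).
    apply: (@Bd_ultra _ _ ultraG _ (fun m x => S m (N t m) i x - S m (N s m) i x) 2
      (fun m => C * ((n s t m)%:R * h m))).
    + move=> m; rewrite -[2]/(1 + 1); apply: (nice_sub (nice_Bd _)).
        exact: (S1 t m _ i tT' (leqnn _)).
      exact: (S1 s m _ i sT (leqnn _)).
    + move=> m; rewrite (Sst s t m st).
      have := H2 (h m) (S m (N s m)) (n s t m) (h0 m)
        (fun j jn i => S1n s t m j i st tT (ltnW jn)) i.
      by apply: (nice_mono (nice_Bd _)); rewrite ler_wpM2r// mulr_ge0// ltW.
    + exact: cvgM (cvg_cst _) (cn s t st).
  apply: (nice_ext (nice_Bd _) _ H) => x _.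
  by apply: cvg_lim => //; exact: cvgB (cU t i x tT') (cU s i x sT).
- move=> s t st tT i; have [sT tT'] := cI s t st tT.
  pose E m x := S m (N t m) i x - S m (N s m) i x -
    (n s t m)%:R * h m * rhs lam f (S m (N s m)) i x.
  have nT m : `|(n s t m)%:R * h m| <= T.
    rewrite ger0_norm ?mulr_ge0// ?(ltW (h0 m))//; apply: (NT t) => //.
    by rewrite -(Nst s t m st) leq_addr.
  have H : Bd k (C * (t - s) ^+ 2) (fun x => lim (E^~ x @ G)).
    (* [2 + T * (C4 * 1)] is a crude bound of order [k.+1]: 2 for the difference of two iterates,
       the rest for the right-hand side. The sharp bound of order [k] is the last argument. *)
    apply: (@Bd_ultra _ _ ultraG _ E (2 + T * (C4 * 1))
      (fun m => C * ((n s t m)%:R * h m) ^+ 2)).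
    + move=> m; apply: (nice_sub (nice_Bd _)).
        rewrite -[2]/(1 + 1); apply: (nice_sub (nice_Bd _)); apply: BdW.
          exact: (S1 t m _ i tT' (leqnn _)).
        exact: (S1 s m _ i sT (leqnn _)).
      have Hr := H4 (S m (N s m)) 1 (lexx _) (fun j => S1 s m _ j sT (leqnn _)) i.
      apply: (nice_mono (nice_Bd _) _ (nice_scale (nice_Bd _) ((n s t m)%:R * h m) Hr)).
      by rewrite ler_wpM2r// mulr_ge0.
    + move=> m; rewrite /E (Sst s t m st).
      have := H3 (h m) (S m (N s m)) (n s t m) (h0 m)
        (fun j jn i => S1n s t m j i st tT jn) i.
      by apply: (nice_mono (nice_Bd _)); rewrite ler_wpM2r// sqr_ge0.
    + apply: cvgM; first exact: cvg_cst.
      by under eq_fun do rewrite expr2; apply: cvgM; exact: cn.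
  apply: (nice_ext (nice_Bd _) _ H) => x _.
  apply: cvg_lim => //; apply: cvgB.
    exact: cvgB (cU t i x tT') (cU s i x sT).
  apply: cvgM; first exact: cn.
  apply: cvgN; apply: cvgD.
    apply: cvgM.
      by apply: cvg_cv => [|j]; [exact: smooth_continuous|exact: cU].
    have := @is_derive_ultra _ _ ultraG (fun m => S m (N s m) i) 1
      (fun m => Bd_le (leq_addr k 2) (S1 s m _ i sT (leqnn _))) x.
    move=> [_ ->]; apply: (@bounded_ultra_cvg _ _ ultraG _ 1) => m.
    exact: Bd_bound (Bd_derive (S1 s m _ i sT (leqnn _))).2.
  by apply: cvg_cv => [|j]; [exact: smooth_continuous|exact: cU].
- move=> p Hp t i x; suff E m : S m (N t m) i (x + p) = S m (N t m) i x.
    by rewrite /U; under eq_fun do rewrite E.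
  elim: (N t m) i x => [|j IH] i x; first exact: Hp.
  rewrite /S !iterS -![iter j _ _]/(S m j) /step.
  have cvp : cv (S m j) (x + p) = cv (S m j) x.
    by apply/colP => l; rewrite !cvE.
  by rewrite /weight cvp ![x + p + _]addrAC !IH.
Qed.

End ForwardProblem.

(** * Solutions of the Cauchy problem *)

Section SmoothAlgebra.
Context {R : realType}.
Implicit Types (F G : 'cV[R]_2 -> R).

Lemma CkS_intro k F (dF : 'I_2 -> 'cV[R]_2 -> R) : continuous F ->
  (forall i y, is_derive y (unitv i) F (dF i y)) -> (forall i, Ck k (dF i)) ->
  Ck k.+1 F.
Proof.
move=> cF dFP kF; split=> // i; split; first by move=> y; case: (dFP i y).
rewrite (_ : partial i F = dF i)//; apply/funext => y.
by rewrite /partial; case: (dFP i y).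
Qed.

Lemma CkS_is_derive k F i y : Ck k.+1 F ->
  is_derive y (unitv i) F (partial i F y).
Proof. by move=> [_ /(_ i)[+ _]] => /(_ y)/derivableP. Qed.

Lemma CkS_partial k F i : Ck k.+1 F -> Ck k (partial i F).
Proof. by move=> [_ /(_ i)[]]. Qed.

Lemma Ck_cst k (c : R) : Ck k (fun _ : 'cV[R]_2 => c).
Proof.
elim: k c => [|k IH] c; first by split=> // y; exact: cst_continuous.
split; first exact: cst_continuous.
move=> i; split; first by move=> y; exact: derivable_cst.
rewrite (_ : partial i _ = (fun=> 0)); first exact: IH.
by apply/funext => y; exact: derive_cst.
Qed.

Lemma Ck_add k F G : Ck k F -> Ck k G -> Ck k (fun y => F y + G y).
Proof.
elim: k F G => [|k IH] F G HF HG.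
  by split=> // y; exact: (cvgD (@Ck_continuous _ _ _ HF y) (@Ck_continuous _ _ _ HG y)).
apply: (@CkS_intro _ _ (fun i y => partial i F y + partial i G y)) => [y|i y|i].
- exact: (cvgD (@Ck_continuous _ _ _ HF y) (@Ck_continuous _ _ _ HG y)).
- by apply: is_derive_add; apply: CkS_is_derive; eassumption.
- by apply: IH; exact: CkS_partial.
Qed.

Lemma Ck_mul k F G : Ck k F -> Ck k G -> Ck k (fun y => F y * G y).
Proof.
elim: k F G => [|k IH] F G HF HG.
  by split=> // y; exact: (cvgM (@Ck_continuous _ _ _ HF y) (@Ck_continuous _ _ _ HG y)).
apply: (@CkS_intro _ _
  (fun i y => partial i F y * G y + F y * partial i G y)) => [y|i y|i].
- exact: (cvgM (@Ck_continuous _ _ _ HF y) (@Ck_continuous _ _ _ HG y)).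
- by apply: is_derive_mul; apply: CkS_is_derive; eassumption.
- by apply: Ck_add; apply: IH; (exact: CkS_partial || exact: CkS).
Qed.

Lemma Ck_inv k F : (forall y, F y != 0) -> Ck k F -> Ck k (fun y => (F y)^-1).
Proof.
move=> F0; elim: k => [|k IH] HF.
  by split=> // y; exact: (cvgV (F0 y) (@Ck_continuous _ _ _ HF y)).
apply: (@CkS_intro _ _
  (fun i y => - 1 * partial i F y * ((F y)^-1 * (F y)^-1))) => [y|i y|i].
- exact: (cvgV (F0 y) (@Ck_continuous _ _ _ HF y)).
- by rewrite mulN1r; apply: is_derive_inv => //; apply: CkS_is_derive; eassumption.
- apply: Ck_mul; last by apply: Ck_mul; exact: IH (CkS HF).
  by apply: Ck_mul; [exact: Ck_cst|exact: CkS_partial].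
Qed.

Lemma smooth_mul F G : smooth F -> smooth G -> smooth (fun y => F y * G y).
Proof. by move=> sF sG k; exact: Ck_mul. Qed.

Lemma smooth_inv F : (forall y, F y != 0) -> smooth F ->
  smooth (fun y => (F y)^-1).
Proof. by move=> F0 sF k; exact: Ck_inv. Qed.

Lemma smooth_opp F : smooth F -> smooth (fun y => - F y).
Proof.
move=> sF k; rewrite (_ : (fun y => - F y) = (fun y => - 1 * F y)).
  by apply: Ck_mul; [exact: Ck_cst|exact: sF].
by apply/funext => y; rewrite mulN1r.
Qed.

End SmoothAlgebra.

(** * Solutions for times of both signs *)

Section TwoSided.
Context {R : realType}.
Variables (lam f : 'I_2 -> 'cV[R]_2 -> R).
Hypotheses (lam_smooth : forall i, smooth (lam i))
  (f_smooth : forall i, smooth (f i)) (f0 : forall i, f i 0 = 0).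
Implicit Types (U : R -> 'I_2 -> R -> R) (s t : R).

(* [U] solves the equation to second order in time between [s] and [t]. *)
Let expands k U (c s t : R) := forall i, Bd k (c * (t - s) ^+ 2)
  (fun x => U t i x - U s i x - (t - s) * rhs lam f (U s) i x).
Let lipschitz k U (c s t : R) := forall i, Bd k (c * `|t - s|)
  (fun x => U t i x - U s i x).

(** Expanding at the other end replaces [rhs (U s)] by [rhs (U t)]; by the Lipschitz bound this
    costs another multiple of [(t - s) ^+ 2]. *)
Lemma expands_sym k : exists2 A : R, 0 <= A & forall U c s t, 0 <= c ->
  (forall i, Bd k.+1 1 (U s i)) -> (forall i, Bd k.+1 1 (U t i)) ->
  lipschitz k.+1 U c s t -> expands k U c s t -> expands k U (c + A * c) t s.
Proof.
have nk := nice_Bd (R := R) k; have [A A0 HA] := rhs_lip lam_smooth f_smooth k.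
exists A => // U c s t c0 Hs Ht Hl He i.
have := nice_add nk (nice_opp nk (He i))
  (nice_scale nk (t - s) (HA _ _ _ Ht Hs Hl i)).
rewrite [X in Bd k X _ -> _](_ : _ = (c + A * c) * (s - t) ^+ 2).
  by apply: (nice_ext nk) => x _; ring.
rewrite -(sqrrN (s - t)) opprB mulrDl; congr (_ + _).
by rewrite -[in RHS](real_normK (num_real (t - s))); ring.
Qed.

(** Two expansions that meet at time 0 are added: as [s] and [t] do not have the same strict sign,
    [s ^+ 2 + t ^+ 2] and [|s| * |t|] are at most [(t - s) ^+ 2]. *)
Lemma expands_cat k : exists2 A : R, 0 <= A & forall U c s t, 0 <= c ->
  s * t <= 0 ->
  (forall i, Bd k.+1 1 (U s i)) -> (forall i, Bd k.+1 1 (U 0 i)) ->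
  lipschitz k.+1 U c s 0 -> expands k U c s 0 -> expands k U c 0 t ->
  expands k U (c + A * c) s t.
Proof.
have nk := nice_Bd (R := R) k; have [A A0 HA] := rhs_lip lam_smooth f_smooth k.
exists A => // U c s t c0 st Hs H0 Hl Hes Het i.
have := nice_add nk (nice_add nk (Het i) (Hes i))
  (nice_scale nk t (HA _ _ _ H0 Hs Hl i)).
rewrite !sub0r !subr0 => H.
apply: (nice_mono nk _ (nice_ext nk _ H)); last by move=> x _; ring.
have -> : `|t| * (A * (c * `|- s|)) = A * c * - (s * t).
  have -> : - (s * t) = `|s| * `|t| by rewrite -normrM ler0_norm.
  by rewrite normrN; ring.
rewrite mulrDl -subr_ge0.
rewrite (_ : _ - _ = c * (2 * - (s * t)) + A * c * ((t ^+ 2 + s ^+ 2) - (s * t))).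
  rewrite addr_ge0// mulr_ge0//; first lra.
    by rewrite mulr_ge0.
  by rewrite subr_ge0 (le_trans st)// addr_ge0// sqr_ge0.
by ring.
Qed.

(** Reversing time changes the signs of [lam] and [f], and the two halves fit together because both
    expand at time 0 with the same right-hand side. Both signs are needed: the final state is
    followed backwards, and the sideways evolution leaves its initial line in both directions. *)
Lemma two_sided_solution k (T : R) : 0 <= T -> exists2 C : R, 0 <= C &
  forall (M : R) u0, C * M <= 1 -> (forall i, Bd k.+2 M (u0 i)) ->
  exists U : R -> 'I_2 -> R -> R,
  [/\ U 0 = u0,
      forall t, `|t| <= T -> forall i, Bd k.+1 (C * M) (U t i),
      forall s t, `|s| <= T -> `|t| <= T -> forall i, Bd k (C * (t - s) ^+ 2)
          (fun x => U t i x - U s i x - (t - s) * rhs lam f (U s) i x) &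
      forall p, (forall i x, u0 i (x + p) = u0 i x) ->
        forall t i x, U t i (x + p) = U t i x].
Proof.
move=> T0.
have [C1 C10 H1] := forward_solution lam_smooth f_smooth f0 k T0.
have [C2 C20 H2] := @forward_solution _ (fun i y => - lam i y)
  (fun i y => - f i y) (fun i => smooth_opp (lam_smooth i))
  (fun i => smooth_opp (f_smooth i))
  (fun i => etrans (congr1 -%R (f0 i)) (oppr0 R)) k _ T0.
have [A A0 HA] := expands_sym k; have [B B0 HB] := expands_cat k.
(* [c] serves on each half in the direction of evolution, [c'] on each half in both directions, [C]
   across time 0. *)
pose c := C1 + C2; pose c' := c + A * c; pose C := c' + B * c'.
have c0 : 0 <= c by rewrite addr_ge0.
have c'0 : 0 <= c' by rewrite addr_ge0// mulr_ge0.
have cc' : c <= c' by rewrite lerDl mulr_ge0.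
have c'C : c' <= C by rewrite lerDl mulr_ge0.
have C0 : 0 <= C by rewrite addr_ge0// mulr_ge0.
have C1c : C1 <= c by rewrite lerDl.
have C2c : C2 <= c by rewrite lerDr.
have C1C : C1 <= C by apply: le_trans c'C; exact: le_trans cc'.
have C2C : C2 <= C by apply: le_trans c'C; exact: le_trans cc'.
exists C => // M u0 CM Hu0.
have M0 : 0 <= M by exact: (nice_pos (nice_Bd _) (Hu0 0)).
have [|U1 [U10 U1b U1l U1e U1p]] := H1 M u0 _ Hu0.
  by apply: le_trans CM; rewrite ler_wpM2r.
have [|U2 [U20 U2b U2l U2e U2p]] := H2 M u0 _ Hu0.
  by apply: le_trans CM; rewrite ler_wpM2r.
pose U t := if 0 <= t then U1 t else U2 (- t).
have UP t : 0 <= t -> U t = U1 t by rewrite /U => ->.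
have UN t : t <= 0 -> U t = U2 (- t).
  rewrite /U le_eqVlt => /orP[/eqP ->|t0]; first by rewrite lexx oppr0 U10 U20.
  by rewrite leNgt t0.
have Ub t : `|t| <= T -> forall i, Bd k.+1 (C * M) (U t i).
  move=> tT i; have [t0|t0] := leP 0 t.
    rewrite UP//; apply: (nice_mono (nice_Bd _) _ (U1b t _ i)).
      by rewrite ler_wpM2r.
    by rewrite t0 -(ger0_norm t0).
  rewrite UN 1?ltW//; apply: (nice_mono (nice_Bd _) _ (U2b (- t) _ i)).
    by rewrite ler_wpM2r.
  by rewrite -(ltr0_norm t0) normr_ge0.
have Ub1 t : `|t| <= T -> forall i, Bd k.+1 1 (U t i).
  by move=> tT i; apply: (nice_mono (nice_Bd _) CM (Ub t tT i)).
have lipP s t : 0 <= s <= t -> t <= T -> lipschitz k.+1 U c s t.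
  move=> /[dup] st0 /andP[s0 st] tT i; rewrite UP ?(le_trans s0 st)// UP//.
  apply: (nice_mono (nice_Bd _) _ (U1l s t st0 tT i)).
  by rewrite ger0_norm ?subr_ge0// ler_wpM2r// subr_ge0.
have lipN s t : - T <= t -> t <= s <= 0 -> lipschitz k.+1 U c s t.
  move=> tT /andP[ts s0] i; rewrite !UN ?(le_trans ts s0)//.
  apply: (nice_mono (nice_Bd _) _ (U2l (- s) (- t) _ _ i)).
  - by rewrite opprK addrC ler0_norm ?subr_le0// opprB ler_wpM2r// subr_ge0.
  - by rewrite oppr_ge0 s0 lerN2.
  - by rewrite lerNl.
have lip_sym s t : lipschitz k.+1 U c s t -> lipschitz k.+1 U c t s.
  move=> H i; rewrite distrC; apply: (nice_ext (nice_Bd _) _ (nice_opp (nice_Bd _) (H i))).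
  by move=> x _; rewrite opprB.
have expP s t : 0 <= s <= t -> t <= T -> expands k U c s t.
  move=> /[dup] st0 /andP[s0 st] tT i; rewrite UP ?(le_trans s0 st)// UP//.
  apply: (nice_mono (nice_Bd _) _ (U1e s t st0 tT i)).
  by rewrite ler_wpM2r// sqr_ge0.
have expN s t : - T <= t -> t <= s <= 0 -> expands k U c s t.
  move=> tT /andP[ts s0] i; rewrite !UN ?(le_trans ts s0)//.
  have H : Bd k (C2 * (- t - - s) ^+ 2) (fun x => U2 (- t) i x - U2 (- s) i x -
      (- t - - s) * rhs (fun i y => - lam i y) (fun i y => - f i y) (U2 (- s)) i x).
    by apply: U2e; [rewrite oppr_ge0 s0 lerN2|rewrite lerNl].
  apply: (nice_mono (nice_Bd _) _ (nice_ext (nice_Bd _) _ H)).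
    have -> : (- t - - s) ^+ 2 = (t - s) ^+ 2 by ring.
    by rewrite ler_wpM2r// sqr_ge0.
  by move=> x _; rewrite /rhs; ring.
have exp_pos s t : 0 <= s -> 0 <= t -> s <= T -> t <= T -> expands k U c' s t.
  move=> s0 t0 sT tT; have [st|/ltW ts] := leP s t => i.
    apply: (nice_mono (nice_Bd _) _ (expP s t _ tT i)); rewrite ?s0//.
    by rewrite ler_wpM2r// sqr_ge0.
  apply: (HA U c t s) => //; try (by apply: Ub1; rewrite ger0_norm).
    by apply: lipP; rewrite ?t0.
  by apply: expP; rewrite ?t0.
have exp_neg s t : s <= 0 -> t <= 0 -> - T <= s -> - T <= t -> expands k U c' s t.
  move=> s0 t0 sT tT; have [ts|/ltW st] := leP t s => i.
    apply: (nice_mono (nice_Bd _) _ (expN s t tT _ i)); rewrite ?s0 ?ts//.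
    by rewrite ler_wpM2r// sqr_ge0.
  apply: (HA U c t s) => //; try (by apply: Ub1; rewrite ler0_norm// lerNl).
    by apply: lipN; rewrite ?t0 ?st.
  by apply: expN; rewrite ?t0 ?st.
have Clip s : `|s| <= T -> lipschitz k.+1 U c' s 0.
  move=> sT i; apply: (nice_mono (nice_Bd _) (M := c * `|0 - s|)).
    by rewrite ler_wpM2r.
  have [s0|s0] := leP 0 s.
    apply: lip_sym; apply: lipP; rewrite ?lexx//.
    by move: sT; rewrite ger0_norm.
  apply: lip_sym; apply: lipN; rewrite ?lexx ?(ltW s0)//.
  by move: sT; rewrite ltr0_norm// lerNl.
have exp_all s t : `|s| <= T -> `|t| <= T -> expands k U C s t.
  move=> sT tT i.
  have sT2 := sT; have tT2 := tT; move: sT2 tT2.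
  rewrite !ler_norml => /andP[s1 s2] /andP[t1 t2].
  have W : expands k U c' s t -> Bd k (C * (t - s) ^+ 2)
      (fun x => U t i x - U s i x - (t - s) * rhs lam f (U s) i x).
    move=> H; apply: (nice_mono (nice_Bd _) _ (H i)).
    by rewrite ler_wpM2r// sqr_ge0.
  have [s0|s0] := leP 0 s; have [t0|t0] := leP 0 t.
  - by apply: W; exact: exp_pos.
  - apply: (HB U c' s t c'0) => //.
    + by rewrite mulr_ge0_le0// ltW.
    + exact: Ub1.
    + by apply: Ub1; rewrite normr0.
    + exact: Clip.
    + exact: exp_pos.
    + by apply: exp_neg => //; rewrite ?(ltW t0)// lerNl oppr0.
  - apply: (HB U c' s t c'0) => //.
    + by rewrite mulr_le0_ge0// ltW.
    + exact: Ub1.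
    + by apply: Ub1; rewrite normr0.
    + exact: Clip.
    + by apply: exp_neg => //; rewrite ?(ltW s0)// lerNl oppr0.
    + exact: exp_pos.
  - by apply: W; apply: exp_neg => //; exact: ltW.
exists U; split=> //; first by rewrite UP.
move=> p Hp t i x; rewrite /U; case: ifP => _; [exact: U1p|exact: U2p].
Qed.

End TwoSided.

(** * Cut-off functions of prescribed smoothness *)

Section Cutoffs.
Context {R : realType}.
Implicit Types (g : R -> R) (t a b c d M : R) (n k : nat).

Lemma Bd_affine k M g c d : Bd k M g ->
  exists M' : R, Bd k M' (fun t => g (c * t + d)).
Proof.
elim: k M g => [|k IH] M g Hg; first by exists M => t _; exact: Hg.
have [M' HM'] := IH _ _ (BdW Hg).
have [dg Hdg] := Bd_derive Hg; have [M'' HM''] := IH _ _ Hdg.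
have nk := nice_Bd (R := R) k.
have M'0 := nice_pos nk HM'.
have HC := nice_scale nk c HM''; have C0 := nice_pos nk HC.
exists (M' + `|c| * M''); apply/BdS; split.
  by move=> t _; apply: le_trans (Bd_bound t HM') _; rewrite lerDl.
exists (fun t => c * 'D_1 g (c * t + d)).
  move=> t; have /is_derive_epsP H := dg (c * t + d).
  apply/is_derive_epsP => eps eps0.
  have c0 : 0 < `|c| + 1 by rewrite ltr_wpDl.
  have [|del del0 {}H] := H (eps / (`|c| + 1)); first by rewrite divr_gt0.
  exists (del / (`|c| + 1)); first by rewrite divr_gt0.
  move=> h; rewrite ltr_pdivlMr// => hd.
  have hc : `|c * h| < del.
    rewrite normrM; apply: le_lt_trans hd; rewrite mulrC ler_wpM2l//.
    by rewrite lerDl.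
  have := H _ hc; rewrite -![_ *: 1]/(_ * 1) !mulr1 mulrDr addrA mulrA [h * c]mulrC.
  move=> /le_trans; apply.
  rewrite normrM mulrA ler_wpM2r// -mulrA ler_piMr ?(ltW eps0)//.
  by rewrite mulrC ler_pdivrMr// mul1r lerDl.
by apply: (nice_mono nk _ HC); rewrite lerDr.
Qed.

Let posp n t : R := Num.max t 0 ^+ n / n`!%:R.

Let is_derive_posp n t : is_derive t 1 (posp n.+2) (posp n.+1 t).
Proof.
have [t0|t0|->] := ltgtP t 0.
- apply: (@is_derive_sqr _ _ _ _ _ _ 0 (- t)); first by rewrite oppr_gt0.
  move=> h ht; rewrite /posp !max_r//.
  + by rewrite !expr0n /= !mul0r mulr0 !subr0 normr0.
  + exact: ltW.
  + by rewrite -[_ *: 1]/(_ * 1) mulr1; move: ht; rewrite ltr_norml => /andP[]; lra.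
- suff D : is_derive t 1 (fun s => n.+2`!%:R^-1 * s ^+ n.+2) (posp n.+1 t).
    apply: near_eq_is_derive D; near=> s; have s0 : 0 < s by near: s; exact: lt_nbhsr.
    by rewrite /posp max_l ?(ltW s0)// mulrC.
  have := is_derive_scale n.+2`!%:R^-1 (is_deriveX n.+2 (is_derive_id t (1 : R))).
  rewrite exprfctE; congr (is_derive _ _ _ _); rewrite /posp max_l ?(ltW t0)//.
  rewrite -[_ *: 1]/(_ * 1) mulr1 factS natrM; field.
  by rewrite -natrD !pnatr_eq0 -lt0n fact_gt0.
- apply: (@is_derive_sqr _ _ _ _ _ _ 1 1) => // h h1.
  rewrite -[_ *: 1]/(_ * 1) mulr1 addr0 /posp maxxx !expr0n/= !mul0r mulr0 !subr0.
  rewrite mul1r normrM normfV [`|_%:R|]ger0_norm//.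
  rewrite ler_pdivrMr ?ltr0n ?fact_gt0// normrX.
  have m1 : `|Num.max h 0| <= `|h|.
    by case: (leP h 0) => h0; rewrite ?normr0.
  apply: (@le_trans _ _ (h ^+ 2)); last first.
    by rewrite ler_peMr ?sqr_ge0// ler1n fact_gt0.
  rewrite -[h ^+ 2]ger0_norm ?sqr_ge0// normrX.
  apply: (@le_trans _ _ (`|h| ^+ n.+2)); first by rewrite lerXn2r// nnegrE.
  by rewrite -addn2 exprD ler_piMl ?sqr_ge0// exprn_ile1// ltW.
Unshelve. all: by end_near. Qed.

Let diff1 g t := g t - g (t - 1).

Let is_derive_diff1 n (g dg : R -> R) : (forall t, is_derive t 1 g (dg t)) ->
  forall t, is_derive t 1 (iter n diff1 g) (iter n diff1 dg t).
Proof.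
move=> gdg; elim: n => //= n IH t.
exact: (is_derive_sub (IH t) (is_derive_translate (IH (t - 1)))).
Qed.

(** Iterated unit differences of a truncated power: the distribution function of a sum of [n + 1]
    independent uniform variables on [[0, 1]], that is, a primitive of a cardinal B-spline. *)
Let unit_step n := iter n.+1 diff1 (posp n.+1).

(** The derivative of [unit_step n.+1] is a unit difference of [unit_step n], which gives the
    regularity; by the mean value theorem [unit_step n.+1 t] is a value of [unit_step n] on
    [[t - 1, t]], which gives the other properties. *)
Let unit_stepP n : [/\ forall t, 0 <= unit_step n t <= 1,
  forall t, t <= 0 -> unit_step n t = 0,
  forall t, n.+1%:R <= t -> unit_step n t = 1 &
  exists M, Bd n M (unit_step n)].
Proof.
elim: n => [|n [H01 H0 H1 [M HM]]].
  have E t : unit_step 0 t = Num.max t 0 - Num.max (t - 1) 0.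
    by rewrite /unit_step /= /diff1 /posp !expr1 (_ : 1`!%:R = 1)// !divr1.
  have H01 t : 0 <= unit_step 0 t <= 1.
    by rewrite E; case: (leP t 0); case: (leP (t - 1) 0) => ? ?; lra.
  split=> //.
  - move=> t t0; rewrite E !max_r ?subrr//; lra.
  - move=> t t0; rewrite E !max_l; lra.
  - by exists 1 => t _; have := H01 t; rewrite ler_norml => /andP[]; lra.
have dA t : is_derive t 1 (iter n.+1 diff1 (posp n.+2)) (unit_step n t).
  by apply: is_derive_diff1 => s; exact: is_derive_posp.
have mv t : exists2 c, t - 1 <= c <= t & unit_step n.+1 t = unit_step n c.
  have [c cb E] := mvt (t - 1) t dA; exists c.
    by move: cb; rewrite min_l ?max_r// gerBl.
  by rewrite /unit_step iterS -/(unit_step n) /diff1 E; ring.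
have G01 t : 0 <= unit_step n.+1 t <= 1 by have [c _ ->] := mv t.
split=> //.
- by move=> t t0; have [c /andP[_ ct] ->] := mv t; apply: H0; exact: le_trans t0.
- move=> t t0; have [c /andP[tc _] ->] := mv t; apply: H1; apply: le_trans tc.
  by rewrite lerBrDr natr1.
- have nk := nice_Bd (R := R) n.
  have HS := nice_sub nk HM (Bd_translate (- 1) HM).
  have M0 := nice_pos nk HS.
  exists (M + M + 1); apply/BdS; split.
    move=> t _; have /andP[a b] := G01 t.
    by rewrite ger0_norm// (le_trans b)// lerDr.
  exists (fun t => unit_step n t - unit_step n (t - 1)).
    by move=> t; apply: is_derive_sub => //; exact: is_derive_translate.
  by apply: (nice_mono nk _ HS); rewrite lerDl.
Qed.

Lemma step_function k a b : a < b -> exists chi : R -> R,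
  [/\ exists M, Bd k M chi, forall t, 0 <= chi t <= 1,
      forall t, t <= a -> chi t = 0 & forall t, b <= t -> chi t = 1].
Proof.
move=> ab; have [H01 H0 H1 [M HM]] := unit_stepP k.
have ba0 : 0 < b - a by rewrite subr_gt0.
pose c := k.+1%:R / (b - a).
have c0 : 0 < c by rewrite divr_gt0.
exists (fun t => unit_step k (c * t + - (c * a))); split=> //.
- exact: Bd_affine HM.
- by move=> t ta; apply: H0; rewrite -mulrBr pmulr_rle0// subr_le0.
- move=> t bt; apply: H1; rewrite -mulrBr /c mulrAC ler_pdivlMr//.
  by rewrite ler_pM2l// lerD2r.
Qed.

Lemma bump_function k a b e : a < b -> 0 < e -> exists chi : R -> R,
  [/\ exists M, Bd k M chi, 
      forall t, a <= t <= b -> chi t = 1 &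
      forall t, t <= a - e \/ b + e <= t -> chi t = 0].
Proof.
move=> ab e0.
have [|c1 [[M1 H1] _ c10 c11]] := @step_function k (a - e) a; first lra.
have [|c2 [[M2 H2] _ c20 c21]] := @step_function k b (b + e); first lra.
have nk := nice_Bd (R := R) k; have [C _ HC] := nice_mul nk.
exists (fun t => c1 t * (1 - c2 t)); split.
- exists (C * M1 * (`|1| + M2)); apply: HC => //.
  exact: (nice_sub nk (nice_cst nk 1) H2).
- by move=> t /andP[at_ tb]; rewrite c11// c20// subr0 mulr1.
- by move=> t [ta|bt]; [rewrite c10// mul0r|rewrite c21// subrr mulr0].
Qed.

End Cutoffs.

(** * Functions of time and space *)

Section Plane.
Context {R : realType}.
Implicit Types (u : R * R -> R) (g : R -> R) (p : R * R) (M t x : R).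

Definition et : R * R := (1, 0).
Definition ex : R * R := (0, 1).
Definition Etx : set (R * R) := [set e | e = et \/ e = ex].
Definition Ex : set (R * R) := [set ex].

Lemma line_t h t x : h *: et + (t, x) = (h *: (1 : R) + t, x).
Proof.
by congr (_, _); rewrite /= -?[_ *: 0]/(_ * 0) ?mulr0 ?add0r.
Qed.

Lemma line_x h t x : h *: ex + (t, x) = (t, h *: (1 : R) + x).
Proof.
by congr (_, _); rewrite /= -?[_ *: 0]/(_ * 0) ?mulr0 ?add0r.
Qed.

Lemma is_derive_tP u t x (d : R) :
  is_derive (t, x) et u d <-> is_derive t 1 (fun s => u (s, x)) d.
Proof.
by split=> /is_derive_epsP H; apply/is_derive_epsP => eps /H[del del0 {}H];
  exists del => // h /H; rewrite line_t.
Qed.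

Lemma is_derive_xP u t x (d : R) :
  is_derive (t, x) ex u d <-> is_derive x 1 (fun s => u (t, s)) d.
Proof.
by split=> /is_derive_epsP H; apply/is_derive_epsP => eps /H[del del0 {}H];
  exists del => // h /H; rewrite line_x.
Qed.

Definition Pd (k : nat) : R -> (R * R -> R) -> Prop := Dern setT Etx k.

Lemma nice_Pd k : nice setT (Pd k).
Proof. by apply: nice_Dern; [exact: openT|exists 0]. Qed.

Lemma Pd_bound k M u p : Pd k M u -> `|u p| <= M.
Proof. by move=> /(nice_bound (nice_Pd k)); apply. Qed.

Lemma PdS k M u : Pd k.+1 M u <-> Bo setT M u /\ exists ut ux,
  [/\ forall p, is_derive p et u (ut p), forall p, is_derive p ex u (ux p),
      Pd k M ut & Pd k M ux].
Proof.
split=> [/iter_DerP[Hu du]|[Hu [ut [ux [dt dx Ht Hx]]]]].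
  split=> //; have [ut dt Ht] := du et (or_introl erefl).
  have [ux dx Hx] := du ex (or_intror erefl).
  by exists ut, ux; split=> // p; [exact: dt|exact: dx].
by apply/iter_DerP; split=> // e [->|->]; [exists ut|exists ux].
Qed.

Lemma PdW k M u : Pd k.+1 M u -> Pd k M u.
Proof. exact: iter_DerW. Qed.

Lemma Pd_derive k M u : Pd k.+1 M u ->
  [/\ forall p, is_derive p et u ('D_et u p),
      forall p, is_derive p ex u ('D_ex u p),
      Pd k M ('D_et u) & Pd k M ('D_ex u)].
Proof.
move=> /PdS[_ [ut [ux [dt dx Ht Hx]]]].
have -> : 'D_et u = ut by apply/funext => p; case: (dt p).
by have -> : 'D_ex u = ux by apply/funext => p; case: (dx p).
Qed.

Lemma Pd_of_t k M g : Bd k M g -> Pd k M (fun p => g p.1).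
Proof.
elim: k g => [|k IH] g Hg; first by move=> p _; exact: Hg.
have [dg Hdg] := Bd_derive Hg; apply/PdS; split.
  by move=> p _; exact: Bd_bound Hg.
exists (fun p => 'D_1 g p.1), (fun=> 0); split.
- by move=> [t x]; apply/is_derive_tP; exact: dg.
- by move=> [t x]; apply/is_derive_xP; exact: (is_derive_const (g t)).
- exact: (IH _ Hdg).
- by apply: (nice_cst_le (nice_Pd k)); rewrite normr0 (nice_pos (nice_Bd k) Hdg).
Qed.

Lemma Pd_of_x k M g : Bd k M g -> Pd k M (fun p => g p.2).
Proof.
elim: k g => [|k IH] g Hg; first by move=> p _; exact: Hg.
have [dg Hdg] := Bd_derive Hg; apply/PdS; split.
  by move=> p _; exact: Bd_bound Hg.
exists (fun=> 0), (fun p => 'D_1 g p.2); split.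
- by move=> [t x]; apply/is_derive_tP; exact: (is_derive_const (g x)).
- by move=> [t x]; apply/is_derive_xP; exact: dg.
- by apply: (nice_cst_le (nice_Pd k)); rewrite normr0 (nice_pos (nice_Bd k) Hdg).
- exact: (IH _ Hdg).
Qed.

Lemma Bd_line_t k M u x : Pd k M u -> Bd k M (fun t => u (t, x)).
Proof.
elim: k u => [|k IH] u Hu; first by move=> t _; exact: Hu.
have [dt _ Ht _] := Pd_derive Hu; apply/BdS; split.
  by move=> t _; exact: Pd_bound Hu.
exists (fun t => 'D_et u (t, x)); last exact: (IH _ Ht).
by move=> t; apply/is_derive_tP; exact: dt.
Qed.

(** On the overlap the derivatives agree by uniqueness, so they glue to one function, to which the
    induction applies. *)
Lemma Dern_union (D D' : set (R * R)) k M u : open D -> open D' ->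
  D !=set0 -> D' !=set0 -> (forall p, D p \/ D' p) ->
  Dern D Etx k M u -> Dern D' Etx k M u -> Pd k M u.
Proof.
move=> oD oD' D0 D'0 DD'; elim: k u => [|k IH] u HD HD'.
  by move=> p _; case: (DD' p) => [/HD|/HD'].
have /iter_DerP[HuD duD] := HD; have /iter_DerP[HuD' duD'] := HD'.
apply/iter_DerP; split; first by move=> p _; case: (DD' p) => [/HuD|/HuD'].
move=> e Ee; have [g dg Hg] := duD e Ee; have [g' dg' Hg'] := duD' e Ee.
pose w p := if `[< D p >] then g p else g' p.
have wD p : D p -> w p = g p by move=> /asboolT; rewrite /w => ->.
have wD' p : D' p -> w p = g' p.
  move=> D'p; rewrite /w; case: asboolP => // Dp.
  exact: is_derive_uniq (dg p Dp) (dg' p D'p).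
exists w.
  by move=> p _; case: (DD' p) => [Dp|D'p]; rewrite ?(wD p Dp) ?(wD' p D'p);
    [exact: dg|exact: dg'].
apply: IH.
  by apply: (nice_ext (nice_Dern Etx k oD D0) _ Hg) => p Dp; rewrite wD.
by apply: (nice_ext (nice_Dern Etx k oD' D'0) _ Hg') => p Dp; rewrite wD'.
Qed.

End Plane.

(** * Joint regularity in time and space *)

Section SpaceTimeRegularity.
Context {R : realType}.
Variable T : R.
Hypothesis T0 : 0 < T.

Let strip : set (R * R) := [set p | `|p.1| < T].

Lemma open_fst (A : set R) : open A -> open [set p : R * R | A p.1].
Proof.
move=> oA; apply: (@open_comp _ _ (fst : R * R -> R) A) => // p _; exact: cvg_fst.
Qed.

Lemma open_fst_lt (r : R) : open [set p : R * R | `|p.1| < r].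
Proof.
apply: (@open_fst [set t | `|t| < r]).
apply: (@open_comp _ _ (fun t : R => `|t|) [set s | s < r]); last exact: open_lt.
by move=> t _; exact: norm_continuous.
Qed.

Lemma open_fst_gt (r : R) : open [set p : R * R | r < `|p.1|].
Proof.
apply: (@open_fst [set t | r < `|t|]).
apply: (@open_comp _ _ (fun t : R => `|t|) [set s | r < s]); last exact: open_gt.
by move=> t _; exact: norm_continuous.
Qed.

Let open_strip : open strip.
Proof. exact: open_fst_lt. Qed.

Let strip0 : strip !=set0.
Proof. by exists 0; rewrite /strip /= normr0. Qed.

(* [m] derivatives in [x] on top of [n] derivatives in both variables: the
   equation converts them one by one into derivatives in [t]. *)
Let X (m n : nat) : R -> (R * R -> R) -> Prop :=
  iter m (Der strip Ex) (Dern strip Etx n).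

Let nice_X m n : nice strip (X m n).
Proof. by apply: nice_iter => //; exact: nice_Dern. Qed.

Let XS m n (M : R) u : X m.+1 n M u -> X m n M u /\
  exists2 ux, (forall p, strip p -> is_derive p ex u (ux p)) & X m n M ux.
Proof. by move=> [Hu /(_ ex erefl)]. Qed.

Let X_slices k (M : R) (U : R -> R -> R) : 0 <= M ->
  (forall t, `|t| < T -> Bd k M (U t)) -> X k 0 M (fun p => U p.1 p.2).
Proof.
move=> M0; elim: k U => [|k IH] U HU.
  by move=> [t x] tT; apply: Bd_bound (HU t tT).
split; first by apply: IH => t tT; exact: BdW (HU t tT).
move=> _ ->; exists (fun p => 'D_1 (U p.1) p.2).
  by move=> [t x] tT; apply/is_derive_xP; exact: (Bd_derive (HU t tT)).1.
by apply: (IH (fun t => 'D_1 (U t))) => t tT; exact: (Bd_derive (HU t tT)).2.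
Qed.

(** For [m = 0] the expansion says that [G] is the time derivative of [u], and [G] has [n]
    derivatives. For larger [m] the expansion, differentiated in [x], is an expansion for the
    [x]-derivatives of [u] and [G]. *)
Let X_gain m n (A B C : R) (u G : R * R -> R) : A <= B ->
  X m.+1 n A u -> X m n B G ->
  (forall s t, `|s| < T -> `|t| < T -> Bd m (C * (t - s) ^+ 2)
    (fun x => u (t, x) - u (s, x) - (t - s) * G (s, x))) ->
  X m n.+1 B u.
Proof.
move=> AB; elim: m u G => [|m IH] u G Hu HG Hq.
  have [H [ux dx Hx]] := XS Hu.
  apply/iter_DerP; split.
    by move=> p /(nice_bound (nice_X 0 n) H) /le_trans; apply.
  move=> e [->|->]; last first.
    by exists ux => //; exact: (nice_mono (nice_X 0 n) AB Hx).
  exists G => // -[s x] sT; apply/is_derive_tP.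
  apply: (@is_derive_sqr _ _ _ _ _ _ C (T - `|s|)); first by rewrite subr_gt0.
  move=> h hT; rewrite -[_ *: 1]/(_ * 1) mulr1.
  have hsT : `|h + s| < T by rewrite (le_lt_trans (ler_normD _ _))// -ltrBrDr.
  by have := Hq s (h + s) sT hsT x I; rewrite /= addrK.
have [H [ux dx Hx]] := XS Hu; have [HG' [Gx dGx HGx]] := XS HG.
split; first by apply: IH H HG' _ => s t sT tT; exact: BdW (Hq s t sT tT).
move=> _ ->; exists ux => //; apply: IH Hx HGx _ => s t sT tT.
have [dq Hdq] := Bd_derive (Hq s t sT tT).
apply: (nice_ext (nice_Bd m) _ Hdq) => x _.
apply: is_derive_uniq (dq x) _; apply: is_derive_sub.
  by apply: is_derive_sub; apply/is_derive_xP; exact: dx.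
by apply: is_derive_scale; apply/is_derive_xP; exact: dGx.
Qed.

Variables (lam f : 'I_2 -> 'cV[R]_2 -> R).
Hypotheses (lam_smooth : forall i, smooth (lam i))
  (f_smooth : forall i, smooth (f i)) (f0 : forall i, f i 0 = 0).

Let X_rhs m n : exists2 B : R, 1 <= B & forall (A : R) (u : 'I_2 -> R * R -> R)
    (ux : 'I_2 -> R * R -> R), A <= 1 ->
  (forall i, X m n A (u i)) -> (forall i, X m n A (ux i)) ->
  forall i, X m n (B * A) (fun p => - (lam i (cv u p) * ux i p + f i (cv u p))).
Proof.
have nX := nice_X m n; have [Cm Cm0 Hm] := nice_mul nX.
have /choice[L HL] i : exists C : R, 0 <= C /\ forall u, (forall i, X m n 1 (u i)) ->
    X m n C (fun x => lam i (cv u x)).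
  by have [C C0 H] := nice_compb nX (lam_smooth i); exists C.
have /choice[K HK] i : exists C : R, 0 <= C /\ forall u (M : R), M <= 1 ->
    (forall i, X m n M (u i)) -> X m n (C * M) (fun x => f i (cv u x)).
  by have [C C0 H] := nice_comps nX (f_smooth i) (f0 i); exists C.
pose B i := Cm * L i + K i.
have B0 i : 0 <= B i by rewrite addr_ge0 ?(HK i).1// mulr_ge0// (HL i).1.
exists (\sum_i B i + 1) => [|A u ux A1 Hu Hux i]; first by rewrite lerDr sumr_ge0.
have A0 := nice_pos nX (Hu i).
have Hu1 j : X m n 1 (u j) by exact: (nice_mono nX A1 (Hu j)).
have := nice_opp nX (nice_add nX (Hm _ _ _ _ ((HL i).2 u Hu1) (Hux i))
  ((HK i).2 u A A1 Hu)).
rewrite -mulrDl; apply: (nice_mono nX); rewrite ler_wpM2r//.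
by rewrite (bigD1 i)//= -addrA lerDl addr_ge0// sumr_ge0.
Qed.

(** The [k.+1] derivatives in [x] at fixed times are exchanged one at a time: the number [n] of
    derivatives in both variables grows from 0 to [k.+1], each exchange multiplying the bound by the
    constant of [X_rhs]. *)
Lemma space_time_regularity k : exists2 B : R, 1 <= B &
  forall (A C : R) (U : R -> 'I_2 -> R -> R), B * A <= 1 ->
  (forall t, `|t| < T -> forall i, Bd k.+1 A (U t i)) ->
  (forall s t, `|s| < T -> `|t| < T -> forall i, Bd k (C * (t - s) ^+ 2)
     (fun x => U t i x - U s i x - (t - s) * rhs lam f (U s) i x)) ->
  forall i, Dern strip Etx k.+1 (B * A) (fun p => U p.1 i p.2).
Proof.
suff H n : (n <= k.+1)%N -> exists2 B : R, 1 <= B &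
    forall (A C : R) (U : R -> 'I_2 -> R -> R), B * A <= 1 ->
    (forall t, `|t| < T -> forall i, Bd k.+1 A (U t i)) ->
    (forall s t, `|s| < T -> `|t| < T -> forall i, Bd k (C * (t - s) ^+ 2)
      (fun x => U t i x - U s i x - (t - s) * rhs lam f (U s) i x)) ->
    forall i, X (k.+1 - n) n (B * A) (fun p => U p.1 i p.2).
  have [B B1 HB] := H k.+1 (leqnn _); exists B => // A C U BA HU He.
  by have := HB A C U BA HU He; rewrite subnn.
elim: n => [_|n IH nk].
  exists 1 => // A C U; rewrite mul1r subn0 => A1 HU _ i.
  have A0 : 0 <= A.
    by apply: (nice_pos (nice_Bd _) (HU 0 _ 0)); rewrite normr0.
  by apply: (X_slices (U := fun t => U t i)) => // t tT; exact: HU.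
have [B B1 HB] := IH (ltnW nk).
have mE : (k.+1 - n)%N = (k.+1 - n.+1).+1 by rewrite subnSK.
set m := (k.+1 - n.+1)%N in mE *.
have mk : (m <= k)%N by rewrite /m subSS leq_subr.
have [B' B'1 HB'] := X_rhs m n.
have BB' : 1 <= B' * B by rewrite -[1]mulr1 ler_pM.
exists (B' * B) => // A C U BA HU He i.
have A0 : 0 <= A.
  by apply: (nice_pos (nice_Bd _) (HU 0 _ 0)); rewrite normr0.
have BA0 : 0 <= B * A by rewrite mulr_ge0// (le_trans ler01).
have BA' : B * A <= B' * B * A by rewrite -mulrA ler_peMl.
have BA1 : B * A <= 1 by exact: le_trans BA.
have HX j : X m.+1 n (B * A) (fun p => U p.1 j p.2).
  by rewrite -mE; exact: (HB A C U BA1 HU He j).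
pose ux j p := 'D_1 (U p.1 j) p.2.
have Hux j : X m n (B * A) (ux j).
  have [_ [g dg Hg]] := XS (HX j).
  apply: (nice_ext (nice_X m n) _ Hg) => -[t x] tT.
  have [dU _] := Bd_derive (HU t tT j).
  by apply: is_derive_uniq ((is_derive_xP _ _ _ _).1 (dg _ tT)) (dU x).
have HG := HB' (B * A) (fun j p => U p.1 j p.2) ux BA1
  (fun j => (XS (HX j)).1) Hux i; rewrite mulrA in HG.
apply: (X_gain BA' (HX i) HG (C := C)) => s t sT tT /=.
apply: (nice_ext (nice_Bd m) _ (Bd_le mk (He s t sT tT i))) => x _.
rewrite /rhs /ux /=; congr (_ - _ * - (lam i _ * _ + f i _));
  by apply/colP => j; rewrite !cvE.
Qed.

End SpaceTimeRegularity.

(** * The Cauchy problem on the plane *)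

Section CauchyProblem.
Context {R : realType}.
Variables (lam f : 'I_2 -> 'cV[R]_2 -> R).
Implicit Types (u : 'I_2 -> R * R -> R) (p : R * R).

(** Quantifying over the derivatives lets the equation be carried through translations, exchanges of
    variables and local equalities without naming them. It has content where both derivatives exist,
    which the classes [Pd] of positive order ensure. *)
Definition pde u (i : 'I_2) p := forall ut ux : R,
  is_derive p et (u i) ut -> is_derive p ex (u i) ux ->
  ut + lam i (cv u p) * ux + f i (cv u p) = 0.

Lemma pde_near u v i p : (\near p, forall j, u j p = v j p) ->
  pde u i p -> pde v i p.
Proof.
move=> uv H vt vx dt dx.
have vu : \near p, v i p = u i p by apply: filterS uv => q ->.
have := H vt vx (is_derive_near vu dt) (is_derive_near vu dx).
suff -> : cv u p = cv v p by [].
by apply/colP => j; rewrite !cvE; have /(_ j) := nbhs_singleton uv.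
Qed.

Hypotheses (lam_smooth : forall i, smooth (lam i))
  (f_smooth : forall i, smooth (f i)) (f0 : forall i, f i 0 = 0).

(** The solution is computed for [|t| < T + 3] and multiplied by a cut-off in time that is 1 up to
    [T + 1] and 0 beyond [T + 2]. The result has bounded derivatives on the whole plane, so later
    cut-offs, translations and exchanges of variables need no domains. *)
Theorem cauchy_problem k (T : R) : 0 <= T -> exists2 C : R, 0 < C &
  forall (M : R) (u0 : 'I_2 -> R -> R), C * M <= 1 ->
    (forall i, Bd k.+2 M (u0 i)) ->
  exists u, [/\ forall i, Pd k.+1 (C * M) (u i),
      forall i x, u i (0, x) = u0 i x,
      forall i p, `|p.1| <= T -> pde u i p &
      forall r, (forall i x, u0 i (x + r) = u0 i x) ->
        forall i t x, u i (t, x + r) = u i (t, x)].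
Proof.
move=> T0; pose T' := T + 3.
have T'0 : 0 < T' by rewrite ltr_wpDl.
have [C1 C10 H1] := two_sided_solution lam_smooth f_smooth f0 k (ltW T'0).
have [B B1 HB] := space_time_regularity T'0 lam_smooth f_smooth f0 k.
have [|chi [[Mc Hchi] chi1 chi0]] :=
  @bump_function R k.+1 (- (T + 1)) (T + 1) 1 _ ltr01.
  by rewrite gt0_cp// ltr_wpDl.
have nk := nice_Pd (R := R) k.+1.
pose D : set (R * R) := [set p | `|p.1| < T'].
pose D' : set (R * R) := [set p | T + 2 < `|p.1|].
have oD : open D by exact: open_fst_lt.
have oD' : open D' by exact: open_fst_gt.
have D0 : D !=set0 by exists 0; rewrite /D /= normr0.
have D'0 : D' !=set0.
  exists (T', 0); rewrite /D' /= ger0_norm ?(ltW T'0)// /T'; lra.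
have nD := nice_Dern Etx k.+1 oD D0; have nD' := nice_Dern Etx k.+1 oD' D'0.
have [Cm Cm0 Hm] := nice_mul nD.
have Mc0 := nice_pos (nice_Bd _) Hchi.
pose C := (1 + Cm * Mc) * B * C1 + C1 + 1.
have B0 : 0 <= B by rewrite (le_trans ler01).
have E0 : 0 <= Cm * Mc by rewrite mulr_ge0.
have C0 : 0 < C by rewrite ltr_wpDl// addr_ge0// !mulr_ge0// addr_ge0.
exists C => // M u0 CM Hu0.
have M0 := nice_pos (nice_Bd _) (Hu0 0).
have [P0 Q0] : 0 <= B * C1 /\ 0 <= Cm * Mc * (B * C1) by rewrite !mulr_ge0.
have CE : C = B * C1 + Cm * Mc * (B * C1) + C1 + 1 by rewrite /C; ring.
have le1 : B * C1 * M <= C * M by rewrite ler_wpM2r// CE; lra.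
have le2 : C1 * M <= C * M by rewrite ler_wpM2r// CE; lra.
have le3 : Cm * Mc * (B * (C1 * M)) <= C * M.
  by rewrite [B * _]mulrA mulrA ler_wpM2r// CE; lra.
have [|U [U0 Ub Ue Up]] := H1 M u0 _ Hu0; first exact: le_trans CM.
have HU := HB (C1 * M) C1 U _ (fun t tT => Ub t (ltW tT))
  (fun s t sT tT => Ue s t (ltW sT) (ltW tT)).
have {}HU i : Dern D Etx k.+1 (B * (C1 * M)) (fun p => U p.1 i p.2).
  by apply: HU; rewrite mulrA; exact: le_trans CM.
pose u i p := chi p.1 * U p.1 i p.2.
have uU i p : `|p.1| <= T + 1 -> u i p = U p.1 i p.2.
  by rewrite ler_norml /u => /chi1 ->; rewrite mul1r.
exists u; split.
- move=> i; apply: (Dern_union oD oD' D0 D'0).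
  + move=> p; have [h|h] := ltP `|p.1| T'; [left|right]; rewrite /D /D' //=.
    by rewrite (lt_le_trans _ h)// ltrD2l ltr_nat.
  + apply: (nice_mono nD le3); apply: Hm => //.
    by apply: Dern_sub (Pd_of_t Hchi).
  + have Z : Dern D' Etx k.+1 (C * M) (fun=> 0 : R).
      by apply: (nice_cst_le nD'); rewrite normr0 mulr_ge0// ltW.
    apply: (nice_ext nD' _ Z) => p Dp; rewrite /u chi0 ?mul0r//.
    move: Dp; rewrite /D' /= ltr_normr => /orP[]; [right|left]; lra.
- by move=> i x; rewrite uU /= ?normr0 ?addr_ge0// U0.
- move=> i [t x] /= tT.
  have near_uU : \forall p \near (t, x), forall j, U p.1 j p.2 = u j p.
    have oN : open [set p : R * R | `|p.1| < T + 1] by exact: open_fst_lt.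
    have : nbhs (t, x) [set p : R * R | `|p.1| < T + 1].
      apply: open_nbhs_nbhs; split=> //; rewrite /= (le_lt_trans tT)//; lra.
    by apply: filterS => p /= /ltW pT j; rewrite uU.
  apply: (pde_near (u := fun j p => U p.1 j p.2)) => // ut ux /is_derive_tP dt /is_derive_xP dx.
  have tT' : `|t| < T' by rewrite (le_lt_trans tT)// /T'; lra.
  have dt' : is_derive t 1 (fun s => U s i x) (rhs lam f (U t) i x).
    apply: (@is_derive_sqr _ _ _ _ _ _ C1 (T' - `|t|)); first by rewrite subr_gt0.
    move=> h hT; rewrite -[_ *: 1]/(_ * 1) mulr1.
    have htT : `|h + t| <= T' by rewrite (le_trans (ler_normD _ _))// -lerBrDr ltW.
    by have := Bd_bound x (Ue t (h + t) (ltW tT') htT i); rewrite /= addrK.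
  rewrite (is_derive_uniq dt dt') /rhs.
  have [dU _] := Bd_derive (Ub t (ltW tT') i).
  rewrite (is_derive_uniq dx (dU x)).
  suff -> : cv (fun j p => U p.1 j p.2) (t, x) = cv (U t) x by ring.
  by apply/colP => j; rewrite !cvE.
- by move=> r Hr i t x; rewrite /u /= (Up r Hr).
Qed.

End CauchyProblem.

(** * Finite speed of propagation *)

Lemma ex2_and {U : Type} (P Q : U -> Prop) :
  (exists2 x, P x & Q x) -> exists x, P x /\ Q x.
Proof. by case=> x; exists x. Qed.

Lemma linear_difference {R : comPzRingType} (ut ux vt vx l k f g : R) :
  ut + l * ux + f = 0 -> vt + k * vx + g = 0 ->
  ut - vt + l * (ux - vx) = - ((l - k) * vx + (f - g)).
Proof. by move=> E F; rewrite -[LHS]addr0 -{1}F -[RHS]addr0 -E; ring. Qed.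

Section PlaneTaylor.
Context {R : realType}.
Implicit Types (u w : R * R -> R) (a b t x M : R).

Lemma Pd_lip M u a b t x : Pd 1 M u ->
  `|u (t + a, x + b) - u (t, x)| <= M * (`|a| + `|b|).
Proof.
move=> /PdS[_ [ut [ux [dt dx Ht Hx]]]].
rewrite (_ : _ - _ = (u (t + a, x + b) - u (t, x + b)) +
   (u (t, x + b) - u (t, x))); last by ring.
rewrite mulrDr (le_trans (ler_normD _ _))// lerD//.
  have := mvt_dir (t, x + b) a dt (fun z => Ht z I).
  by rewrite line_t -[_ *: 1]/(_ * 1) mulr1 [a + t]addrC.
have := mvt_dir (t, x) b dx (fun z => Hx z I).
by rewrite line_x -[_ *: 1]/(_ * 1) mulr1 [b + x]addrC.
Qed.

Lemma Pd_taylor M u a b t x : Pd 2 M u ->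
  `|u (t + a, x + b) - u (t, x) - a * 'D_et u (t, x) - b * 'D_ex u (t, x)|
    <= M * (`|a| + `|b|) ^+ 2.
Proof.
move=> Hu; have [dt dx Ht Hx] := Pd_derive Hu.
have M0 := nice_pos (nice_Pd _) Hu.
have [dtt _ Htt _] := Pd_derive Ht; have [_ dxx _ Hxx] := Pd_derive Hx.
rewrite (_ : _ - _ = (u (t + a, x + b) - u (t, x + b) - a * 'D_et u (t, x + b)) +
  (u (t, x + b) - u (t, x) - b * 'D_ex u (t, x)) +
  a * ('D_et u (t, x + b) - 'D_et u (t, x))); last by ring.
have A : `|u (t + a, x + b) - u (t, x + b) - a * 'D_et u (t, x + b)| <= M * a ^+ 2.
  have := taylor_dir (t, x + b) a dt dtt (fun z => Htt z I).
  by rewrite line_t -[_ *: 1]/(_ * 1) mulr1 [a + t]addrC.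
have B : `|u (t, x + b) - u (t, x) - b * 'D_ex u (t, x)| <= M * b ^+ 2.
  have := taylor_dir (t, x) b dx dxx (fun z => Hxx z I).
  by rewrite line_x -[_ *: 1]/(_ * 1) mulr1 [b + x]addrC.
have C : `|a * ('D_et u (t, x + b) - 'D_et u (t, x))| <= `|a| * (M * `|b|).
  rewrite normrM ler_wpM2l//; have := Pd_lip 0 b t x Ht.
  by rewrite addr0 normr0 add0r.
apply: (le_trans (ler_normD _ _)); apply: (le_trans (lerD (ler_normD _ _) C)).
apply: (le_trans (lerD (lerD A B) (lexx _))).
rewrite -(real_normK (num_real a)) -(real_normK (num_real b)).
rewrite -subr_ge0 (_ : _ - _ = M * (`|a| * `|b|)); last by ring.
by rewrite !mulr_ge0.
Qed.

Lemma Pd_swap k M u a b : Pd k M u -> Pd k M (fun p => u (p.2 + a, p.1 + b)).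
Proof.
elim: k u => [|k IH] u Hu; first by move=> p _; exact: Hu.
have [dt dx Ht Hx] := Pd_derive Hu; apply/PdS; split.
  by move=> p _; exact: Pd_bound Hu.
exists (fun p => 'D_ex u (p.2 + a, p.1 + b)), (fun p => 'D_et u (p.2 + a, p.1 + b)).
split; [move=> [t x]|move=> [t x]|exact: (IH _ Hx)|exact: (IH _ Ht)].
- apply/is_derive_tP.
  apply: (@is_derive_translate _ (fun s => u (x + a, s)) b t).
  by apply/is_derive_xP; exact: dx.
- apply/is_derive_xP.
  apply: (@is_derive_translate _ (fun s => u (s, t + b)) a x).
  by apply/is_derive_tP; exact: dt.
Qed.

End PlaneTaylor.

Section FiniteSpeed.
Context {R : realType}.
Variables (lam f : 'I_2 -> 'cV[R]_2 -> R).
Hypotheses (lam_smooth : forall i, smooth (lam i))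
  (f_smooth : forall i, smooth (f i)).

(* Gronwall's inequality along discretised characteristics: going back [N]
   steps of length [t / N], each step costs an error [O(1 / N ^ 2)]. *)
Lemma finite_speed (u v : 'I_2 -> R * R -> R) (c x0 rho : R) :
  0 <= c ->
  (forall i, Pd 2 1 (u i)) -> (forall i, Pd 2 1 (v i)) ->
  (forall i t x, `|x - x0| <= rho - c * `|t| ->
     [/\ pde lam f u i (t, x), pde lam f v i (t, x) &
         `|lam i (cv u (t, x))| <= c]) ->
  (forall i x, `|x - x0| <= rho -> u i (0, x) = v i (0, x)) ->
  forall i t x, `|x - x0| <= rho - c * `|t| -> u i (t, x) = v i (t, x).
Proof.
move=> c0 Hu Hv HK uv0.
have u1 i p : `|u i p| <= 1 by exact: Pd_bound (Hu i).
have v1 i p : `|v i p| <= 1 by exact: Pd_bound (Hv i).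
have /choice[A HA] i := ex2_and (smooth_box_lip 1 (lam_smooth i)).
have /choice[B HB] i := ex2_and (smooth_box_lip 1 (f_smooth i)).
pose L := \sum_i (A i + B i).
have AB0 i : 0 <= A i + B i.
  by have [A0 _] := HA i; have [B0 _] := HB i; rewrite addr_ge0.
have L0 : 0 <= L by exact: sumr_ge0.
have ABL i : A i + B i <= L.
  by rewrite /L (bigD1 i)//= lerDl; exact: sumr_ge0.
pose w i p := u i p - v i p.
have Hw i : Pd 2 2 (w i) by rewrite -[2]/(1 + 1); exact: (nice_sub (nice_Pd 2)).
(* A step back errs by [K * h ^+ 2]: the first summand comes from bounding [w] at the starting point
   by its values at the foot [q], the second is the Taylor remainder along the step. *)
pose K := L * (2 * (1 + c)) + 2 * (1 + c) ^+ 2.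
have K0 : 0 <= K by rewrite addr_ge0// !mulr_ge0 ?sqr_ge0 ?addr_ge0.
have onestep i h t x m : `|x - x0| <= rho - c * `|t| ->
    let q := (t - h, x - lam i (cv u (t, x)) * h) in
    (forall j, `|w j q| <= m) -> `|w i (t, x)| <= m * (1 + L * `|h|) + K * h ^+ 2.
  move=> xK; set l := lam i _ => q wq.
  have [pu pv lc] := HK i t x xK.
  have m0 : 0 <= m by exact: le_trans (wq i).
  have lh : `|- (l * h)| <= c * `|h| by rewrite normrN normrM ler_wpM2r.
  have step_le : `|- h| + `|- (l * h)| <= (1 + c) * `|h|.
    by rewrite mulrDl mul1r normrN lerD2l.
  have [dut dux _ _] := Pd_derive (Hu i); have [dvt dvx _ Hvx] := Pd_derive (Hv i).
  have Eu := pu _ _ (dut _) (dux _); have Ev := pv _ _ (dvt _) (dvx _).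
  have wt : 'D_et (w i) (t, x) = 'D_et (u i) (t, x) - 'D_et (v i) (t, x).
    have [dwt _ _ _] := Pd_derive (Hw i).
    by apply: is_derive_uniq (dwt _) _; exact: is_derive_sub.
  have wx : 'D_ex (w i) (t, x) = 'D_ex (u i) (t, x) - 'D_ex (v i) (t, x).
    have [_ dwx _ _] := Pd_derive (Hw i).
    by apply: is_derive_uniq (dwx _) _; exact: is_derive_sub.
  pose r := (lam i (cv u (t, x)) - lam i (cv v (t, x))) * 'D_ex (v i) (t, x) +
     (f i (cv u (t, x)) - f i (cv v (t, x))).
  have Er : 'D_et (w i) (t, x) + l * 'D_ex (w i) (t, x) = - r.
    by rewrite wt wx; exact: linear_difference Eu Ev.
  have wp j : `|w j (t, x)| <= m + 2 * ((1 + c) * `|h|).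
    rewrite -[w j (t, x)](subrK (w j q)) addrC (le_trans (ler_normD _ _))//.
    rewrite lerD// distrC.
    apply: (le_trans (Pd_lip (- h) (- (l * h)) t x (PdW (Hw j)))).
    by rewrite ler_wpM2l.
  have rL : `|r| <= L * (m + 2 * ((1 + c) * `|h|)).
    have [A0 HAi] := HA i; have [B0 HBi] := HB i.
    have wp' j : `|cv u (t, x) j 0 - cv v (t, x) j 0| <= m + 2 * ((1 + c) * `|h|).
      by rewrite !cvE; exact: wp.
    have cu j : `|cv u (t, x) j 0| <= 1 by rewrite cvE.
    have cv' j : `|cv v (t, x) j 0| <= 1 by rewrite cvE.
    have a1 := HAi _ _ cu cv' _ wp'; have b1 := HBi _ _ cu cv' _ wp'.
    have vx1 : `|'D_ex (v i) (t, x)| <= 1 by exact: Pd_bound Hvx.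
    have m'0 : 0 <= m + 2 * ((1 + c) * `|h|).
      by apply: addr_ge0 => //; rewrite !mulr_ge0// addr_ge0.
    apply: (@le_trans _ _ ((A i + B i) * (m + 2 * ((1 + c) * `|h|)))).
      rewrite mulrDl (le_trans (ler_normD _ _))// lerD// normrM.
      by apply: le_trans a1; rewrite ler_piMr.
    by rewrite ler_wpM2r.
  have T2 := Pd_taylor (- h) (- (l * h)) t x (Hw i).
  have {}T2 : `|w i q - w i (t, x) - h * r| <= 2 * (1 + c) ^+ 2 * h ^+ 2.
    have -> : w i q - w i (t, x) - h * r = w i (t - h, x - l * h) - w i (t, x) -
       - h * 'D_et (w i) (t, x) - - (l * h) * 'D_ex (w i) (t, x).
      rewrite /q -[r]opprK -Er; ring.
    apply: (le_trans T2); rewrite -mulrA ler_wpM2l// -exprMn.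
    rewrite exprMn -(real_normK (num_real h)) -exprMn.
    by rewrite lerXn2r// nnegrE ?addr_ge0// !mulr_ge0// addr_ge0.
  rewrite (_ : w i (t, x) = w i q - (w i q - w i (t, x) - h * r) - h * r); last by ring.
  apply: (le_trans (ler_normB _ _)).
  apply: (le_trans (lerD (ler_normB _ _) (lexx _))).
  apply: (le_trans (lerD (lerD (wq i) T2) (lexx _))).
  rewrite normrM.
  have := ler_wpM2l (normr_ge0 h) rL.
  rewrite /K -[h ^+ 2](real_normK (num_real _)).
  rewrite -subr_ge0 => H; rewrite -subr_ge0; apply: (le_trans H).
  by rewrite le_eqVlt; apply/orP; left; apply/eqP; ring.
have iter_bound h x n t : t = n%:R * h -> `|x - x0| <= rho - c * `|t| -> forall i,
    `|w i (t, x)| <= K * (n%:R * h ^+ 2) * (1 + L * `|h|) ^+ n.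
  elim: n t x => [|n IH] t x -> xK i.
    rewrite mul0r /w uv0 ?subrr ?normr0 ?mul0r ?mulr0 ?mul0r//.
    by move: xK; rewrite mul0r normr0 mulr0 subr0.
  have [_ _ lc] := HK i _ x xK.
  apply: (le_trans (onestep i h _ x (K * (n%:R * h ^+ 2) * (1 + L * `|h|) ^+ n) xK _)).
    move=> j; apply: IH; first by rewrite -natr1; ring.
    have E : n.+1%:R * h - h = n%:R * h by rewrite -natr1; ring.
    rewrite E addrAC (le_trans (ler_normB _ _))//.
    apply: (le_trans (lerD xK (_ : _ <= c * `|h|))).
      by rewrite normrM ler_wpM2r.
    have -> : `|n.+1%:R * h| = `|n%:R * h| + `|h|.
      by rewrite !normrM !normr_nat -natr1 mulrDl mul1r.
    by rewrite mulrDr opprD addrA subrK.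
  have e1 : 1 <= (1 + L * `|h|) ^+ n.+1.
    by rewrite exprn_ege1// lerDl mulr_ge0.
  have := ler_wpM2l (mulr_ge0 K0 (sqr_ge0 h)) e1.
  rewrite (exprSr (1 + L * `|h|) n) -natr1 mulr1.
  set E := (1 + L * `|h|) ^+ n; set F := 1 + L * `|h|.
  rewrite -subr_ge0 => H; rewrite -subr_ge0; apply: (le_trans H).
  by rewrite le_eqVlt; apply/orP; left; apply/eqP; ring.
move=> i t x xK; apply/eqP; rewrite -subr_eq0 -normr_le0 -/(w i (t, x)).
rewrite leNgt; apply/negP => w0.
(* After [n] steps of length [t / n] the accumulated error is at most [Q / n]; a number of steps
   beyond [Q / |w i (t, x)|] contradicts [w i (t, x) != 0]. *)
pose Q := K * t ^+ 2 * expR (L * `|t|).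
have Q0 : 0 <= Q by rewrite mulr_ge0 ?expR_ge0// mulr_ge0// sqr_ge0.
pose n := Num.truncn (Q / `|w i (t, x)|).
have nQ : Q < n.+1%:R * `|w i (t, x)|.
  rewrite -ltr_pdivrMr//; have /andP[] := truncn_itv (divr_ge0 Q0 (ltW w0)); by [].
have n0 : n.+1%:R != 0 :> R by rewrite pnatr_eq0.
have := iter_bound (t / n.+1%:R) x n.+1 t _ xK i.
have -> : n.+1%:R * (t / n.+1%:R) = t by field.
move=> /(_ erefl) H.
have n0' : 0 < n.+1%:R :> R by rewrite ltr0n.
have eB : (1 + L * `|t / n.+1%:R|) ^+ n.+1 <= expR (L * `|t|).
  rewrite normrM normfV [`|n.+1%:R|]gtr0_norm//.
  have -> : expR (L * `|t|) = expR (L * (`|t| / n.+1%:R)) ^+ n.+1.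
    by rewrite -expRM_natl; congr expR; field.
  by rewrite lerXn2r ?nnegrE ?expR_ge0 ?expR_ge1Dx// addr_ge0// !mulr_ge0// invr_ge0.
have : n.+1%:R * `|w i (t, x)| <= Q.
  rewrite mulrC -ler_pdivlMr//; apply: (le_trans H).
  rewrite /Q.
  have -> : n.+1%:R * (t / n.+1%:R) ^+ 2 = t ^+ 2 / n.+1%:R by field.
  by rewrite mulrA mulrAC ler_wpM2r ?invr_ge0// ler_wpM2l// mulr_ge0// sqr_ge0.
by rewrite leNgt nQ.
Qed.

End FiniteSpeed.

(** * Uniqueness on the rectangle *)

Section RelativeDerivatives.
Context {R : realType} {V : normedModType R}.
Implicit Types (D : set R) (f : R -> V) (x : R).

Lemma derive_in_eps D f x : derivable_in D f x -> forall eps : R, 0 < eps ->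
  exists2 del : R, 0 < del & forall h : R, `|h| < del -> D (h + x) ->
    `|f (h + x) - f x - h *: derive_in D f x| <= eps * `|h|.
Proof.
move=> df eps eps0.
have /cvgrPdist_le/(_ _ eps0) : diff_quot_in D f x --> derive_in D f x by [].
move=> [del /= del0 H]; exists del => // h hdel Dh.
have [->|h0] := eqVneq h 0.
  by rewrite add0r subrr scale0r subr0 !normr0 mulr0.
rewrite (_ : _ - _ = - h *: (derive_in D f x - h^-1 *: (f (h + x) - f x))).
  rewrite normrZ normrN mulrC ler_wpM2r//; apply: H => //.
  by rewrite /= sub0r normrN.
by rewrite scalerBr scalerA mulNr mulfV// !scaleNr scale1r opprK addrC.
Qed.

(** The first hypothesis, that [D] accumulates at [x], makes the filter of the difference quotient
    proper, so that its limit is unique. *)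
Lemma derive_in_intro D f x (d : V) :
  (forall del : R, 0 < del -> exists h : R, [/\ h != 0, `|h| < del & D (h + x)]) ->
  (forall eps : R, 0 < eps -> exists2 del : R, 0 < del &
    forall h : R, `|h| < del -> D (h + x) ->
      `|f (h + x) - f x - h *: d| <= eps * `|h|) ->
  derivable_in D f x /\ derive_in D f x = d.
Proof.
move=> Dx H.
have PF : ProperFilter (within [set h | D (h + x)] 0^').
  split; last exact: within_filter.
  move=> [del /= del0 HA]; have [h [h0 hdel Dh]] := Dx del del0.
  by apply: (HA h) => //; rewrite /= sub0r normrN.
have C : diff_quot_in D f x --> d.
  apply/cvgrPdist_le => eps eps0; have [del del0 {}H] := H eps eps0.
  exists del => //= h; rewrite /= sub0r normrN => hdel h0 Dh.
  have := H h hdel Dh.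
  rewrite (_ : _ - _ = - h *: (d - h^-1 *: (f (h + x) - f x))).
    by rewrite normrZ normrN mulrC ler_pM2r ?normr_gt0.
  by rewrite scalerBr scalerA mulNr mulfV// !scaleNr scale1r opprK addrC.
by split; [apply/cvg_ex; exists d|exact: cvg_lim].
Qed.

Lemma segment_accumulation (L x : R) : 0 < L -> segment L x ->
  forall del : R, 0 < del ->
  exists h : R, [/\ h != 0, `|h| < del & segment L (h + x)].
Proof.
move=> L0; rewrite /segment /= in_itv /= => /andP[x0 xL] del del0.
have [xh|xh] := leP x (L / 2).
  pose h := Num.min (del / 2) (L / 2).
  have h0 : 0 < h by rewrite lt_min !divr_gt0.
  have h1 : h <= del / 2 by rewrite ge_min lexx.
  have h2 : h <= L / 2 by rewrite ge_min lexx orbT.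
  exists h; split; [by rewrite gt_eqF|rewrite gtr0_norm//; lra|].
  by rewrite in_itv /=; apply/andP; lra.
pose h := Num.min (del / 2) (L / 2).
have h0 : 0 < h by rewrite lt_min !divr_gt0.
have h1 : h <= del / 2 by rewrite ge_min lexx.
have h2 : h <= L / 2 by rewrite ge_min lexx orbT.
exists (- h); split; [by rewrite oppr_eq0 gt_eqF|rewrite normrN gtr0_norm//; lra|].
by rewrite in_itv /=; apply/andP; lra.
Qed.

End RelativeDerivatives.

Section Coordinates.
Context {R : realType}.

Lemma coord_le_norm (v : 'cV[R]_2) i : `|v i 0| <= `|v|.
Proof.
rewrite [leRHS]/Num.Def.normr/= mx_normrE.
exact: (le_bigmax _ (fun k : 'I_2 * 'I_1 => `|v k.1 k.2|) (i, 0)).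
Qed.

Lemma norm_le_coord (v : 'cV[R]_2) (c : R) : 0 <= c ->
  (forall i, `|v i 0| <= c) -> `|v| <= c.
Proof.
move=> c0 H; rewrite [leLHS]/Num.Def.normr/= mx_normrE.
by apply: bigmax_le => // -[i j] _; rewrite ord1 H.
Qed.

Lemma derive_in_diff_eps (D : set R) (a b : R -> 'cV[R]_2) (x : R) i (s : R) :
  `|s| <= 1 -> derivable_in D a x -> derivable_in D b x ->
  forall eps : R, 0 < eps -> exists2 del : R, 0 < del &
  forall h : R, `|h| < del -> D (h + x) ->
    `|s * (a (h + x) i 0 - b (h + x) i 0) - s * (a x i 0 - b x i 0) -
      h * (s * (derive_in D a x i 0 - derive_in D b x i 0))| <= eps * `|h|.
Proof.
move=> s1 da db eps eps0; have e20 : 0 < eps / 2 by rewrite divr_gt0.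
have [d1 d10 H1] := derive_in_eps da e20; have [d2 d20 H2] := derive_in_eps db e20.
exists (Num.min d1 d2) => [|h]; first by rewrite lt_min d10.
rewrite lt_min => /andP[hd1 hd2] Dh.
have := le_trans (coord_le_norm _ i) (H1 h hd1 Dh).
have := le_trans (coord_le_norm _ i) (H2 h hd2 Dh).
move: (derive_in D a x) (derive_in D b x) (a (h + x)) (b (h + x)) (a x) (b x).
move=> da' db' ah bh ax bx; rewrite !mxE => b1 a1.
rewrite (_ : _ - _ = s * ((ah i 0 - ax i 0 - h * da' i 0) -
   (bh i 0 - bx i 0 - h * db' i 0))); last by ring.
rewrite normrM (le_trans (ler_wpM2r (normr_ge0 _) s1))// mul1r.
by rewrite (le_trans (ler_normB _ _))// [eps]splitr mulrDl lerD.
Qed.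

End Coordinates.

Section ScalarEquations.
Context {R : realType}.
Variables (T L : R) (lambda1 lambda2 f1 f2 : 'cV[R]_2 -> R).

Definition pair_coeff (g h : 'cV[R]_2 -> R) (i : 'I_2) := if i == 0 then g else h.

Notation lam := (pair_coeff lambda1 lambda2).
Notation f := (pair_coeff f1 f2).

Lemma equation_coord (Theta : R) (yt yx y : 'cV[R]_2) :
  yt + Lambda lambda1 lambda2 y *m yx + source f1 f2 y = Theta *: unitv 0 <->
  forall i, yt i 0 + lam i y * yx i 0 + f i y = Theta * (i == 0)%:R.
Proof.
have E i : (yt + Lambda lambda1 lambda2 y *m yx + source f1 f2 y) i 0 =
    yt i 0 + lam i y * yx i 0 + f i y.
  rewrite /Lambda mul_diag_mx !mxE /pair_coeff.
  by case: (i == 0).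
have E' i : (Theta *: unitv 0 : 'cV[R]_2) i 0 = Theta * (i == 0)%:R.
  by rewrite !mxE andbT.
split=> [H i|H]; first by rewrite -E H E'.
by apply/colP => i; rewrite E H E'.
Qed.

Lemma compact_rect : compact (rect T L).
Proof. by apply: compact_setX; exact: segment_compact. Qed.

Hypotheses (T0 : 0 < T) (L0 : 0 < L).

Lemma rect0 : rect T L !=set0.
Proof.
by exists (0, 0); split; rewrite /segment /= in_itv /= lexx ltW.
Qed.

Lemma within_comp {U W : topologicalType} (A : set (R * R)) (g : R * R -> U)
    (h : U -> W) : {within A, continuous g} -> continuous h ->
  {within A, continuous (fun p => h (g p))}.
Proof. by move=> cg ch p; apply: continuous_comp; [exact: cg|exact: ch]. Qed.

Lemma within_coord (y : R * R -> 'cV[R]_2) (i : 'I_2) :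
  {within rect T L, continuous y} ->
  {within rect T L, continuous (fun p => y p i 0)}.
Proof.
move=> cy; apply: (@within_comp _ _ _ y (fun v : 'cV[R]_2 => v i 0)) => //.
exact: coord_continuous.
Qed.

Lemma within_norm (g : R * R -> R) : {within rect T L, continuous g} ->
  {within rect T L, continuous (fun p => `|g p|)}.
Proof. by move=> cg; apply: (within_comp cg); exact: norm_continuous. Qed.

Lemma rect_bounded (y : R * R -> 'cV[R]_2) : {within rect T L, continuous y} ->
  exists2 M : R, 0 <= M & forall p, rect T L p -> forall i, `|y p i 0| <= M.
Proof.
move=> cy.
have [p0 _ H0] := compact_EVT_max rect0 compact_rect
  (within_norm (@within_coord y 0 cy)).
have [p1 _ H1] := compact_EVT_max rect0 compact_rect
  (within_norm (@within_coord y 1 cy)).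
exists (`|y p0 0 0| + `|y p1 1 0|) => [|p pr]; first exact: addr_ge0.
apply: ord2P.
  by apply: le_trans (H0 p (mem_set pr)) _; rewrite lerDl.
by apply: le_trans (H1 p (mem_set pr)) _; rewrite lerDr.
Qed.

Lemma one_sided_max (D : set R) (g : R -> R) (x d : R) :
  (forall eps : R, 0 < eps -> exists2 del : R, 0 < del &
    forall h : R, `|h| < del -> D (h + x) -> `|g (h + x) - g x - h * d| <= eps * `|h|) ->
  (forall h, D (h + x) -> g (h + x) <= g x) ->
  ((exists2 r : R, 0 < r & forall h : R, 0 < h < r -> D (h + x)) -> d <= 0) /\
  ((exists2 r : R, 0 < r & forall h : R, 0 < h < r -> D (- h + x)) -> 0 <= d).
Proof.
move=> H gmax; split=> -[r r0 Dr]; apply/ler_addgt0Pr => eps eps0;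
  have [del del0 {}H] := H eps eps0;
  pose h := Num.min del r / 2;
  have h0 : 0 < h by rewrite divr_gt0// lt_min del0.
all: have h1 : h < del by rewrite ltr_pdivrMr// gt_min; apply/orP; left; lra.
all: have h2 : h < r by rewrite ltr_pdivrMr// gt_min; apply/orP; right; lra.
- have Dh : D (h + x) by apply: Dr; rewrite h0.
  have := H h _ Dh; rewrite gtr0_norm// => /(_ h1)/ler_normlP[A B].
  have C := gmax h Dh; rewrite add0r -(ler_pM2l h0); lra.
- have Dh : D (- h + x) by apply: Dr; rewrite h0.
  have := H (- h) _ Dh; rewrite normrN gtr0_norm// => /(_ h1)/ler_normlP[A B].
  have C := gmax (- h) Dh; rewrite -(ler_pM2l h0) mulr0; lra.
Qed.

End ScalarEquations.

Section Uniqueness.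
Context {R : realType}.
Variables (T L : R) (lambda1 lambda2 f1 f2 : 'cV[R]_2 -> R).
Hypotheses (T0 : 0 < T) (L0 : 0 < L).
Hypotheses (lambda1_smooth : smooth lambda1) (lambda2_smooth : smooth lambda2)
  (f1_smooth : smooth f1) (f2_smooth : smooth f2).

Notation lam := (pair_coeff lambda1 lambda2).
Notation f := (pair_coeff f1 f2).

Lemma pair_coeff_smooth (g h : 'cV[R]_2 -> R) i : smooth g -> smooth h ->
  smooth (pair_coeff g h i).
Proof. by rewrite /pair_coeff; case: ifP. Qed.

(** Going back from [ts], the envelope decays at rate [kap], while the slope bound and the error
    [W * |h|] let [g] decay at rate at most [K + 1]. For a step [eta] with [kap * eta <= 1] the
    comparison gives [kap <= (K + 1) * (1 + kap * eta) <= 2 * (K + 1)], contrary to the choice of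
    [kap]. Only earlier times are compared, so [ts = T] is allowed. *)
Lemma no_fast_maximum (K W U ts : R) (g : R -> R) :
  0 <= K -> 0 < W -> 0 < ts -> ts <= T -> g ts = W -> U <= K * W ->
  (exists2 del : R, 0 < del & forall h : R, `|h| < del -> segment T (h + ts) ->
    `|g (h + ts) - g ts - h * U| <= W * `|h|) ->
  (forall t, segment T t -> g t <= W * expR ((2 * (K + 1) + 1) * (t - ts))) ->
  False.
Proof.
move=> K0 Wpos ts0 tsT gW Wbound [del del0 H] gmax.
set kap := 2 * (K + 1) + 1 in gmax.
have kap0 : 0 < kap by rewrite /kap; lra.
have [eta [eta0 eta1 eta2 eta3]] : exists eta : R,
    [/\ 0 < eta, eta < del, eta <= ts & kap * eta <= 1].
  exists (Num.min (Num.min (del / 2) ts) kap^-1); split.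
  - by rewrite !lt_min ts0 invr_gt0 kap0 !andbT divr_gt0.
  - by rewrite !gt_min ltr_pdivrMr// ltr_pMr// ltr1n.
  - by rewrite !ge_min lexx orbT.
  - by rewrite mulrC -ler_pdivlMr// mul1r ge_min lexx orbT.
have etaT : segment T (- eta + ts).
  rewrite /segment /= in_itv /= addrC subr_ge0 eta2 (le_trans _ tsT)//.
  by rewrite gerBl ltW.
have := H (- eta); rewrite normrN gtr0_norm// => /(_ eta1 etaT) /ler_normlP[H1 H2].
have := gmax _ etaT; rewrite addrK mulrN expRN => W'.
have k0 : 0 <= kap * eta by rewrite mulr_ge0// ltW.
have k1 : 0 < 1 + kap * eta by rewrite ltr_wpDr.
have W'' : g (- eta + ts) * (1 + kap * eta) <= W.
  rewrite -ler_pdivlMr//; apply: (le_trans W'); rewrite ler_wpM2l ?(ltW Wpos)//.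
  by rewrite lef_pV2 ?posrE ?expR_gt0// expR_ge1Dx.
rewrite gW in H1.
move: H1 W''; move: (g (- eta + ts)) => S; clear - K0 Wpos Wbound kap0 eta0 eta3 k1.
move=> H1 W''.
have key : W - eta * (K * W) - W * eta <= S.
  have : eta * U <= eta * (K * W) by rewrite ler_pM2l.
  lra.
have key2 : (W - eta * (K * W) - W * eta) * (1 + kap * eta) <= W.
  by apply: le_trans W''; rewrite ler_wpM2r// ltW.
have : W * eta * (kap - (K + 1) * (1 + kap * eta)) <= 0.
  move: key2; rewrite -subr_ge0 -oppr_le0; congr (_ <= 0); ring.
rewrite pmulr_rle0 ?mulr_gt0// subr_le0 => key3.
have : (K + 1) * (1 + kap * eta) <= (K + 1) * 2.
  by rewrite ler_wpM2l ?addr_ge0// -[2]/(1 + 1) lerD2l.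
by move: key3; rewrite {1}/kap; lra.
Qed.

(* Maximum principle: at a maximum of [exp (- kappa t) |y_i - z_i|] the space
   derivative vanishes, by periodicity also when it is attained at [x = 0] or
   [x = L], and the time derivative contradicts the equation. *)
Lemma solution_unique (Theta : R * R -> R) (y0 : R -> 'cV[R]_2)
    (y z : R * R -> 'cV[R]_2) :
  solution T L lambda1 lambda2 f1 f2 Theta y0 y ->
  solution T L lambda1 lambda2 f1 f2 Theta y0 z ->
  forall p, rect T L p -> z p = y p.
Proof.
move=> [[[cy [dty dxy _ _]] py] Ey _ y_0] [[[cz [dtz dxz _ [cdxz _]]] pz] Ez _ z_0].
have [My My0 HMy] := rect_bounded T0 L0 cy.
have [Mz Mz0 HMz] := rect_bounded T0 L0 cz.
have [Md Md0 HMd] := rect_bounded T0 L0 cdxz.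
pose r := My + Mz.
have yr p i : rect T L p -> `|y p i 0| <= r.
  by move=> pr; apply: le_trans (HMy p pr i) _; rewrite lerDl.
have zr p i : rect T L p -> `|z p i 0| <= r.
  by move=> pr; apply: le_trans (HMz p pr i) _; rewrite lerDr.
have /choice[A HA] i := ex2_and
  (smooth_box_lip r (pair_coeff_smooth i lambda1_smooth lambda2_smooth)).
have /choice[B HB] i := ex2_and
  (smooth_box_lip r (pair_coeff_smooth i f1_smooth f2_smooth)).
pose K := \sum_i (A i * Md + B i).
have AB0 i : 0 <= A i * Md + B i.
  by have [? _] := HA i; have [? _] := HB i; rewrite addr_ge0// mulr_ge0.
have K0 : 0 <= K by exact: sumr_ge0.
have ABK i : A i * Md + B i <= K by rewrite /K (bigD1 i)//= lerDl; exact: sumr_ge0.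
pose kap := 2 * (K + 1) + 1.
have kap0 : 0 < kap by rewrite /kap; lra.
pose w i p := y p i 0 - z p i 0.
have cw i : {within rect T L, continuous (w i)}.
  move=> p; apply: cvgB; first exact: (@within_coord _ T L y i cy).
  exact: (@within_coord _ T L z i cz).
pose phi i p := expR (- (kap * p.1)) * `|w i p|.
have cphi i : {within rect T L, continuous (phi i)}.
  move=> p; apply: cvgM; last exact: (within_norm (cw i)).
  apply: (@continuous_comp (subspace (rect T L)) _ _ (fun p => - (kap * p.1)) expR);
    last exact: continuous_expR.
  apply: cvgN; apply: cvgM; first exact: cvg_cst.
  by apply: (@continuous_subspaceT _ _ (rect T L) fst) => q; exact: cvg_fst.
have EVT i := compact_EVT_max (rect0 T0 L0) (@compact_rect _ T L) (cphi i).
(* The maximum is taken over both components, so that at [P] the other component, which enters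
   through the coefficients, is bounded by the maximal one. *)
have [i [P Pr Pmax]] : exists i, exists2 P, rect T L P &
    forall j q, rect T L q -> phi j q <= phi i P.
  have [P0 /set_mem P0r HP0] := EVT 0; have [P1 /set_mem P1r HP1] := EVT 1.
  have [h|/ltW h] := leP (phi 0 P0) (phi 1 P1).
    exists 1, P1 => //; apply: ord2P => q /mem_set qr; last exact: HP1.
    exact: le_trans (HP0 q qr) h.
  exists 0, P0 => //; apply: ord2P => q /mem_set qr; first exact: HP0.
  exact: le_trans (HP1 q qr) h.
suff W0 : w i P = 0.
  move=> p pr; apply/esym/eqP; rewrite -subr_eq0; apply/eqP/colP => j.
  have := Pmax j p pr; rewrite /phi W0 normr0 mulr0.
  rewrite pmulr_rle0 ?expR_gt0// normr_le0 => /eqP.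
  by rewrite /w !mxE.
apply/eqP; rewrite -normr_le0 leNgt; apply/negP => Wpos.
case: P Pr Pmax Wpos => ts xs [/= tsT xsL] Pmax Wpos.
have Pr : rect T L (ts, xs) by [].
have tI := tsT; rewrite /segment /= in_itv /= in tI; case/andP: tI => ts0 tsT'.
have xI := xsL; rewrite /segment /= in_itv /= in xI; case/andP: xI => xs0 xsL'.
have wmax j q : rect T L q -> `|w j q| <= `|w i (ts, xs)| * expR (kap * (q.1 - ts)).
  move=> qr; have := Pmax j q qr; rewrite /phi /= expRN mulrC ler_pdivrMr ?expR_gt0//.
  by rewrite mulrAC -expRD [- _ + _]addrC -mulrBr mulrC.
have ts_gt0 : 0 < ts.
  rewrite lt_neqAle ts0 andbT; apply/eqP => t0.
  by move: Wpos; rewrite -t0 /w y_0// z_0// subrr normr0 ltxx.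
(* [sg * w i] is differentiable relative to the rectangle, stays below [|w i|] and touches it at the
   maximum; it replaces the absolute value. *)
pose sg := Num.sg (w i (ts, xs)).
have sgW : sg * w i (ts, xs) = `|w i (ts, xs)| by rewrite /sg -normrEsg.
have sg1 q : sg * w i q <= `|w i q|.
  rewrite (le_trans (ler_norm _))// normrM normr_sg; case: (_ != 0); rewrite ?mul1r// mul0r//.
have sgle1 : `|sg| <= 1 by rewrite normr_sg; case: (_ != 0).
pose wt := dt T y (ts, xs) i 0 - dt T z (ts, xs) i 0.
pose wx x := dx L y (ts, x) i 0 - dx L z (ts, x) i 0.
have side x : segment L x -> sg * w i (ts, x) = `|w i (ts, xs)| ->
    (x < L -> sg * wx x <= 0) /\ (0 < x -> 0 <= sg * wx x).
  move=> xL Ex.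
  have [] := @one_sided_max R (segment L) (fun x => sg * w i (ts, x)) x (sg * wx x).
  - exact: (@derive_in_diff_eps _ _ (fun x => y (ts, x)) (fun x => z (ts, x)) x i sg sgle1
      (dxy (ts, x) (conj tsT xL)) (dxz (ts, x) (conj tsT xL))).
  - move=> h hx; rewrite Ex (le_trans (sg1 _))//.
    by have := wmax i (ts, h + x) (conj tsT hx); rewrite /= subrr mulr0 expR0 mulr1.
  move: xL; rewrite /segment /= in_itv /= => /andP[x0 xL] Hr Hl; split=> hx.
    apply: Hr; exists (L - x); first by rewrite subr_gt0.
    move=> h /andP[h0 h1]; rewrite in_itv /=; apply/andP; lra.
  apply: Hl; exists x => // h /andP[h0 h1]; rewrite in_itv /=; apply/andP; lra.
have per j : (j <= 1)%N -> (forall t, segment T t ->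
    iter j (dx L) y (t, 0) = iter j (dx L) y (t, L)) /\
    (forall t, segment T t -> iter j (dx L) z (t, 0) = iter j (dx L) z (t, L)).
  by move=> j1; split; [exact: py|exact: pz].
have w_per : w i (ts, 0) = w i (ts, L).
  have [py0 pz0] := per 0%N isT.
  by rewrite /w (py0 ts tsT : y (ts, 0) = _) (pz0 ts tsT : z (ts, 0) = _).
have wx_per : wx 0 = wx L.
  have [py1 pz1] := per 1%N isT.
  by rewrite /wx (py1 ts tsT : dx L y (ts, 0) = _) (pz1 ts tsT : dx L z (ts, 0) = _).
have s0L : segment L 0 by rewrite /segment /= in_itv /= lexx ltW.
have sLL : segment L L by rewrite /segment /= in_itv /= lexx ltW.
have wx0 : sg * wx xs = 0.
  have [Hr Hl] := side xs xsL sgW.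
  apply/eqP; rewrite eq_le; apply/andP; split.
    have [/Hr//|xL] := ltP xs L.
    have E : xs = L by apply/eqP; rewrite eq_le xsL'.
    have [H0 _] := side 0 s0L (etrans (congr1 _ w_per)
      (etrans (congr1 (fun x => sg * w i (ts, x)) (esym E)) sgW)).
    by rewrite E -wx_per; apply: H0.
  have [/Hl//|x0] := ltP 0 xs.
  have E : xs = 0 by apply/eqP; rewrite eq_le x0.
  have [_ H0] := side L sLL (etrans (congr1 _ (esym w_per))
    (etrans (congr1 (fun x => sg * w i (ts, x)) (esym E)) sgW)).
  by rewrite E wx_per; apply: H0.
have Wbound : sg * wt <= K * `|w i (ts, xs)|.
  have EY := (equation_coord lambda1 lambda2 f1 f2 _ _ _ _).1 (Ey (ts, xs) Pr) i.
  have EZ := (equation_coord lambda1 lambda2 f1 f2 _ _ _ _).1 (Ez (ts, xs) Pr) i.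
  have [A0 HAi] := HA i; have [B0 HBi] := HB i.
  have yz j : `|y (ts, xs) j 0 - z (ts, xs) j 0| <= `|w i (ts, xs)|.
    by have := wmax j (ts, xs) Pr; rewrite /= subrr mulr0 expR0 mulr1.
  have a1 := HAi _ _ (fun j => yr _ j Pr) (fun j => zr _ j Pr) _ yz.
  have b1 := HBi _ _ (fun j => yr _ j Pr) (fun j => zr _ j Pr) _ yz.
  have d1 := HMd (ts, xs) Pr i.
  have -> : sg * wt = - (lam i (y (ts, xs)) * (sg * wx xs)) - sg * (
      (lam i (y (ts, xs)) - lam i (z (ts, xs))) * dx L z (ts, xs) i 0 +
      (f i (y (ts, xs)) - f i (z (ts, xs)))).
    rewrite /wt /wx; move: EY EZ; rewrite -!/(dx L _ _).
    set yt := dt T y _ i 0; set zt := dt T z _ i 0.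
    set yx := dx L y _ i 0; set zx := dx L z _ i 0.
    set fy := f i _; set fz := f i _; set ly := lam i _; set lz := lam i _ => EY EZ.
    have E : yt + ly * yx + fy - (zt + lz * zx + fz) = 0 by rewrite EY EZ subrr.
    by rewrite -[LHS]subr0 -[X in _ - X](mulr0 sg) -E; ring.
  rewrite wx0 mulr0 oppr0 sub0r (le_trans (ler_norm _))// normrN normrM.
  apply: (le_trans (ler_wpM2r (normr_ge0 _) sgle1)).
  rewrite mul1r; apply: (@le_trans _ _ ((A i * Md + B i) * `|w i (ts, xs)|)).
    rewrite [leRHS]mulrDl (le_trans (ler_normD _ _))// lerD// normrM mulrAC.
    by rewrite ler_pM.
  by rewrite ler_wpM2r.
have := @no_fast_maximum K `|w i (ts, xs)| (sg * wt) ts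
  (fun t => sg * w i (t, xs)) K0 Wpos ts_gt0 tsT' sgW Wbound; apply.
  exact: (@derive_in_diff_eps _ (segment T) (fun t => y (t, xs))
    (fun t => z (t, xs)) ts i sg sgle1 (dty (ts, xs) Pr) (dtz (ts, xs) Pr) _ Wpos).
move=> t tT; apply: le_trans (sg1 (t, xs)) _.
exact: (wmax i (t, xs) (conj tT xsL)).
Qed.

End Uniqueness.

(** * The implicit function theorem *)

Section ImplicitFunction.
Context {R : realType}.

Lemma between_dist (a b z : R) :
  Num.min a b <= z <= Num.max a b -> `|z - a| <= `|b - a|.
Proof.
move=> /andP[zl zu]; have [ab|ba] := leP a b.
  rewrite (min_idPl ab) in zl; rewrite (max_idPr ab) in zu.
  by rewrite !ger0_norm ?subr_ge0// lerD2r.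
rewrite (min_idPr (ltW ba)) in zl; rewrite (max_idPl (ltW ba)) in zu.
by rewrite ![`|_ - a|]distrC !ger0_norm ?subr_ge0 ?(ltW ba)// lerD2l lerN2.
Qed.

(** At a zero of [f] the term with the derivative of [k] drops out, so a Lipschitz estimate at [x]
    takes the place of differentiability of [k]. *)
Lemma is_derive_mul0 {V : normedModType R} (f k : V -> R) (x e : V) (d C : R) :
  f x = 0 -> is_derive x e f d ->
  (forall h : R, `|k (h *: e + x) - k x| <= C * `|h|) ->
  is_derive x e (fun z => f z * k z) (d * k x).
Proof.
move=> fx0 fd kC; apply/is_derive_epsP => eps eps0.
pose A := `|d| + 1; pose B := `|k x| + 1.
have A0 : 0 < A by rewrite ltr_wpDl.
have B0 : 0 < B by rewrite ltr_wpDl.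
have C0 : 0 <= C by have := kC 1; rewrite normr1 mulr1; apply: le_trans.
have C1 : 0 < C + 1 by rewrite ltr_wpDl.
pose e1 := Num.min 1 (eps / (2 * B)).
have e10 : 0 < e1 by rewrite lt_min ltr01 divr_gt0// mulr_gt0.
have [del del0 H] := (is_derive_epsP _ _ _ _).1 fd _ e10.
exists (Num.min del (eps / (2 * A * (C + 1)))).
  by rewrite lt_min del0 divr_gt0// !mulr_gt0.
move=> h; rewrite lt_min => /andP[hdel]; rewrite ltr_pdivlMr ?mulr_gt0// => h2.
have {}H := H h hdel; rewrite fx0 subr0 in H.
rewrite fx0 mul0r subr0.
have fA : `|f (h *: e + x)| <= A * `|h|.
  rewrite -[f _](subrK (h * d)) (le_trans (ler_normD _ _))// mulrDl mul1r addrC.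
  rewrite lerD//; first by rewrite normrM mulrC.
  by apply: (le_trans H); rewrite ler_piMl// ge_min lexx.
rewrite (_ : _ - _ = f (h *: e + x) * (k (h *: e + x) - k x) +
  (f (h *: e + x) - h * d) * k x); last by ring.
rewrite (le_trans (ler_normD _ _))// [X in _ <= X * _]splitr [leRHS]mulrDl !normrM lerD//.
  apply: (le_trans (ler_pM _ _ fA (kC h))) => //.
  have : 2 * (A * `|h| * C) <= `|h| * (2 * A * (C + 1)).
    rewrite -subr_ge0 (_ : _ - _ = 2 * A * `|h|); last by ring.
    by rewrite !mulr_ge0// ltW.
  move=> /le_lt_trans/(_ h2)/ltW h3.
  rewrite mulrA ler_wpM2r//.
  by rewrite ler_pdivlMr// mulrC.
apply: (le_trans (ler_wpM2r (normr_ge0 _) H)).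
rewrite mulrAC ler_wpM2r//.
apply: (@le_trans _ _ (eps / (2 * B) * B)).
  by rewrite ler_pM ?(ltW e10)// ?ge_min ?lexx ?orbT// lerDl.
by rewrite invfM mulrA divfK ?gt_eqF.
Qed.

Variables (g F : 'cV[R]_2 -> R).
Hypotheses (g_smooth : smooth g) (F_smooth : smooth F) (F0 : F 0 = 0).
Let c0 := partial 0 F 0.
Hypothesis c0_neq0 : c0 != 0.

(** The left-hand side of the second equation as a function of pointwise values: [a] stands for
    [y_1], [v] for [y_2], and [p], [q] for the derivatives of [y_2] in [t] and [x]. The derivative
    in [a] is [slope], close to [c0] for small arguments. *)
Definition phi (a v p q : R) := p + g (vec2 a v) * q + F (vec2 a v).
Definition slope (a v q : R) :=
  partial 0 g (vec2 a v) * q + partial 0 F (vec2 a v).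

Lemma is_derive_phi (a v p q : R) :
  is_derive a 1 (fun s => phi s v p q) (slope a v q).
Proof.
have := is_derive_add (is_derive_add (is_derive_const p a 1)
  (is_derive_mul (smooth_is_derive0 a v g_smooth) (is_derive_const q a 1)))
  (smooth_is_derive0 a v F_smooth).
by congr (is_derive _ _ _ _); rewrite /slope mulr0 addr0 add0r.
Qed.

Lemma phi_mvt (a b v p q : R) : exists2 xi : R,
  Num.min a b <= xi <= Num.max a b &
  phi b v p q - phi a v p q = slope xi v q * (b - a).
Proof. exact: (mvt a b (fun s => is_derive_phi s v p q)). Qed.

Lemma vec2_box (a v r : R) : `|a| <= r -> `|v| <= r ->
  forall i, `|vec2 a v i 0| <= r.
Proof. by move=> ar vr; apply: ord2P; rewrite ?vec2_0 ?vec2_1. Qed.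

Lemma slope_near : exists r m : R, [/\ 0 < r, r <= 1, 0 < m &
  forall a v q, `|a| <= r -> `|v| <= m -> `|q| <= m -> `|c0| / 2 <= Num.sg c0 * slope a v q].
Proof.
have c00 : 0 < `|c0| by rewrite normr_gt0.
have [|d d0 Hd] := continuous_cvP 0 (smooth_continuous (smooth_partial 0 F_smooth))
  (eps := `|c0| / 4).
  by rewrite divr_gt0.
have [G G0 HG] := continuous_box_bounded 1 (smooth_continuous (smooth_partial 0 g_smooth)).
pose r := Num.min 1 (d / 2).
have r0 : 0 < r by rewrite lt_min ltr01 divr_gt0.
have r1 : r <= 1 by rewrite ge_min lexx.
have rd : r < d.
  by apply: (@le_lt_trans _ _ (d / 2)); rewrite ?ge_min ?lexx ?orbT//; lra.
pose m := Num.min r (`|c0| / (4 * (G + 1))).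
have G10 : 0 < G + 1 by rewrite ltr_wpDl.
have m0 : 0 < m by rewrite lt_min r0 divr_gt0// mulr_gt0.
have mr : m <= r by rewrite ge_min lexx.
exists r, m; split=> // a v q ar vm qm.
have vr : `|v| <= r by exact: le_trans mr.
have H1 : `|partial 0 F (vec2 a v) - c0| <= `|c0| / 4.
  by apply: Hd => i; rewrite [X in _ - X]mxE subr0 (le_lt_trans (vec2_box ar vr i)).
have H2 : `|partial 0 g (vec2 a v) * q| <= `|c0| / 4.
  rewrite normrM; apply: (@le_trans _ _ (G * m)).
    by rewrite ler_pM//; apply: HG; apply: vec2_box; exact: le_trans r1.
  apply: (@le_trans _ _ ((G + 1) * (`|c0| / (4 * (G + 1))))).
    by rewrite ler_pM// ?(ltW m0)// ?lerDl// ge_min lexx orbT.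
  by rewrite le_eqVlt; apply/orP; left; apply/eqP; field; rewrite gt_eqF.
have : `|slope a v q - c0| <= `|c0| / 4 + `|c0| / 4.
  rewrite (_ : _ - _ = partial 0 g (vec2 a v) * q +
     (partial 0 F (vec2 a v) - c0)); last by rewrite /slope; ring.
  by rewrite (le_trans (ler_normD _ _))// lerD.
have : `|Num.sg c0 * (slope a v q - c0)| <= `|slope a v q - c0|.
  by rewrite normrM normr_sg c0_neq0 mul1r.
rewrite mulrBr -normrEsg ler_norml => /andP[]; move: `|slope a v q - c0| => z; lra.
Qed.

Lemma phi0_bound : exists2 A : R, 0 <= A & forall (v p q M : R), M <= 1 ->
  `|v| <= M -> `|p| <= M -> `|q| <= M -> `|phi 0 v p q| <= A * M.
Proof.
have [G G0 HG] := continuous_box_bounded 1 (smooth_continuous g_smooth).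
have [B B0 HB] := smooth_box_lip 1 F_smooth.
exists (1 + G + B) => [|v p q M M1 vM pM qM]; first by rewrite !addr_ge0.
have M0 : 0 <= M by exact: le_trans vM.
rewrite /phi !mulrDl mul1r (le_trans (ler_normD _ _))// lerD//.
  rewrite (le_trans (ler_normD _ _))// lerD// normrM ler_pM//.
  by apply: HG; apply: vec2_box; rewrite ?normr0// (le_trans vM).
have v0 : forall i, `|vec2 0 v i 0| <= M.
  by apply: vec2_box; rewrite ?normr0.
have := HB (vec2 0 v) 0 (fun i => le_trans (v0 i) M1) _ M _; rewrite F0 subr0.
by apply=> i; rewrite ?[X in _ - X]mxE ?subr0// mxE normr0.
Qed.

Lemma slope_lip : exists2 A : R, 0 <= A & forall (a b v w q s del : R),
  `|a| <= 1 -> `|b| <= 1 -> `|v| <= 1 -> `|w| <= 1 -> `|q| <= 1 ->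
  `|a - b| <= del -> `|v - w| <= del -> `|q - s| <= del ->
  `|slope a v q - slope b w s| <= A * del.
Proof.
have [G G0 HG] := continuous_box_bounded 1 (smooth_continuous (smooth_partial 0 g_smooth)).
have [A A0 HA] := smooth_box_lip 1 (smooth_partial 0 g_smooth).
have [B B0 HB] := smooth_box_lip 1 (smooth_partial 0 F_smooth).
exists (A + G + B) => [|a b v w q s del a1 b1 v1 w1 q1 ab vw qs].
  by rewrite !addr_ge0.
have d i : `|vec2 a v i 0 - vec2 b w i 0| <= del.
  by move: i; apply: ord2P; rewrite ?vec2_0 ?vec2_1.
have e1 := HA _ _ (vec2_box a1 v1) (vec2_box b1 w1) _ d.
have e2 := HB _ _ (vec2_box a1 v1) (vec2_box b1 w1) _ d.
have e3 := HG _ (vec2_box b1 w1).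
have del0 : 0 <= del by exact: le_trans ab.
rewrite /slope (_ : _ - _ = (partial 0 g (vec2 a v) - partial 0 g (vec2 b w)) * q +
  partial 0 g (vec2 b w) * (q - s) +
  (partial 0 F (vec2 a v) - partial 0 F (vec2 b w))); last by ring.
rewrite [leRHS]mulrDl (le_trans (ler_normD _ _))// lerD//.
rewrite [leRHS]mulrDl (le_trans (ler_normD _ _))// !normrM lerD//.
  by rewrite -[leRHS]mulr1 ler_pM.
by rewrite ler_pM.
Qed.

Section Solution.
Variables (r m : R).
Hypotheses (r1 : r <= 1) (slopeP : forall a v q,
  `|a| <= r -> `|v| <= m -> `|q| <= m -> `|c0| / 2 <= Num.sg c0 * slope a v q).
Let c := `|c0| / 2.

Let c_gt0 : 0 < c. Proof. by rewrite divr_gt0// normr_gt0. Qed.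

Lemma slope_ge (a v q : R) : `|a| <= r -> `|v| <= m -> `|q| <= m ->
  c <= `|slope a v q|.
Proof.
move=> ar vm qm; apply: (le_trans (slopeP ar vm qm)).
by rewrite (le_trans (ler_norm _))// normrM normr_sg c0_neq0 mul1r.
Qed.

Lemma phi_expanding (a b v p q : R) : `|a| <= r -> `|b| <= r -> `|v| <= m ->
  `|q| <= m -> c * `|b - a| <= `|phi b v p q - phi a v p q|.
Proof.
move=> ar br vm qm; have [xi xib ->] := phi_mvt a b v p q.
by rewrite normrM ler_wpM2r// slope_ge//; exact: norm_between_le xib ar br.
Qed.

(** Multiplied by the sign of [c0], [phi] increases in [a] at a rate of at least [c]; starting from
    a value of size at most [c * r] at 0, it reaches both signs on [[- r, r]]. *)
Lemma phi_solvable (v p q : R) : 0 <= r -> `|v| <= m -> `|q| <= m ->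
  `|phi 0 v p q| <= c * r -> exists2 a, `|a| <= r & phi a v p q = 0.
Proof.
move=> r0 vm qm ph.
pose sphi a := Num.sg c0 * phi a v p q.
have csphi : continuous sphi.
  move=> a; apply/differentiable_continuous/derivable1_diffP.
  by case: (is_derive_scale (Num.sg c0) (is_derive_phi a v p q)).
have sphi0 : `|sphi 0| <= c * r by rewrite /sphi normrM normr_sg c0_neq0 mul1r.
have increase a b : `|a| <= r -> `|b| <= r -> a <= b -> c * (b - a) <= sphi b - sphi a.
  move=> ar br ab; have [xi xib E] := phi_mvt a b v p q.
  rewrite -mulrBr E mulrA ler_wpM2r ?subr_ge0//.
  exact: slopeP (norm_between_le xib ar br) vm qm.
have rr : `|r| <= r by rewrite ger0_norm.
have r'r : `|- r| <= r by rewrite normrN.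
have z0 : `|0 : R| <= r by rewrite normr0.
have hi : 0 <= sphi r.
  have := increase 0 r z0 rr r0; rewrite subr0.
  by move: sphi0; rewrite ler_norml => /andP[]; lra.
have lo : sphi (- r) <= 0.
  have := increase (- r) 0 r'r z0; rewrite oppr_le0 sub0r opprK => /(_ r0).
  by move: sphi0; rewrite ler_norml => /andP[]; lra.
have r2 : - r <= r by rewrite (le_trans _ r0)// oppr_le0.
have cs : {within `[(- r), r], continuous sphi} by exact: continuous_subspaceT.
have [|a] := IVT (v := 0) r2 cs.
  by rewrite ge_min lo le_max hi orbT.
rewrite in_itv /= -ler_norml => ar /eqP; rewrite mulf_eq0 sgr_eq0 (negbTE c0_neq0) /=.
by move=> /eqP; exists a.
Qed.

Lemma phi_inj (a b v p q : R) : `|a| <= r -> `|b| <= r -> `|v| <= m ->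
  `|q| <= m -> phi a v p q = 0 -> phi b v p q = 0 -> a = b.
Proof.
move=> ar br vm qm a0 b0; have := phi_expanding p ar br vm qm.
rewrite a0 b0 subr0 normr0 pmulr_rle0// normr_le0 subr_eq0.
by move=> /eqP.
Qed.

(** With the first argument frozen at [w x], [N] is differentiable by the chain rule and vanishes at
    [x]. The mean value theorem in that argument gives [w z = w x + N z * k z], where [k z] is minus
    the inverse of the slope at an intermediate point. This shows that [w] is Lipschitz at [x],
    hence that [k] is, and [is_derive_mul0] concludes. *)
Lemma implicit_is_derive (v p q w : R * R -> R) (x e : R * R) (M v' p' q' : R) :
  M <= m -> M <= 1 -> e = et \/ e = ex ->
  Pd 1 M v -> Pd 1 M p -> Pd 1 M q ->
  is_derive x e v v' -> is_derive x e p p' -> is_derive x e q q' ->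
  (forall z, `|w z| <= r) -> (forall z, phi (w z) (v z) (p z) (q z) = 0) ->
  is_derive x e w (- (p' + (partial 1 g (vec2 (w x) (v x)) * v' * q x +
     g (vec2 (w x) (v x)) * q') + partial 1 F (vec2 (w x) (v x)) * v') *
     (slope (w x) (v x) (q x))^-1).
Proof.
move=> Mm M1 Ee Hv Hp Hq dv dp dq wr w0.
have vb z : `|v z| <= m by apply: le_trans Mm; exact: Pd_bound Hv.
have qb z : `|q z| <= m by apply: le_trans Mm; exact: Pd_bound Hq.
have v1 z : `|v z| <= 1 by apply: le_trans M1; exact: Pd_bound Hv.
have q1 z : `|q z| <= 1 by apply: le_trans M1; exact: Pd_bound Hq.
have w1 z : `|w z| <= 1 by exact: le_trans r1.
have lip (u : R * R -> R) : Pd 1 M u -> forall h, `|u (h *: e + x) - u x| <= M * `|h|.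
  move=> Hu h; have [dt dx Ht Hx] := Pd_derive Hu.
  case: Ee => ->; [apply: mvt_dir dt _|apply: mvt_dir dx _] => z.
    exact: Pd_bound Ht.
  exact: Pd_bound Hx.
pose N z := phi (w x) (v z) (p z) (q z).
have Nx : N x = 0 by exact: w0.
have dN : is_derive x e N (p' + (partial 1 g (vec2 (w x) (v x)) * v' * q x +
     g (vec2 (w x) (v x)) * q') + partial 1 F (vec2 (w x) (v x)) * v').
  pose u (i : 'I_2) z := if i == 0 then w x else v z.
  have uE z : cv u z = vec2 (w x) (v z) by [].
  have du : forall i, is_derive x e (u i) (if i == 0 then 0 else v').
    by apply: ord2P; rewrite /u /=; [exact: is_derive_const|].
  have dg := is_derive_comp g_smooth du; have dF := is_derive_comp F_smooth du.
  rewrite /= !mulr0 !add0r !uE in dg dF.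
  have := is_derive_add (is_derive_add dp (is_derive_mul dg dq)) dF.
  by rewrite uE; congr (is_derive _ _ _ _); apply/funext => z; rewrite uE.
have [A A0 HA] := slope_lip.
have mv z : exists xi : R, Num.min (w x) (w z) <= xi <= Num.max (w x) (w z) /\
    phi (w z) (v z) (p z) (q z) - N z = slope xi (v z) (q z) * (w z - w x).
  by have [xi xib E] := phi_mvt (w x) (w z) (v z) (p z) (q z); exists xi.
have /choice[xi Hxi] := mv.
have xir z : `|xi z| <= r by exact: norm_between_le (Hxi z).1 (wr x) (wr z).
have xi1 z : `|xi z| <= 1 by exact: le_trans r1.
pose k z := - (slope (xi z) (v z) (q z))^-1.
have slc z := slope_ge (xir z) (vb z) (qb z).
have sl0 z : slope (xi z) (v z) (q z) != 0.
  by rewrite -normr_gt0; exact: lt_le_trans (slc z).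
have wE z : w z = w x + N z * k z.
  have E := (Hxi z).2; rewrite w0 sub0r in E.
  by rewrite /k mulrN -mulNr E mulrAC mulfV// mul1r addrC subrK.
have kc z : `|k z| <= c^-1.
  by rewrite /k normrN normfV lef_pV2 ?posrE// (lt_le_trans c_gt0).
have [B B0 HB] : exists2 B : R, 0 <= B & forall h : R, `|w (h *: e + x) - w x| <= B * `|h|.
  have [G G0 HG] := continuous_box_bounded 1 (smooth_continuous g_smooth).
  have [G' G'0 HG'] := smooth_box_lip 1 g_smooth.
  have [F' F'0 HF'] := smooth_box_lip 1 F_smooth.
  have M0 := nice_pos (nice_Pd _) Hv.
  exists ((M + (G' * M + G * M) + F' * M) * c^-1).
    by rewrite mulr_ge0 ?invr_ge0 ?(ltW c_gt0)// !addr_ge0// mulr_ge0.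
  move=> h; rewrite (wE (h *: e + x)) addrAC subrr add0r normrM mulrAC ler_pM//
    -[N (_ + _)]subr0 -Nx.
  set z := h *: e + x.
  have d : forall i, `|vec2 (w x) (v z) i 0 - vec2 (w x) (v x) i 0| <= M * `|h|.
    by apply: ord2P; rewrite ?vec2_0 ?vec2_1 ?subrr ?normr0 ?mulr_ge0//; exact: lip.
  have e1 := HG' _ _ (vec2_box (w1 x) (v1 z)) (vec2_box (w1 x) (v1 x)) _ d.
  have e2 := HF' _ _ (vec2_box (w1 x) (v1 z)) (vec2_box (w1 x) (v1 x)) _ d.
  rewrite /N /phi (_ : _ - _ = (p z - p x) +
     ((g (vec2 (w x) (v z)) - g (vec2 (w x) (v x))) * q z +
      g (vec2 (w x) (v x)) * (q z - q x)) +
     (F (vec2 (w x) (v z)) - F (vec2 (w x) (v x)))); last by ring.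
  rewrite [leRHS]mulrDl (le_trans (ler_normD _ _))// lerD//; last by rewrite -mulrA.
  rewrite [leRHS]mulrDl (le_trans (ler_normD _ _))// lerD//; first exact: lip.
  rewrite [leRHS]mulrDl (le_trans (ler_normD _ _))// !normrM -!mulrA lerD//.
    by rewrite -[leRHS]mulr1 ler_pM.
  by rewrite ler_pM//; [apply: HG; exact: vec2_box|exact: lip].
have xx : xi x = w x by have := (Hxi x).1; rewrite minxx maxxx => /le_anti.
have kx : k x = - (slope (w x) (v x) (q x))^-1.
  by rewrite /k xx.
have klip h : `|k (h *: e + x) - k x| <= A * (B + M) * (c^-1 * c^-1) * `|h|.
  set z := h *: e + x.
  rewrite /k opprK addrC -[X in `|X|](_ : (slope (xi z) (v z) (q z) - slope (xi x) (v x) (q x)) *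
    ((slope (xi x) (v x) (q x))^-1 * (slope (xi z) (v z) (q z))^-1) = _); last first.
    by field; rewrite !sl0.
  have M0 := nice_pos (nice_Pd _) Hv.
  rewrite [leRHS]mulrAC normrM ler_pM//; last first.
    by rewrite normrM !normfV ler_pM ?invr_ge0// lef_pV2 ?posrE// (lt_le_trans c_gt0).
  rewrite -mulrA; apply: HA => //.
  - rewrite xx; apply: (@le_trans _ _ `|w z - w x|).
      exact: between_dist (Hxi z).1.
    by apply: (le_trans (HB h)); rewrite mulrDl lerDl mulr_ge0.
  - by apply: (le_trans (lip v Hv h)); rewrite mulrDl lerDr mulr_ge0.
  - by apply: (le_trans (lip q Hq h)); rewrite mulrDl lerDr mulr_ge0.
have := is_derive_add (is_derive_const (w x) x e) (is_derive_mul0 Nx dN klip).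
rewrite add0r kx mulrN -mulNr; congr (is_derive _ _ _ _).
by apply/funext => z; rewrite -wE.
Qed.

(** The formula for the derivatives of [w] contains [w] but none of its derivatives, so order [k]
    for [w] gives order [k] for its derivatives. [M1] shrinks with the order to keep the previous
    bound on [w] below 1, as the composition estimates require. *)
Lemma implicit_regular k : exists A M1 : R, [/\ 0 <= A, 0 < M1 &
  forall (M : R) (v p q w : R * R -> R), M <= M1 -> M <= m ->
  Pd k M v -> Pd k M p -> Pd k M q ->
  (forall z, `|w z| <= r) -> (forall z, phi (w z) (v z) (p z) (q z) = 0) ->
  Pd k (A * M) w].
Proof.
have [A0 A00 HA0] := phi0_bound.
have base (M : R) (v p q w : R * R -> R) : M <= 1 -> M <= m ->
  Bo setT M v -> Bo setT M p -> Bo setT M q ->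
  (forall z, `|w z| <= r) -> (forall z, phi (w z) (v z) (p z) (q z) = 0) ->
  Bo setT (A0 / c * M) w.
  move=> M1 Mm Hv Hp Hq wr w0 z _.
  have r0 : `|0 : R| <= r by rewrite normr0 (le_trans _ (wr z)).
  have := phi_expanding (p z) r0 (wr z) (le_trans (Hv z I) Mm) (le_trans (Hq z I) Mm).
  rewrite w0 sub0r subr0 normrN => /le_trans/(_ (HA0 _ _ _ _ M1 (Hv z I) (Hp z I) (Hq z I))).
  by move=> H; rewrite mulrAC ler_pdivlMr// mulrC.
have Ac0 : 0 <= A0 / c by rewrite divr_ge0// ltW.
elim: k => [|k [A [M1 [HA M10 IH]]]].
  by exists (A0 / c), 1.
have nk := nice_Pd (R := R) k.
have [Cg Cg0 HCg] := nice_compb nk g_smooth.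
have [Cg' Cg'0 HCg'] := nice_compb nk (smooth_partial 0 g_smooth).
have [Cg1 Cg10 HCg1] := nice_compb nk (smooth_partial 1 g_smooth).
have [CF' CF'0 HCF'] := nice_compb nk (smooth_partial 0 F_smooth).
have [CF1 CF10 HCF1] := nice_compb nk (smooth_partial 1 F_smooth).
have [C C0 HC] := nice_mul nk.
have [Ci Ci0 HCi] := nice_inv nk (C * Cg' * 1 + CF') c_gt0.
pose B := C * (1 + (C * (C * Cg1 * 1) * 1 + C * Cg * 1) + C * CF1 * 1) * Ci.
have B0 : 0 <= B by rewrite /B !mulr_ge0// !addr_ge0 ?mulr_ge0.
exists (A0 / c + B), (Num.min M1 (Num.min 1 (A + 1)^-1)).
have A10 : 0 < A + 1 by rewrite ltr_wpDl.
split; [exact: addr_ge0|by rewrite !lt_min M10 ltr01 invr_gt0|].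
move=> M v p q w; rewrite !le_min => /and3P[MM1 M1' MA] Mm Hv Hp Hq wr w0.
have M0 := nice_pos (nice_Pd _) Hv.
have AM : A * M <= 1.
  apply: (@le_trans _ _ ((A + 1) * (A + 1)^-1)); last by rewrite mulfV ?gt_eqF.
  by rewrite ler_pM// lerDl.
have Hw := IH M v p q w MM1 Mm (PdW Hv) (PdW Hp) (PdW Hq) wr w0.
pose u (i : 'I_2) z := if i == 0 then w z else v z.
have uE z : cv u z = vec2 (w z) (v z) by [].
have Hu : forall i, Pd k 1 (u i).
  apply: ord2P; rewrite /u /=; first exact: (nice_mono nk AM).
  exact: (nice_mono nk M1' (PdW Hv)).
have {}HCg := HCg u Hu; have {}HCg' := HCg' u Hu; have {}HCg1 := HCg1 u Hu.
have {}HCF' := HCF' u Hu; have {}HCF1 := HCF1 u Hu.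
have q1 : Pd k 1 q := nice_mono nk M1' (PdW Hq).
have Hsl : Pd k (C * Cg' * 1 + CF') (fun z => slope (w z) (v z) (q z)).
  apply: nice_ext nk _ _ _ _ (nice_add nk (HC _ _ _ _ HCg' q1) HCF') => z _.
  by rewrite /slope uE.
have sl z := slope_ge (wr z) (le_trans (Pd_bound z Hv) Mm) (le_trans (Pd_bound z Hq) Mm).
have {HCi} Hinv := HCi _ Hsl (fun z _ => sl z).
have Bd0 : Bo setT ((A0 / c + B) * M) w.
  apply: (nice_mono (nice_Bo _)) (base M v p q w M1' Mm _ _ _ wr w0).
  - by exists 0.
  - by rewrite ler_wpM2r// lerDl.
  - by move=> z _; exact: Pd_bound Hv.
  - by move=> z _; exact: Pd_bound Hp.
  - by move=> z _; exact: Pd_bound Hq.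
have low f : Pd k.+1 M f -> Pd 1 M f by apply: Dern_le.
have key (e : R * R) (v' p' q' : R * R -> R) : e = et \/ e = ex ->
    (forall z, is_derive z e v (v' z)) -> (forall z, is_derive z e p (p' z)) ->
    (forall z, is_derive z e q (q' z)) ->
    Pd k M v' -> Pd k M p' -> Pd k M q' ->
    exists2 w', forall z, is_derive z e w (w' z) & Pd k ((A0 / c + B) * M) w'.
  move=> Ee dv dp dq Hv' Hp' Hq'.
  exists (fun z => - (p' z + (partial 1 g (vec2 (w z) (v z)) * v' z * q z +
     g (vec2 (w z) (v z)) * q' z) + partial 1 F (vec2 (w z) (v z)) * v' z) *
     (slope (w z) (v z) (q z))^-1).
    move=> z.
    exact: (implicit_is_derive Mm M1' Ee (low _ Hv) (low _ Hp) (low _ Hq)).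
  have H := HC _ _ _ _ (nice_opp nk (nice_add nk (nice_add nk Hp'
    (nice_add nk (HC _ _ _ _ (HC _ _ _ _ HCg1 Hv') q1) (HC _ _ _ _ HCg Hq')))
    (HC _ _ _ _ HCF1 Hv'))) Hinv.
  apply: (nice_ext nk) (nice_mono nk _ H); first by move=> z _; rewrite uE.
  rewrite mulrDl ler_wpDl ?(mulr_ge0 Ac0 M0)//.
  by rewrite /B le_eqVlt; apply/orP; left; apply/eqP; ring.
have [vt vx Hvt Hvx] := Pd_derive Hv; have [pt px Hpt Hpx] := Pd_derive Hp.
have [qt qx Hqt Hqx] := Pd_derive Hq.
apply/PdS; split=> //.
have [wt dwt Hwt] := key et _ _ _ (or_introl erefl) vt pt qt Hvt Hpt Hqt.
have [wx dwx Hwx] := key ex _ _ _ (or_intror erefl) vx px qx Hvx Hpx Hqx.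
by exists wt, wx.
Qed.

End Solution.

Theorem implicit_function k : exists A M1 r : R, [/\ 0 <= A, 0 < M1, 0 < r &
  forall (M : R) (v p q : R * R -> R), M <= M1 ->
  Pd k M v -> Pd k M p -> Pd k M q ->
  exists w : R * R -> R, [/\ Pd k (A * M) w,
    forall z, phi (w z) (v z) (p z) (q z) = 0 &
    forall z a, `|a| <= r -> phi a (v z) (p z) (q z) = 0 -> a = w z]].
Proof.
have [r [m [r0 r1 m0 slopeP]]] := slope_near.
have [A [M1 [A0 M10 HA]]] := implicit_regular r1 slopeP k.
have [B B0 HB] := phi0_bound.
have B10 : 0 < B + 1 by rewrite ltr_wpDl.
have c0' : 0 < `|c0| by rewrite normr_gt0.
exists A, (Num.min (Num.min M1 m) (Num.min 1 (`|c0| / 2 * r / (B + 1)))), r.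
split=> //; first by rewrite !lt_min M10 m0 ltr01 !divr_gt0// mulr_gt0// divr_gt0.
move=> M v p q; rewrite !le_min => /andP[/andP[MM1 Mm] /andP[M1' MB]] Hv Hp Hq.
have M0 := nice_pos (nice_Pd _) Hv.
have vb z : `|v z| <= m by rewrite (le_trans (Pd_bound z Hv)).
have qb z : `|q z| <= m by rewrite (le_trans (Pd_bound z Hq)).
have /choice[w Hw] z : exists a, `|a| <= r /\ phi a (v z) (p z) (q z) = 0.
  have [|a ar a0] := phi_solvable slopeP (v := v z) (p := p z) (q := q z) (ltW r0) (vb z) (qb z).
    apply: (le_trans (HB _ _ _ _ M1' (Pd_bound z Hv) (Pd_bound z Hp) (Pd_bound z Hq))).
    move: MB; rewrite ler_pdivlMr//; apply: le_trans.
    by rewrite mulrC ler_wpM2l// lerDl.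
  by exists a.
exists w; split=> [|z|z a ar a0]; last 2 first.
- by case: (Hw z).
- by case: (Hw z) => wr w0; apply: (phi_inj slopeP ar wr (vb z) (qb z) a0 w0).
apply: (HA M v p q w) => // z; by case: (Hw z).
Qed.

End ImplicitFunction.

(** * Periodic extension and relative derivatives *)

Section SupNorm.
Context {R : realType} {U : topologicalType} {V : normedModType R}.

Lemma sup_norm_ge (A : set U) (f : U -> V) u : compact A ->
  {within A, continuous f} -> A u -> `|f u| <= sup_norm A f.
Proof.
move=> cA cf Au; apply: ub_le_sup; last by exists u.
have cn : {within A, continuous (fun u => `|f u|)}.
  by move=> p; apply: continuous_comp; [exact: cf|exact: norm_continuous].
have [p _ H] := compact_EVT_max (ex_intro _ u Au) cA cn.
by exists `|f p| => _ [v Av <-]; apply: H; rewrite inE.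
Qed.

Lemma sup_norm_le (A : set U) (f : U -> V) c : A !=set0 ->
  (forall u, A u -> `|f u| <= c) -> sup_norm A f <= c.
Proof.
move=> [u Au] H; apply: ge_sup; first by exists `|f u|, u.
by move=> _ [v Av <-]; exact: H.
Qed.

End SupNorm.

Section PeriodicExtension.
Context {R : realType}.
Variable L : R.
Hypothesis L0 : 0 < L.

Definition wrap (x : R) : R := x - L * (Num.floor (x / L))%:~R.

Lemma wrap_itv (x : R) : 0 <= wrap x < L.
Proof.
have /andP[lo hi] := floor_itv (x / L).
rewrite ler_pdivlMr// in lo; rewrite ltr_pdivrMr// intrD mulrDl mul1r in hi.
by rewrite /wrap subr_ge0 mulrC lo ltrBlDr addrC.
Qed.

Lemma wrapD (x : R) : wrap (x + L) = wrap x.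
Proof.
rewrite /wrap mulrDl mulfV ?gt_eqF// floorDrz ?int_num1// floor1 intrD.
by rewrite mulrDr mulr1; ring.
Qed.

Lemma wrap_id (x : R) : 0 <= x < L -> wrap x = x.
Proof.
move=> /andP[x0 xL]; rewrite /wrap (_ : Num.floor _ = 0) ?mulr0 ?subr0//.
by apply/floor_def; rewrite divr_ge0 ?(ltW L0)//= ltr_pdivrMr// mul1r.
Qed.

Lemma wrapL : wrap L = 0.
Proof. by rewrite -[X in wrap X]add0r wrapD wrap_id// lexx. Qed.

(** Only [x = 0] is delicate: the left half of its neighbourhood is carried by periodicity to the
    left of [L], where the derivative is [G L = G 0]. *)
Lemma periodic_is_derive (F G : R -> R) : (forall x, F (x + L) = F x) ->
  (forall x, segment L x -> forall eps : R, 0 < eps -> exists2 del : R, 0 < del &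
    forall h : R, `|h| < del -> segment L (h + x) ->
      `|F (h + x) - F x - h * G x| <= eps * `|h|) ->
  G 0 = G L -> forall x, 0 <= x < L -> is_derive x 1 F (G x).
Proof.
move=> FL H GL x /andP[x0 xL].
have seg y : 0 <= y -> y <= L -> segment L y.
  by move=> y0 yL; rewrite /segment /= in_itv /= y0.
apply/is_derive_epsP => eps eps0.
have [d d0 Hd] := H x (seg _ x0 (ltW xL)) eps eps0.
have [x00|xn0] := eqVneq x 0.
  have [d' d'0 Hd'] := H L (seg _ (ltW L0) (lexx L)) eps eps0.
  exists (Num.min L (Num.min d d')); first by rewrite !lt_min L0 d0.
  move=> h; rewrite !lt_min => /and3P[hL hd hd'].
  have /andP[hL1 hL2] : - L < h < L by rewrite -ltr_norml.
  rewrite [h *: 1]mulr1; have [h0|h0] := leP 0 h.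
    by apply: Hd => //; apply: seg; rewrite x00 addr0// ltW.
  rewrite x00 addr0 -(FL h) -(FL 0) add0r GL; apply: Hd' => //.
  by apply: seg; [rewrite -lerBlDr sub0r ltW|rewrite gerDr ltW].
have {xn0}x0 : 0 < x by rewrite lt_def xn0.
exists (Num.min d (Num.min x (L - x))); first by rewrite !lt_min d0 x0 subr_gt0.
move=> h; rewrite !lt_min => /and3P[hd hx hL].
rewrite [h *: 1]mulr1; apply: Hd => //.
move: hx hL; rewrite !ltr_norml => /andP[? ?] /andP[? ?].
by apply: seg; lra.
Qed.

Lemma is_derive_wrap (F G : R -> R) : (forall x, F (x + L) = F x) ->
  (forall x, G (x + L) = G x) ->
  (forall x : R, 0 <= x < L -> is_derive x 1 F (G x)) ->
  forall x : R, is_derive x 1 F (G x).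
Proof.
move=> FL GL H x.
have per (f : R -> R) (n : nat) : (forall x, f (x + L) = f x) ->
    forall x, f (x + L * n%:R) = f x.
  move=> fL; elim: n => [|n IH] y; first by rewrite mulr0 addr0.
  by rewrite mulrS mulrDr mulr1 addrA IH fL.
have perz (f : R -> R) (n : int) : (forall x, f (x + L) = f x) ->
    forall x, f (x + L * n%:~R) = f x.
  move=> fL y; case: n => n; first exact: per.
  by rewrite NegzE mulrNz -(per _ n.+1 fL) mulrN subrK.
pose c := L * (- Num.floor (x / L))%:~R.
have xc : x + c = wrap x by rewrite /c mulrNz mulrN.
rewrite -(perz G _ GL x : _ (_ + c) = _).
have -> : F = (fun y => F (y + c)) by apply/funext => y; rewrite perz.
by apply: is_derive_translate; rewrite xc; apply: H; exact: wrap_itv.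
Qed.

Lemma Ck1_norm_ge k j (f : R -> 'cV[R]_2) (x : R) : CkL1 L k f -> (j <= k)%N ->
  segment L x -> `|dn L j f x| <= Ck1_norm L k f.
Proof.
move=> [[cf _] _] jk xL.
apply: (le_trans (sup_norm_ge (segment_compact (a := 0) (b := L)) (cf j jk) xL)).
exact: (le_bigmax _ (fun i : 'I_k.+1 => sup_norm (segment L) (dn L i f))
  (Ordinal (jk : (j < k.+1)%N))).
Qed.

Lemma periodic_extension k (f : R -> 'cV[R]_2) : CkL1 L k f ->
  exists u : 'I_2 -> R -> R, [/\ forall i, Bd k (Ck1_norm L k f) (u i),
    forall i x, u i (x + L) = u i x & forall i x, segment L x -> u i x = f x i 0].
Proof.
move=> Hf; have [[cf df] pf] := Hf.
pose g j i x := dn L j f (wrap x) i 0.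
have gP j i x : g j i (x + L) = g j i x by rewrite /g wrapD.
have gE j i x : (j <= k)%N -> segment L x -> g j i x = dn L j f x i 0.
  move=> jk; rewrite /segment /= in_itv /= => /andP[x0].
  rewrite le_eqVlt => /orP[/eqP ->|xL]; last by rewrite /g wrap_id ?x0.
  by rewrite /g wrapL pf.
have gd j i (x : R) : (j < k)%N -> is_derive x 1 (g j i) (g j.+1 i x).
  move=> jk; apply: is_derive_wrap => // {}x xL.
  apply: periodic_is_derive => // [{xL}x xL eps eps0|].
    have [del del0 H] := derive_in_eps (df j jk x xL) eps0.
    exists del => // h hdel hx; rewrite !gE ?(ltnW jk)//.
    by have := le_trans (coord_le_norm _ i) (H h hdel hx); rewrite !mxE.
  by rewrite /g wrapL wrap_id// lexx.
have gB n j i : (j + n <= k)%N -> Bd n (Ck1_norm L k f) (g j i).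
  elim: n j => [|n IH] j jk.
    rewrite addn0 in jk; move=> x _; apply: le_trans (coord_le_norm _ i) _.
    apply: Ck1_norm_ge => //; rewrite /segment /= in_itv /=.
    by have /andP[-> /ltW] := wrap_itv x.
  apply/BdS; split; last first.
    by exists (g j.+1 i); [move=> x; apply: gd|apply: IH];
      rewrite ?addSnnS// (leq_trans _ jk)// addnS ltnS leq_addr.
  move=> x _; apply: le_trans (coord_le_norm _ i) _.
  apply: Ck1_norm_ge => //; first exact: leq_trans (leq_addr _ _) jk.
  rewrite /segment /= in_itv /=; by have /andP[-> /ltW] := wrap_itv x.
by exists (g 0%N); split=> [i|//|i x xL]; [exact: gB|rewrite gE].
Qed.

End PeriodicExtension.

(** * From functions on the plane to the spaces on the rectangle *)

Section PlaneRegularity.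
Context {R : realType}.

Lemma Pd_continuous M (u : R * R -> R) : Pd 1 M u -> continuous u.
Proof.
move=> Hu [t x]; have M0 := nice_pos (nice_Pd _) Hu.
have M10 : 0 < M + 1 by rewrite ltr_wpDl.
apply/cvgrPdist_le => eps eps0.
exists ([set s | `|t - s| < eps / (M + 1) / 2], [set y | `|x - y| < eps / (M + 1) / 2]).
  have e0 : 0 < eps / (M + 1) / 2 by rewrite !divr_gt0.
  by split; apply: nbhsx_ballx.
move=> [s y] /= [ts xy]; rewrite distrC.
have := Pd_lip (s - t) (y - x) t x Hu.
rewrite ![_ + (_ - _)]addrC !subrK => /le_trans; apply.
rewrite [`|s - t|]distrC [`|y - x|]distrC.
apply: (@le_trans _ _ ((M + 1) * (eps / (M + 1)))).
  rewrite ler_pM ?addr_ge0// ?lerDl//.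
  by rewrite [leRHS]splitr ltW// ltrD.
by rewrite mulrC divfK ?gt_eqF.
Qed.

Context {V : normedModType R}.

Definition expands (f : R -> V) (x : R) (d : V) := forall eps : R, 0 < eps ->
  exists2 del : R, 0 < del & forall h : R, `|h| < del ->
    `|f (h + x) - f x - h *: d| <= eps * `|h|.

Lemma expands_in (L : R) (f : R -> V) (x : R) (d : V) : 0 < L -> segment L x ->
  expands f x d -> derivable_in (segment L) f x /\ derive_in (segment L) f x = d.
Proof.
move=> L0 xL H; apply: derive_in_intro; first exact: segment_accumulation.
by move=> eps /H[del del0 {}H]; exists del => // h hdel _; exact: H.
Qed.

Variables (T L : R) (u ut ux : R * R -> V) (c : R).
Hypotheses (T0 : 0 < T) (L0 : 0 < L)
  (ut_derive : forall t x, expands (fun s => u (s, x)) t (ut (t, x)))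
  (ux_derive : forall t x, expands (fun y => u (t, y)) x (ux (t, x)))
  (u_continuous : continuous u) (ut_continuous : continuous ut)
  (ux_continuous : continuous ux)
  (u_periodic : forall t, u (t, L) = u (t, 0))
  (ux_periodic : forall t, ux (t, L) = ux (t, 0))
  (u_le : forall p, `|u p| <= c) (ut_le : forall p, `|ut p| <= c)
  (ux_le : forall p, `|ux p| <= c).

Lemma dt_expands p : rect T L p -> dt T u p = ut p.
Proof. by case: p => t x [tT xL]; case: (expands_in T0 tT (@ut_derive t x)). Qed.

Lemma dx_expands p : rect T L p -> dx L u p = ux p.
Proof. by case: p => t x [tT xL]; case: (expands_in L0 xL (@ux_derive t x)). Qed.

Lemma CkL2_expands : CkL2 T L 1 u.
Proof.
have within (v w : R * R -> V) : continuous w -> (forall p, rect T L p -> v p = w p) ->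
    {within rect T L, continuous v}.
  move=> cw vw; apply: (@subspace_eq_continuous _ _ _ w); last exact: continuous_subspaceT.
  by move=> p; rewrite inE => /vw/esym.
split; first split.
- exact: continuous_subspaceT.
- split.
  + by move=> [t x] [tT xL]; case: (expands_in T0 tT (@ut_derive t x)).
  + by move=> [t x] [tT xL]; case: (expands_in L0 xL (@ux_derive t x)).
  + by split=> //; exact: within ut_continuous dt_expands.
  + by split=> //; exact: within ux_continuous dx_expands.
- case=> [_ t _|[_ t tT|//]]; first by rewrite /= u_periodic.
  have s0 : segment L 0 by rewrite /segment /= in_itv /= lexx ltW.
  have sL : segment L L by rewrite /segment /= in_itv /= lexx ltW.
  by rewrite /= !dx_expands ?ux_periodic.
Qed.

Lemma Ck2_norm_expands : Ck2_norm T L 1 u <= c.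
Proof.
have c0 : 0 <= c by exact: le_trans (u_le 0).
have r0 := rect0 T0 L0.
apply: bigmax_le => // -[i i2] _; apply: bigmax_le => // -[j j2] /=.
case: i i2 => [|[|//]] i2; case: j j2 => [|[|//]] j2 //= _; apply: sup_norm_le => // p rp.
- by rewrite dx_expands.
- by rewrite dt_expands.
Qed.

End PlaneRegularity.

(** * Construction of the controlled trajectory *)

Section Symmetries.
Context {R : realType}.
Implicit Types (lam f : 'I_2 -> 'cV[R]_2 -> R) (u : 'I_2 -> R * R -> R).

Lemma is_derive_untranslate (g : R -> R) (c x d : R) :
  is_derive x 1 (fun y => g (y + c)) d -> is_derive (x + c) 1 g d.
Proof.
move=> H; have := @is_derive_translate _ (fun y => g (y + c)) (- c) (x + c) d.
rewrite addrK => /(_ H); congr (is_derive _ _ _ _).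
by apply/funext => y; rewrite subrK.
Qed.

Lemma Pd_translate k M (u : R * R -> R) a b :
  Pd k M u -> Pd k M (fun p => u (p.1 + a, p.2 + b)).
Proof.
move=> Hu; have := Pd_swap 0 0 (Pd_swap a b Hu).
by apply: (nice_ext (nice_Pd k)) => p _ /=; rewrite !addr0.
Qed.

Lemma pde_translate lam f u i p a b : pde lam f u i (p.1 + a, p.2 + b) ->
  pde lam f (fun j q => u j (q.1 + a, q.2 + b)) i p.
Proof.
case: p => t x H ut ux /is_derive_tP/= dt /is_derive_xP/= dx; apply: H.
  apply/is_derive_tP.
  exact: (@is_derive_untranslate (fun s => u i (s, x + b)) a t ut).
apply/is_derive_xP.
exact: (@is_derive_untranslate (fun s => u i (t + a, s)) b x ux).
Qed.

(* Exchanging [t] and [x] in [u_t + lam u_x + f = 0] and dividing by [lam]. *)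
Lemma pde_swap lam f lam' f' u i p a b :
  (forall y, lam' i y * lam i y = 1) -> (forall y, f' i y = lam' i y * f i y) ->
  pde lam f u i (p.2 + a, p.1 + b) ->
  pde lam' f' (fun j q => u j (q.2 + a, q.1 + b)) i p.
Proof.
case: p => s t ll ff H ut ux /is_derive_tP/= dt /is_derive_xP/= dx.
have /H : is_derive (t + a, s + b) et (u i) ux.
  apply/is_derive_tP.
  exact: (@is_derive_untranslate (fun r => u i (r, s + b)) a t ux).
have -> : cv (fun j q => u j (q.2 + a, q.1 + b)) (s, t) = cv u (t + a, s + b).
  by apply/colP => j; rewrite !cvE.
have /[swap] /[apply] E : is_derive (t + a, s + b) ex (u i) ut.
  apply/is_derive_xP.
  exact: (@is_derive_untranslate (fun r => u i (t + a, r)) b s ut).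
transitivity (lam' i (cv u (t + a, s + b)) *
  (ux + lam i (cv u (t + a, s + b)) * ut + f i (cv u (t + a, s + b)))).
  by rewrite ff !mulrDr mulrA ll mul1r; ring.
by rewrite E mulr0.
Qed.

Lemma open_snd (A : set R) : open A -> open [set p : R * R | A p.2].
Proof.
move=> oA; apply: (@open_comp _ _ (snd : R * R -> R) A) => // p _; exact: cvg_snd.
Qed.

Lemma open_fst_itv (a b : R) : open [set p : R * R | p.1 \in `]a, b[].
Proof. by apply: (@open_fst _ [set` `]a, b[]); exact: interval_open. Qed.

Lemma open_snd_itv (a b : R) : open [set p : R * R | p.2 \in `]a, b[].
Proof. by apply: (@open_snd [set` `]a, b[]); exact: interval_open. Qed.

Lemma pde_on lam f u v (A : set (R * R)) i p : open A -> A p ->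
  (forall q, A q -> forall j, u j q = v j q) -> pde lam f u i p -> pde lam f v i p.
Proof.
by move=> oA Ap uv; apply: pde_near; apply: filterS uv _; exact: open_nbhs_nbhs.
Qed.

End Symmetries.

(** * Evolution in the direction of [x] *)

Section Sideways.
Context {R : realType}.
Variables (lam f : 'I_2 -> 'cV[R]_2 -> R).
Hypotheses (lam_smooth : forall i, smooth (lam i))
  (f_smooth : forall i, smooth (f i)) (f0 : forall i, f i 0 = 0)
  (lam_neq0 : forall i y, lam i y != 0).

Let lam' i y := (lam i y)^-1.
Let f' i y := lam' i y * f i y.
Let lam'_smooth i : smooth (lam' i). Proof. exact: smooth_inv. Qed.
Let f'_smooth i : smooth (f' i). Proof. exact: smooth_mul. Qed.
Let f'0 i : f' i 0 = 0. Proof. by rewrite /f' f0 mulr0. Qed.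

Lemma sideways_problem k (x0 X : R) : 0 <= X -> exists2 C : R, 0 < C &
  forall (M : R) (u0 : 'I_2 -> R -> R), C * M <= 1 ->
    (forall i, Bd k.+2 M (u0 i)) ->
  exists u, [/\ forall i, Pd k.+1 (C * M) (u i),
      forall i t, u i (t, x0) = u0 i t &
      forall i t x, `|x - x0| <= X -> pde lam f u i (t, x)].
Proof.
move=> X0; have [C C0 H] := cauchy_problem lam'_smooth f'_smooth f'0 k X0.
exists C => // M u0 CM Hu0; have [Z [HZ Z0 pZ _]] := H M u0 CM Hu0.
exists (fun i p => Z i (p.2 + - x0, p.1 + 0)); split=> [i|i t|i t x xX].
- exact: Pd_swap (HZ i).
- by rewrite /= subrr addr0 Z0.
apply: (@pde_swap _ lam' f') => [y|y|].
- by rewrite /lam' mulfV.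
- by rewrite /f' mulrA mulfV// mul1r.
- exact: pZ.
Qed.

Lemma sideways_speed (u v : 'I_2 -> R * R -> R) (c x0 t0 rho : R) : 0 <= c ->
  (forall i, Pd 2 1 (u i)) -> (forall i, Pd 2 1 (v i)) ->
  (forall i t x, `|t - t0| <= rho - c * `|x - x0| ->
     [/\ pde lam f u i (t, x), pde lam f v i (t, x) &
         `|(lam i (cv u (t, x)))^-1| <= c]) ->
  (forall i t, `|t - t0| <= rho -> u i (t, x0) = v i (t, x0)) ->
  forall i t x, `|t - t0| <= rho - c * `|x - x0| -> u i (t, x) = v i (t, x).
Proof.
move=> c0 Hu Hv H uv i t x txr.
pose s (w : 'I_2 -> R * R -> R) j p := w j (p.2 + 0, p.1 + x0).
have sE w j : w j (t, x) = s w j (x - x0, t) by rewrite /s /= addr0 subrK.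
rewrite !sE; apply: (finite_speed (c := c) (x0 := t0) (rho := rho)
  lam'_smooth f'_smooth c0) => // [j|j|j y r yr|j r rr].
- exact: Pd_swap (Hu j).
- exact: Pd_swap (Hv j).
- have [|pu pv lc] := H j (r + 0) (y + x0); first by rewrite addr0 addrK.
  split; last exact: lc.
    apply: (@pde_swap _ lam f lam' f' u j (y, r) 0 x0 _ _ pu) => // z; by rewrite /lam' mulVf.
  apply: (@pde_swap _ lam f lam' f' v j (y, r) 0 x0 _ _ pv) => // z; by rewrite /lam' mulVf.
- by rewrite /s /= addr0 add0r uv.
Qed.

End Sideways.

(** * A field joining the initial and final states *)

Section TwoPointField.
Context {R : realType}.
Variables (lam f : 'I_2 -> 'cV[R]_2 -> R) (T L a b d m : R).
Hypotheses (lam_smooth : forall i, smooth (lam i))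
  (f_smooth : forall i, smooth (f i)) (f0 : forall i, f i 0 = 0)
  (lam_neq0 : forall i y, lam i y != 0)
  (T0 : 0 < T) (L0 : 0 < L) (d0 : 0 < d) (dT : 4 * d <= T) (a0 : 0 <= a)
  (dab : a + 8 * d <= b) (bL : b <= L) (m0 : 0 <= m)
  (lam_m : forall i, `|(lam i 0)^-1| <= m)
  (T_large : (L - (b - a) + 8 * d) * m <= T - 4 * d).

Let geometry : [/\ 0 < d, 4 * d <= T, 0 <= a, a + 8 * d <= b & b <= L].
Proof. by []. Qed.

(** The window of length [d] around [T / 2], where the glued field need not be a solution, limits
    the bases of the sideways cones around 0 and [T] to the radius [T / 2 - d / 2]. *)
Lemma time_glued_field : exists2 C : R, 0 < C &
  forall (M : R) (u0 u1 : 'I_2 -> R -> R), C * M <= 1 ->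
    (forall i, Bd 6 M (u0 i)) -> (forall i, Bd 6 M (u1 i)) ->
    (forall i x, u0 i (x + L) = u0 i x) -> (forall i x, u1 i (x + L) = u1 i x) ->
  exists Y Yf Yb : 'I_2 -> R * R -> R, [/\
    forall i, [/\ Pd 5 (C * M) (Y i), Pd 5 (C * M) (Yf i) & Pd 5 (C * M) (Yb i)],
    forall i t x, Y i (t, x + L) = Y i (t, x),
    forall i x, Yf i (0, x) = u0 i x /\ Yb i (T, x) = u1 i x,
    forall i t x, (t <= T / 2 - d / 2 -> Y i (t, x) = Yf i (t, x)) /\
      (T / 2 + d / 2 <= t -> Y i (t, x) = Yb i (t, x)) &
    forall i t x, - T <= t <= 2 * T ->
      pde lam f Yf i (t, x) /\ pde lam f Yb i (t, x)].
Proof.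
have [d0' dT' _ _ _] := geometry.
(* With this horizon both the solution started at 0 and the one started at [T] are valid for
   [- T <= t <= 2 * T]. *)
have T20 : 0 <= 2 * T by rewrite mulr_ge0// ltW.
have [C1 C10 H1] := cauchy_problem lam_smooth f_smooth f0 4 T20.
have [|chi [[Mc Hchi] _ chi0 chi1]] := @step_function R 5 (T / 2 - d / 2) (T / 2 + d / 2).
  by lra.
have Mc0 := nice_pos (nice_Bd _) Hchi.
have n5 := nice_Pd (R := R) 5.
have [Cm Cm0 Hm] := nice_mul n5.
exists (C1 + Cm * Mc * (C1 + C1)).
  by rewrite ltr_wpDr// !mulr_ge0// addr_ge0// ltW.
move=> M u0 u1 CM Hu0 Hu1 per0 per1.
have M0 := nice_pos (nice_Bd _) (Hu0 0).
have K0 : 0 <= Cm * Mc * (C1 + C1) * M by rewrite !mulr_ge0// addr_ge0// ltW.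
rewrite mulrDl in CM *.
have C1M : C1 * M <= 1 by apply: le_trans CM; rewrite lerDl.
have [Yf [HYf Yf0 pYf perf]] := H1 M u0 C1M Hu0.
have [U [HU U0 pU perU]] := H1 M u1 C1M Hu1.
pose Yb i p := U i (p.1 + - T, p.2 + 0).
have HYb i : Pd 5 (C1 * M) (Yb i) by exact: Pd_translate.
exists (fun i p => Yf i p + chi p.1 * (Yb i p - Yf i p)), Yf, Yb; split.
- move=> i; split; last 2 first.
  + by apply: (nice_mono n5) (HYf i); rewrite lerDl.
  + by apply: (nice_mono n5) (HYb i); rewrite lerDl.
  apply: (nice_mono n5) (nice_add n5 (HYf i) (Hm _ _ _ _ (Pd_of_t Hchi)
    (nice_sub n5 (HYb i) (HYf i)))).
  by rewrite -[X in Cm * Mc * X]mulrDl mulrA.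
- by move=> i t x; rewrite /Yb /= !addr0 (perf L per0) (perU L per1).
- by move=> i x; rewrite /Yb /= subrr addr0.
- move=> i t x; split=> H /=; first by rewrite chi0// mul0r addr0.
  by rewrite chi1// mul1r addrC subrK.
- move=> i t x /andP[t1 t2]; split.
    by apply: pYf; rewrite /= ler_norml; apply/andP; split; lra.
  apply: (@pde_translate _ _ _ U i (t, x)); apply: pU.
  by rewrite /= ler_norml; apply/andP; split; lra.
Qed.

(** [m] bounds the inverse speeds at the state 0; by continuity any larger [c] bounds them along
    small fields. *)
Lemma slow_near0 (c : R) : m < c -> exists2 s : R, 0 < s & forall (u : 'I_2 -> R * R -> R) i p,
  (forall j, `|u j p| < s) -> `|(lam i (cv u p))^-1| <= c.
Proof.
move=> mc; have c0 : 0 < c - m by rewrite subr_gt0.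
have H i : exists s : R, 0 < s /\ forall z : 'cV[R]_2,
    (forall j, `|z j 0 - (0 : 'cV[R]_2) j 0| < s) -> `|(lam i z)^-1 - (lam i 0)^-1| <= c - m.
  have ci : continuous (fun y => (lam i y)^-1).
    exact: smooth_continuous (smooth_inv (lam_neq0 i) (lam_smooth i)).
  by have [s s0 Hs] := continuous_cvP 0 ci c0; exists s.
have [s0 [s00 H0]] := H 0; have [s1 [s10 H1]] := H 1.
exists (Num.min s0 s1); first by rewrite lt_min s00.
move=> u i p up.
suff : `|(lam i (cv u p))^-1 - (lam i 0)^-1| <= c - m.
  move=> E; rewrite -[X in `|X|](subrK (lam i 0)^-1) (le_trans (ler_normD _ _))//.
  by rewrite -[leRHS](subrK m) lerD.
by move: i; apply: ord2P; [apply: H0|apply: H1] => j; rewrite [X in _ - X]mxE subr0 cvE;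
  have := up j; rewrite lt_min => /andP[].
Qed.

(** An open neighbourhood of the part of the rectangle outside [[d, T - d] x [a + d, b - d]], where
    the control has to vanish. Up to the period [L], the two strips in [x] form one neighbourhood of
    the complement of [(a, b)] on the circle. *)
Definition outer : set (R * R) :=
  [set p | p.2 \in `](b - d), (L + d)[] `|` [set p | p.2 \in `](- d), (a + d)[] `|`
  ([set p | p.1 \in `](- d), d[] `|` [set p | p.1 \in `](T - d), (T + d)[]).

Lemma open_outer : open outer.
Proof.
apply: openU; apply: openU; [exact: open_snd_itv|exact: open_snd_itv| |];
  exact: open_fst_itv.
Qed.

Lemma outer_rect p : rect T L p ->
  ~ (p.1 \in `[d, T - d] /\ p.2 \in `[a + d, b - d]) -> outer p.
Proof.
have [d0' dT' a0' dab' bL'] := geometry.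
case: p => t x [/= + +]; rewrite /segment /= !in_itv /= => /andP[t1 t2] /andP[x1 x2] H.
rewrite /outer /= !in_itv /=.
have [td|td] := ltP t d; first by right; left; apply/andP; split; lra.
have [td'|td'] := ltP (T - d) t; first by right; right; apply/andP; split; lra.
have [xa|xa] := ltP x (a + d); first by left; right; apply/andP; split; lra.
have [xb|xb] := ltP (b - d) x; first by left; left; apply/andP; split; lra.
by case: H; rewrite td td' xa xb.
Qed.

(** This is where the lower bound on [T] enters. From the middle of the complement of [(a, b)] to
    the far ends of the transition zones the distance is [(L - (b - a)) / 2 + 2 * d]; crossing it
    sideways with slope [m + d / (2 * L)] costs at most [T / 2 - d / 2 - d]. A cone based on the
    times within [T / 2 - d / 2] of 0 or [T] thus still contains those within [d]. The excess of the
    slope over [m], which allows for speeds varying with the field, costs at most [d / 2]. *)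
Lemma cone_width : (m + d / (2 * L)) * ((L - (b - a)) / 2 + 2 * d) <= T / 2 - d / 2 - d.
Proof.
have [d0' dT' a0' dab' bL'] := geometry.
have H : d / (2 * L) * ((L - (b - a)) / 2 + 2 * d) <= d / 2.
  rewrite (_ : d / 2 = d / (2 * L) * L); last by field; rewrite gt_eqF.
  by rewrite ler_wpM2l ?divr_ge0 ?mulr_ge0 ?ltW//; lra.
have := mulr_ge0 m0 (ltW d0); have := T_large; rewrite [leLHS]mulrDl => HT md.
rewrite [leLHS]mulrDl.
by move: (d / (2 * L) * _) H HT => z; lra.
Qed.

Lemma near_initial_time (t : R) : `|t - 0| <= T / 2 - d / 2 ->
  - T <= t <= 2 * T /\ t <= T / 2 - d / 2.
Proof.
have [d0' dT' _ _ _] := geometry.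
by rewrite subr0 ler_norml => /andP[? ?]; split; [apply/andP; split|]; lra.
Qed.

Lemma near_final_time (t : R) : `|t - T| <= T / 2 - d / 2 ->
  - T <= t <= 2 * T /\ T / 2 + d / 2 <= t.
Proof.
have [d0' dT' _ _ _] := geometry.
by rewrite ler_norml => /andP[? ?]; split; [apply/andP; split|]; lra.
Qed.

Lemma transition_width (x : R) : b - d - d <= x -> x <= a + d + L + d ->
  `|x - (a + b + L) / 2| <= (L - (b - a)) / 2 + 2 * d.
Proof. by rewrite ler_norml => ? ?; apply/andP; split; lra. Qed.

Theorem two_point_field : exists2 C : R, 0 < C &
  forall (M : R) (u0 u1 : 'I_2 -> R -> R), C * M <= 1 ->
    (forall i, Bd 6 M (u0 i)) -> (forall i, Bd 6 M (u1 i)) ->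
    (forall i x, u0 i (x + L) = u0 i x) -> (forall i x, u1 i (x + L) = u1 i x) ->
  exists y : 'I_2 -> R * R -> R, [/\ forall i, Pd 4 (C * M) (y i),
    forall i t x, `|x| < d -> y i (t, x + L) = y i (t, x),
    forall i x, y i (0, x) = u0 i x /\ y i (T, x) = u1 i x &
    forall i p, outer p -> pde lam f y i p].
Proof.
have [d0' dT' a0' dab' bL'] := geometry.
have left_of x : x < a + d -> x <= b - d - d by move=> ?; lra.
have right_of x : b - d < x -> a + d + L + d <= x + L by move=> ?; lra.
have right_of' x : - d < x -> b - d < x + L by move=> ?; lra.
have da : d <= a + d by lra.
have flat x : b - d < x -> x < L + d -> b - d <= x <= a + d + L by move=> ? ?; lra.
have flat' x : - d < x -> x < a + d -> b - d <= x + L <= a + d + L.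
  by move=> ? ?; lra.
have near_x0 x : - d < x -> x < L + d -> `|x - (a + b + L) / 2| <= 3 * L.
  by move=> ? ?; rewrite ler_norml; lra.
have near_x0' x : - d < x -> x < a + d -> `|x + L - (a + b + L) / 2| <= 3 * L.
  by move=> ? ?; rewrite ler_norml; lra.
have db : - d <= b - d by lra.
have cone_in (r k : R) : r < d -> k <= T / 2 - d / 2 - d -> r <= T / 2 - d / 2 - k.
  by move=> ? ?; lra.
have cone_base (r k : R) : 0 <= k -> r <= T / 2 - d / 2 - k -> r <= T / 2 - d / 2.
  by move=> ? ?; lra.
have cone_time (r k : R) : 0 <= r -> r <= T / 2 - d / 2 - k -> k <= T.
  by move=> ? ?; lra.
have early t : t < d -> t <= T / 2 - d / 2 by move=> ?; lra.
have range_early t : - d < t -> t < d -> - T <= t <= 2 * T by move=> ? ?; lra.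
have range_late t : T - d < t -> t < T + d -> - T <= t <= 2 * T by move=> ? ?; lra.
have late t : T - d < t -> T / 2 + d / 2 <= t by move=> ?; lra.
(* The midpoint of [[b, a + L]], the complement of [(a, b)] on the circle. *)
pose x0 := (a + b + L) / 2.
pose c := m + d / (2 * L).
have mc : m < c by rewrite ltrDl divr_gt0// mulr_gt0.
have cgt0 : 0 < c by rewrite (le_lt_trans m0).
have c0 := ltW cgt0.
(* [3 * L] covers the strips where the sideways solution replaces the glued field, [T / c] the
   extent of the cones in [x]. *)
pose X := 3 * L + T / c.
have X0 : 0 <= X by rewrite addr_ge0//; [rewrite mulr_ge0// ltW|rewrite divr_ge0// ltW].
have [C1 C10 H1] := time_glued_field.
have [C2 C20 H2] := sideways_problem lam_smooth f_smooth f0 lam_neq0 3 x0 X0.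
have [|psi [[Mp Hpsi] psi1 psi0]] := @bump_function R 4 (b - d) (a + d + L) d _ d0.
  by lra.
have Mp0 := nice_pos (nice_Bd _) Hpsi.
have n4 := nice_Pd (R := R) 4.
have [Cm Cm0 Hm] := nice_mul n4.
have [s s0 Hs] := slow_near0 mc.
pose K := Cm * Mp * (C2 * C1 + C1).
have C1' := ltW C10; have C2' := ltW C20.
have K0 : 0 <= K by rewrite !mulr_ge0// addr_ge0// mulr_ge0.
(* Besides bounding the field, [C] encodes smallness conditions: [C2 * C1] keeps the sideways
   solution below 1, and [2 * C1 / s] makes the fields smaller than [s], hence the inverse speeds at
   most [c]. *)
pose C := C1 + (K + K) + (C2 * C1 + 2 * C1 / s).
have s2 : 0 <= 2 * C1 / s by rewrite divr_ge0 ?mulr_ge0// ltW.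
have C21 : 0 <= C2 * C1 by rewrite mulr_ge0.
have CK : C1 + K + K <= C by rewrite -[leLHS]addrA /C lerDl addr_ge0.
have CC1 : C1 <= C by apply: le_trans CK; rewrite -addrA lerDl addr_ge0.
have CC2 : C2 * C1 <= C by rewrite /C addrA ler_wpDr// lerDr !addr_ge0.
have CCs : 2 * C1 / s <= C by rewrite /C addrA lerDr !addr_ge0.
exists C.
  by rewrite /C -addrA ltr_wpDr// addr_ge0 ?addr_ge0// ?mulr_ge0 ?invr_ge0 ?(ltW s0).
move=> M u0 u1 CM Hu0 Hu1 per0 per1.
have M0 := nice_pos (nice_Bd _) (Hu0 0).
have small B : B <= C -> B * M <= 1.
  by move=> BC; apply: le_trans CM; rewrite ler_wpM2r.
have C1M : C1 * M <= 1 by exact: small.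
have C2M : C2 * (C1 * M) <= 1 by rewrite mulrA; exact: small.
have C1s : C1 * M < s.
  have := small _ CCs; rewrite mulrAC ler_pdivrMr// mul1r -mulrA => H.
  have := mulr_ge0 C1' M0; rewrite le_eqVlt => /orP[/eqP <- //|CM0].
  by apply: lt_le_trans H; rewrite mulr_natl mulr2n ltrDl.
have [Y [Yf [Yb [HY perY Y01 Yfb pY]]]] := H1 M u0 u1 C1M Hu0 Hu1 per0 per1.
have HYi i : Pd 5 (C1 * M) (Y i) by case: (HY i).
have [z [Hz z0 pz]] := H2 (C1 * M) (fun i t => Y i (t, x0)) C2M
  (fun i => Bd_line_t x0 (HYi i)).
have weak k N (u : R * R -> R) : (2 <= k)%N -> N <= 1 -> Pd k N u -> Pd 2 1 u.
  by move=> k2 N1 Hu; apply: (nice_mono (nice_Pd 2) N1); exact: Dern_le Hu.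
have weakY (U : 'I_2 -> R * R -> R) : (forall i, Pd 5 (C1 * M) (U i)) -> forall i, Pd 2 1 (U i).
  by move=> HU i; exact: weak (HU i).
have slow U i p : (forall i, Pd 5 (C1 * M) (U i)) -> `|(lam i (cv U p))^-1| <= c.
  move=> HU; apply: Hs => j; exact: le_lt_trans (Pd_bound p (HU j)) C1s.
have W1 := cone_width; rewrite -/c in W1.
pose G i (p : R * R) := psi p.2 * (z i p - Y i p).
(* Near [t0], which will be 0 or [T], the correction vanishes for all [x]: where [psi] is not 0, the
   point lies in a cone on whose base the sideways solution takes the values of the exact solution
   [U]. *)
have G0 U t0 i t x : (forall i, Pd 5 (C1 * M) (U i)) ->
    (forall i t x, `|t - t0| <= T / 2 - d / 2 -> pde lam f U i (t, x)) ->
    (forall i t x, `|t - t0| <= T / 2 - d / 2 -> Y i (t, x) = U i (t, x)) ->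
    `|t - t0| < d -> G i (t, x) = 0.
  move=> HU pU YU td.
  have [xl|xl] := leP x (b - d - d); first by rewrite /G psi0 ?mul0r//; left.
  have [xr|xr] := leP (a + d + L + d) x; first by rewrite /G psi0 ?mul0r//; right.
  have xW : c * `|x - x0| <= T / 2 - d / 2 - d.
    by apply: le_trans W1; rewrite ler_wpM2l// transition_width// ltW.
  have tr : `|t - t0| <= T / 2 - d / 2 - c * `|x - x0| by exact: cone_in.
  have tr' : `|t - t0| <= T / 2 - d / 2.
    exact: cone_base (mulr_ge0 c0 (normr_ge0 (x - x0))) tr.
  rewrite /G YU//; apply/eqP; rewrite mulf_eq0 subr_eq0; apply/orP; right.
  rewrite eq_sym; apply/eqP.
  apply: (sideways_speed (u := U) (v := z) (c := c) (x0 := x0) (t0 := t0)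
    (rho := T / 2 - d / 2) lam_smooth f_smooth lam_neq0 c0 (weakY U HU)) => //.
  - by move=> j; exact: weak (Hz j).
  - move=> j r y ry; have ry' : `|r - t0| <= T / 2 - d / 2.
      exact: cone_base (mulr_ge0 c0 (normr_ge0 (y - x0))) ry.
    split; [exact: pU| |exact: slow].
    apply: pz; apply: (@le_trans _ _ (T / c)); last by rewrite lerDr mulr_ge0// ltW.
    by rewrite ler_pdivlMr// mulrC; exact: cone_time (normr_ge0 (r - t0)) ry.
  - by move=> j r rr; rewrite z0 YU.
have [normT normT'] := (near_initial_time, near_final_time).
have Gf i t x : `|t| < d -> G i (t, x) = 0.
  move=> td; apply: (G0 Yf 0); rewrite ?subr0//; first by move=> j; case: (HY j).
    by move=> j r y /normT[/(pY j r y)[]].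
  by move=> j r y /normT[_]; case: (Yfb j r y).
have Gb i t x : `|t - T| < d -> G i (t, x) = 0.
  move=> td; apply: (G0 Yb T) => //; first by move=> j; case: (HY j).
    by move=> j r y /normT'[/(pY j r y)[]].
  by move=> j r y /normT'[_]; case: (Yfb j r y).
(* Of the periodic sum of translates of [G], whose supports are disjoint, only the two that meet a
   neighbourhood of [[0, L]] are kept; periodicity is accordingly claimed near [x = 0] only. *)
exists (fun i p => Y i p + G i p + G i (p.1 + 0, p.2 + L)); split.
- move=> i; have HG : Pd 4 (K * M) (G i).
    apply: (nice_mono n4) (Hm _ _ _ _ (Pd_of_x Hpsi)
      (nice_sub n4 (Hz i) (PdW (HYi i)))).
    by rewrite /K mulrA -[X in Cm * Mp * X]mulrDl mulrA.
  apply: (nice_mono n4) (nice_add n4 (nice_add n4 (PdW (HYi i)) HG)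
    (Pd_translate 0 L HG)).
  by rewrite -!mulrDl ler_wpM2r.
- move=> i t x; rewrite ltr_norml => /andP[xl xr] /=; rewrite perY addr0.
  have -> : G i (t, x) = 0.
    by rewrite /G psi0 ?mul0r//; left; apply: left_of; exact: lt_le_trans da.
  have -> : G i (t, x + L + L) = 0.
    by rewrite /G psi0 ?mul0r//; right; apply: right_of; exact: right_of'.
  by rewrite !addr0.
- move=> i x; split.
    have d00 : `|0 : R| < d by rewrite normr0.
    rewrite /= addr0 !Gf// !addr0 (Yfb i 0 x).1; first by case: (Y01 i x).
    exact: early.
  have dT0 : `|T - T| < d by rewrite subrr normr0.
  rewrite /= addr0 !Gb// !addr0 (Yfb i T x).2; first by case: (Y01 i x).
  by apply: late; rewrite gtrBl.
- move=> i [t x]; case=> [[]|[]] /=; rewrite in_itv => /andP[/= l r].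
  + apply: (@pde_on _ lam f z _ [set p | p.2 \in `](b - d), (L + d)[]).
    * exact: open_snd_itv.
    * by rewrite /= in_itv /= l.
    * move=> [s' y] /=; rewrite in_itv /= => /andP[yl yr] j.
      rewrite [G j (s' + 0, _)]/G psi0 ?mul0r ?addr0; last first.
        by right; exact: right_of.
      by rewrite /G psi1 ?mul1r /=; [rewrite addrC subrK|exact: flat].
    * apply: pz; apply: (@le_trans _ _ (3 * L)); last first.
        by rewrite lerDl divr_ge0// ltW.
      by apply: near_x0 => //; exact: le_lt_trans l.
  + apply: (@pde_on _ lam f (fun j q => z j (q.1 + 0, q.2 + L)) _
      [set p | p.2 \in `](- d), (a + d)[]).
    * exact: open_snd_itv.
    * by rewrite /= in_itv /= l.
    * move=> [s' y] /=; rewrite in_itv /= => /andP[yl yr] j.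
      rewrite [G j (s', _)]/G psi0 ?mul0r ?addr0; last first.
        by left; exact: left_of.
      by rewrite /G psi1 ?mul1r /=; [rewrite perY [RHS]addrC subrK|exact: flat'].
    * apply: (@pde_translate _ lam f z i (t, x)); apply: pz.
      apply: (@le_trans _ _ (3 * L)); last by rewrite lerDl divr_ge0// ltW.
      exact: near_x0'.
  + apply: (@pde_on _ lam f Yf _ [set p | p.1 \in `](- d), d[]).
    * exact: open_fst_itv.
    * by rewrite /= in_itv /= l.
    * move=> [s' y] /=; rewrite in_itv /= => /andP[yl yr] j.
      have sd : `|s'| < d by rewrite ltr_norml yl.
      by rewrite addr0 !Gf// !addr0 (Yfb j s' y).1//; exact: early.
    * by case: (pY i t x (range_early _ l r)).
  + apply: (@pde_on _ lam f Yb _ [set p | p.1 \in `](T - d), (T + d)[]).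
    * exact: open_fst_itv.
    * by rewrite /= in_itv /= l.
    * move=> [s' y] /=; rewrite in_itv /= => /andP[yl yr] j.
      have sd : `|s' - T| < d by rewrite ltr_norml ltrBlDl ltrBrDl yl.
      by rewrite addr0 !Gb// !addr0 (Yfb j s' y).2//; exact: late.
    * by case: (pY i t x (range_late _ l r)).
Qed.

End TwoPointField.

Section LocalPeriodicity.
Context {R : realType}.
Variables (L d : R).

(** Periodicity on an open interval around [x = 0], rather than at one point, passes to derivatives
    in [x]. *)
Definition periodic_near0 (F : R * R -> R) : Prop :=
  forall t x, `|x| < d -> F (t, x + L) = F (t, x).

Lemma periodic_near0_derive k M (F : R * R -> R) : Pd k.+1 M F ->
  periodic_near0 F -> periodic_near0 ('D_et F) /\ periodic_near0 ('D_ex F).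
Proof.
move=> HF pF; have [dt dx _ _] := Pd_derive HF; split=> t x xd.
  have /is_derive_tP := dt (t, x + L).
  rewrite (_ : (fun s => F (s, x + L)) = (fun s => F (s, x))).
    by move=> /(@is_derive_tP _ F) H; apply: is_derive_uniq H (dt _).
  by apply/funext => s; rewrite pF.
have /is_derive_xP H := dx (t, x + L).
have {}H := @is_derive_translate _ (fun y => F (t, y)) L x _ H.
have : is_derive x 1 (fun y => F (t, y)) ('D_ex F (t, x + L)).
  apply: (is_derive_on (D := [set y : R | `|y| < d])) H => [|//|y /= yd].
    apply: (@open_comp _ _ (fun t : R => `|t|) [set s | s < d]); last exact: open_lt.
    by move=> s _; exact: norm_continuous.
  by rewrite pF.
by move=> /is_derive_xP H'; apply: is_derive_uniq H' (dx _).
Qed.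

End LocalPeriodicity.

(** * Recovering the first component and the control *)

Section Control.
Context {R : realType}.
Variables (lambda1 lambda2 f1 f2 : 'cV[R]_2 -> R).
Hypotheses (lambda1_smooth : smooth lambda1) (lambda2_smooth : smooth lambda2)
  (f1_smooth : smooth f1) (f2_smooth : smooth f2)
  (f1_0 : f1 0 = 0) (f2_0 : f2 0 = 0) (coupling : partial 0 f2 0 != 0).
Let lam := pair_coeff lambda1 lambda2.
Let f := pair_coeff f1 f2.

(* The second equation, solved for [y_1], makes [y_2] a free variable; the
   first one then defines the control. *)
Lemma control_of_field (L d : R) : exists2 C : R, 0 < C &
  forall (M : R) (y : 'I_2 -> R * R -> R), C * M <= 1 ->
    (forall i, Pd 4 M (y i)) -> (forall i, periodic_near0 L d (y i)) ->
  exists w Theta : R * R -> R, [/\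
    [/\ Pd 3 (C * M) w, periodic_near0 L d w & periodic_near0 L d Theta],
    Pd 2 (C * M) Theta,
    forall p, 'D_et w p + lambda1 (vec2 (w p) (y 1 p)) * 'D_ex w p +
      f1 (vec2 (w p) (y 1 p)) = Theta p,
    forall p, 'D_et (y 1) p + lambda2 (vec2 (w p) (y 1 p)) * 'D_ex (y 1) p +
      f2 (vec2 (w p) (y 1 p)) = 0 &
    forall D, open D -> (forall i p, D p -> pde lam f y i p) ->
      forall p, D p -> w p = y 0 p /\ Theta p = 0].
Proof.
have [A [M1 [r [A0 M10 r0 HA]]]] :=
  implicit_function lambda2_smooth f2_smooth f2_0 coupling 3.
have n2 := nice_Pd (R := R) 2.
have [Cl Cl0 HCl] := nice_compb n2 lambda1_smooth.
have [Cf Cf0 HCf] := nice_comps n2 f1_smooth f1_0.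
have [Cm Cm0 Hm] := nice_mul n2.
pose B := A + Cm * Cl * A + Cf * (A + 1).
have B0 : 0 <= B by rewrite !addr_ge0 ?mulr_ge0// addr_ge0.
(* The first group bounds [w] and [Theta]. The second gives [M <= M1], which admits the data to the
   implicit function theorem, and [A * M <= r] and [M <= r], which put [w] and [y 0] within the
   radius of uniqueness. *)
pose C := (A + B + 1) + (A / r + r^-1 + M1^-1).
have C1 : 0 <= A / r + r^-1 + M1^-1.
  by rewrite !addr_ge0 ?mulr_ge0 ?invr_ge0 ?(ltW r0) ?(ltW M10).
exists C; first by rewrite ltr_wpDr// ltr_wpDl// addr_ge0.
move=> M y CM Hy py; have M0 := nice_pos (nice_Pd _) (Hy 0).
have small c : 0 <= C - c -> c * M <= 1.
  by rewrite subr_ge0 => cC; apply: le_trans CM; rewrite ler_wpM2r.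
have Ar0 : 0 <= A / r by rewrite divr_ge0// ltW.
have r'0 : 0 <= r^-1 by rewrite invr_ge0 ltW.
have M1'0 : 0 <= M1^-1 by rewrite invr_ge0 ltW.
have A1M : (A + 1) * M <= 1 by apply: small; rewrite /C; lra.
have MM1 : M <= M1.
  have : M1^-1 * M <= 1 by apply: small; rewrite /C; lra.
  by rewrite ler_pdivrMl// mulr1.
have Mr : M <= r.
  have : r^-1 * M <= 1 by apply: small; rewrite /C; lra.
  by rewrite ler_pdivrMl// mulr1.
have AMr : A * M <= r.
  have : A / r * M <= 1 by apply: small; rewrite /C; lra.
  by rewrite mulrAC ler_pdivrMr// mul1r.
pose v := y 1.
have [vt vx Hvt Hvx] := Pd_derive (Hy 1).
have [w [Hw w0 wU]] := HA M v ('D_et v) ('D_ex v) MM1 (PdW (Hy 1)) Hvt Hvx.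
have wr p : `|w p| <= r by rewrite (le_trans (Pd_bound p Hw)).
have [wt wx Hwt Hwx] := Pd_derive Hw.
have [pvt pvx] := periodic_near0_derive (Hy 1) (py 1).
have pw : periodic_near0 L d w.
  move=> t x xd; apply: wU => //.
  have := w0 (t, x + L); rewrite pvt// pvx//; congr (phi _ _ _ _ _ _ = 0).
  exact: py.
have [pwt pwx] := periodic_near0_derive Hw pw.
pose Theta p := 'D_et w p + lambda1 (vec2 (w p) (v p)) * 'D_ex w p +
  f1 (vec2 (w p) (v p)).
pose u (i : 'I_2) p := if i == 0 then w p else v p.
have uE p : cv u p = vec2 (w p) (v p) by [].
have Hu : forall i, Pd 2 ((A + 1) * M) (u i).
  apply: ord2P; rewrite /u /=.
    by apply: (nice_mono n2) (PdW Hw); rewrite ler_wpM2r// lerDl.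
  by apply: (nice_mono n2) (PdW (PdW (Hy 1))); rewrite ler_peMl// lerDr.
exists w, Theta; split.
- split=> //; first by apply: (nice_mono (nice_Pd 3)) Hw;
    rewrite ler_wpM2r// /C; lra.
  move=> t x xd; rewrite /Theta pwt// pwx// pw//.
  by have -> : v (t, x + L) = v (t, x) by exact: py.
- have HT := nice_add n2 (nice_add n2 Hwt (Hm _ _ _ _ (HCl u
    (fun i => nice_mono n2 A1M (Hu i))) Hwx)) (HCf u _ A1M Hu).
  apply: (nice_ext n2) (nice_mono n2 _ HT); first by move=> p _; rewrite /Theta uE.
  apply: (@le_trans _ _ (B * M)); last by rewrite ler_wpM2r// /C; lra.
  by rewrite le_eqVlt; apply/orP; left; apply/eqP; rewrite /B; ring.
- by [].
- by move=> p; have := w0 p.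
- move=> D oD pD.
  have wy p : D p -> w p = y 0 p.
    move=> Dp; apply/esym/wU; first exact: le_trans (Pd_bound p (Hy 0)) Mr.
    have := pD 1 p Dp _ _ (vt p) (vx p).
    suff -> : cv y p = vec2 (y 0 p) (v p) by [].
    by apply/colP; apply: ord2P; rewrite cvE ?vec2_0 ?vec2_1.
  move=> p Dp; split; first exact: wy.
  (* The first equation involves derivatives of the first component, so equality with [y 0] is
     needed near [p] and not only at [p]. *)
  have wy' : \near p, w p = y 0 p.
    by apply: filterS wy _; exact: open_nbhs_nbhs.
  have := pD 0 p Dp _ _ (is_derive_near wy' (wt p)) (is_derive_near wy' (wx p)).
  have -> : cv y p = vec2 (w p) (v p).
    by apply/colP; apply: ord2P; rewrite cvE ?vec2_0 ?vec2_1// wy.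
  by [].
Qed.

End Control.

Section VectorRegularity.
Context {R : realType}.

Lemma is_derive_expands_t (u : R * R -> R) t x (d : R) :
  is_derive (t, x) et u d -> expands (fun s => u (s, x)) t d.
Proof.
move=> /is_derive_tP/is_derive_epsP H eps /H[del del0 {}H].
by exists del => // h /H; rewrite [h *: 1]mulr1.
Qed.

Lemma is_derive_expands_x (u : R * R -> R) t x (d : R) :
  is_derive (t, x) ex u d -> expands (fun y => u (t, y)) x d.
Proof.
move=> /is_derive_xP/is_derive_epsP H eps /H[del del0 {}H].
by exists del => // h /H; rewrite [h *: 1]mulr1.
Qed.

Lemma expands_vec2 (u v : R -> R) x du dv : expands u x du -> expands v x dv ->
  expands (fun y => vec2 (u y) (v y)) x (vec2 du dv).
Proof.
move=> Hu Hv eps eps0; have [d1 d10 H1] := Hu eps eps0.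
have [d2 d20 H2] := Hv eps eps0.
exists (Num.min d1 d2) => [|h]; first by rewrite lt_min d10.
rewrite lt_min => /andP[h1 h2]; apply: norm_le_coord; first by rewrite mulr_ge0// ltW.
by apply: ord2P; rewrite !mxE /=; [exact: H1|exact: H2].
Qed.

Lemma continuous_vec2 (u v : R * R -> R) : continuous u -> continuous v ->
  continuous (fun p => vec2 (u p) (v p)).
Proof.
move=> cu cv p; apply: (continuous_comp (f := fun p => (u p, v p))
  (g := fun q => vec2 q.1 q.2)); first exact: cvg_pair (cu p) (cv p).
exact: vec2_continuous.
Qed.

Lemma norm_vec2 (a b c : R) : `|a| <= c -> `|b| <= c -> `|vec2 a b| <= c.
Proof.
move=> ac bc; apply: norm_le_coord; first exact: le_trans ac.
by apply: ord2P; rewrite ?vec2_0 ?vec2_1.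
Qed.

End VectorRegularity.

Lemma supp_subset (R : realType) (T L : R) (Theta : R * R -> R) (I J : interval R) :
  closed ([set` I] `*` [set` J]) ->
  (forall p, rect T L p -> ~ (p.1 \in I /\ p.2 \in J) -> Theta p = 0) ->
  supp T L Theta `<=` [set` I] `*` [set` J].
Proof.
move=> /closure_id -> H; apply: closureS => p [rp /eqP Thp].
by apply: contrapT => np; apply: Thp; apply: H => // -[pI pJ]; exact: np.
Qed.

Lemma closed_box (R : realType) (a b c d : R) : closed (`[a, b] `*` `[c, d] : set (R * R)).
Proof.
by apply: compact_closed; [exact: norm_hausdorff|apply: compact_setX; exact: segment_compact].
Qed.

(* [d] is the supremum of the admissible [delta]: one control with margin [d]
   serves all of them. *)
Lemma margin (R : realFieldType) (T L a b m : R) : 0 < T -> a < b -> 0 <= m ->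
  (L - (b - a)) * m < T ->
  exists d : R, [/\ 0 < d, 4 * d <= T, a + 8 * d <= b,
    (L - (b - a) + 8 * d) * m <= T - 4 * d &
    forall delta, delta < Num.min T ((b - a) / 2) / 4 ->
      (L - (b - a - 8 * delta)) * m < T - 4 * delta -> delta <= d].
Proof.
(* [q] is the value of [delta] at which the condition relating [T] and [delta] becomes an
   equality. *)
move=> T0 ab m0 Tm; pose q := (T - (L - (b - a)) * m) / (8 * m + 4).
have m4 : 0 < 8 * m + 4 by lra.
have ba : 0 < (b - a) / 2 by lra.
exists (Num.min (Num.min T ((b - a) / 2) / 4) q); set d := Num.min _ _.
have d1 : d <= Num.min T ((b - a) / 2) / 4 by rewrite ge_min lexx.
have d2 : d <= q by rewrite ge_min lexx orbT.
have mT : Num.min T ((b - a) / 2) <= T by rewrite ge_min lexx.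
have mb : Num.min T ((b - a) / 2) <= (b - a) / 2 by rewrite ge_min lexx orbT.
split.
- by rewrite lt_min !divr_gt0 ?lt_min ?T0// subr_gt0.
- by lra.
- by lra.
- by move: d2; rewrite ler_pdivlMr//; lra.
- move=> delta D1 D2; rewrite le_min ltW//= ler_pdivlMr//; lra.
Qed.

Theorem theorem3p1 (R : realType) (T L a b : R)
    (lambda1 lambda2 f1 f2 : 'cV[R]_2 -> R)
    (T_gt0 : 0 < T) (L_gt0 : 0 < L)
    (a_ge0 : 0 <= a) (a_lt_b : a < b) (b_le_L : b <= L)
    (lambda1_smooth : smooth lambda1) (lambda2_smooth : smooth lambda2)
    (f1_smooth : smooth f1) (f2_smooth : smooth f2)
    (lambda_lt : forall y, lambda1 y < lambda2 y)
    (lambda1_neq0 : forall y, lambda1 y != 0)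
    (lambda2_neq0 : forall y, lambda2 y != 0)
    (f1_0 : f1 0 = 0) (f2_0 : f2 0 = 0)
    (T_large : (L - (b - a)) * Num.max (1 / `|lambda1 0|) (1 / `|lambda2 0|) < T)
    (coupling : partial 0 f2 0 != 0) :
  forall eps : R, 0 < eps ->
  exists2 mu : R, 0 < mu &
  forall y0 y1 : R -> 'cV[R]_2,
    CkL1 L 6 y0 -> CkL1 L 6 y1 ->
    Ck1_norm L 6 y0 <= mu -> Ck1_norm L 6 y1 <= mu ->
  exists Theta : R * R -> R,
    [/\ CkL2 T L 1 Theta,
        forall delta : R, 0 < delta -> delta < Num.min T ((b - a) / 2) / 4 ->
          (L - (b - a - 8 * delta)) *
            Num.max (1 / `|lambda1 0|) (1 / `|lambda2 0|) < T - 4 * delta ->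
          supp T L Theta `<=`
            `[delta, T - delta] `*` `[a + delta, b - delta],
        Ck2_norm T L 1 Theta <= eps &
        exists y : R * R -> 'cV[R]_2,
          [/\ the_solution T L lambda1 lambda2 f1 f2 Theta y0 y,
              forall x, segment L x -> y (T, x) = y1 x &
              Ck2_norm T L 1 y <= eps]].
Proof.
move=> eps eps0; move: T_large; set m := Num.max _ _ => Tm.
have m0 : 0 <= m by rewrite le_max divr_ge0.
have [d [d0 dT dab Tmd dmax]] := margin T_gt0 a_lt_b m0 Tm.
pose lam := pair_coeff lambda1 lambda2; pose f := pair_coeff f1 f2.
have lam_smooth i : smooth (lam i) by exact: pair_coeff_smooth.
have f_smooth i : smooth (f i) by exact: pair_coeff_smooth.
have f0 : forall i, f i 0 = 0 by apply: ord2P; rewrite /f /pair_coeff.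
have lam_neq0 : forall i y, lam i y != 0 by apply: ord2P; rewrite /lam /pair_coeff.
have lam_m : forall i, `|(lam i 0)^-1| <= m.
  apply: ord2P; rewrite /lam /pair_coeff /= normfV -[leLHS]div1r /m le_max lexx//.
  by rewrite orbT.
have [C1 C10 H1] := two_point_field lam_smooth f_smooth f0 lam_neq0 T_gt0 L_gt0 d0 dT
  a_ge0 dab b_le_L m0 lam_m Tmd.
have [C2 C20 H2] := control_of_field lambda1_smooth lambda2_smooth f1_smooth f2_smooth
  f1_0 f2_0 coupling L d.
(* The bound 1 meets the smallness conditions of the two constructions, [eps] that of the
   conclusion; [mu] is scaled so that both [C1 * mu] and [C2 * (C1 * mu)] are at most [e]. *)
pose e := Num.min 1 eps; have e0 : 0 < e by rewrite lt_min ltr01.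
have e1 : e <= 1 by rewrite ge_min lexx.
have ee : e <= eps by rewrite ge_min lexx orbT.
have C21 : 0 < C2 + 1 by rewrite ltr_wpDl// ltW.
have C120 : 0 < (C2 + 1) * C1 by rewrite mulr_gt0.
exists (e / ((C2 + 1) * C1)); first exact: divr_gt0.
set mu := _ / _ => y0 y1 Hy0 Hy1 n0 n1.
have muE : (C2 + 1) * (C1 * mu) = e by rewrite mulrA mulrC divfK ?gt_eqF.
have mu0 : 0 < mu by rewrite divr_gt0.
have C1mu : 0 <= C1 * mu by rewrite mulr_ge0 ?ltW.
have le1 : C1 * mu <= e by rewrite -muE ler_peMl// lerDr ltW.
have le2 : C2 * (C1 * mu) <= e by rewrite -muE ler_wpM2r// lerDl.
have [u0 [Hu0 pu0 u0E]] := periodic_extension L_gt0 Hy0.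
have [u1 [Hu1 pu1 u1E]] := periodic_extension L_gt0 Hy1.
have Bmono u N : N <= mu -> Bd 6 N u -> Bd 6 mu u by move=> Nmu; exact: (nice_mono (nice_Bd 6) Nmu).
have [z [Hz pz z01 eqz]] := H1 mu u0 u1 (le_trans le1 e1)
  (fun i => Bmono _ _ n0 (Hu0 i)) (fun i => Bmono _ _ n1 (Hu1 i)) pu0 pu1.
have [w [Th [[Hw pw pTh] HTh eq1 eq2 wz]]] := H2 (C1 * mu) z (le_trans le2 e1) Hz pz.
(* On [outer] the field already solves both equations, so there the control vanishes and the first
   component is unchanged; in particular the initial and final states are kept. *)
have {}wz := wz _ (@open_outer R T L a b d) eqz.
have out p : rect T L p -> ~ (p.1 \in `[d, T - d] /\ p.2 \in `[a + d, b - d]) ->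
    w p = z 0 p /\ Th p = 0.
  by move=> rp np; apply: wz; exact: outer_rect.
have [Tt Tx HTt HTx] := Pd_derive HTh; have [wt wx Hwt Hwx] := Pd_derive Hw.
have [vt vx Hvt Hvx] := Pd_derive (Hz 1).
have [pTt pTx] := periodic_near0_derive HTh pTh.
have [pwt pwx] := periodic_near0_derive Hw pw.
have [pvt pvx] := periodic_near0_derive (Hz 1) (pz 1).
have per0 (F : R * R -> R) : periodic_near0 L d F -> forall t, F (t, L) = F (t, 0).
  by move=> pF t; rewrite -(pF t 0) ?add0r// normr0.
have cont k M (F : R * R -> R) : Pd k.+1 M F -> continuous F.
  by move=> HF; apply: (@Pd_continuous _ M); exact: Dern_le HF.
have le2e k (F : R * R -> R) p : Pd k (C2 * (C1 * mu)) F -> `|F p| <= eps.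
  by move=> HF; rewrite (le_trans (Pd_bound p HF))// (le_trans le2).
have le1e k (F : R * R -> R) p : Pd k (C1 * mu) F -> `|F p| <= eps.
  by move=> HF; rewrite (le_trans (Pd_bound p HF))// (le_trans le1).
have Tt' t x := is_derive_expands_t (Tt (t, x)).
have Tx' t x := is_derive_expands_x (Tx (t, x)).
pose y p := vec2 (w p) (z 1 p).
pose yt p := vec2 ('D_et w p) ('D_et (z 1) p).
pose yx p := vec2 ('D_ex w p) ('D_ex (z 1) p).
have yt' t x : expands (fun s => y (s, x)) t (yt (t, x)).
  exact: expands_vec2 (is_derive_expands_t (wt _)) (is_derive_expands_t (vt _)).
have yx' t x : expands (fun s => y (t, s)) x (yx (t, x)).
  exact: expands_vec2 (is_derive_expands_x (wx _)) (is_derive_expands_x (vx _)).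
have ytE p : rect T L p -> dt T y p = yt p by exact: dt_expands.
have yxE p : rect T L p -> dx L y p = yx p by exact: dx_expands.
exists Th; split.
- apply: (CkL2_expands T_gt0 L_gt0 Tt' Tx').
  + exact: cont HTh.
  + exact: cont HTt.
  + exact: cont HTx.
  + exact: per0.
  + exact: per0.
- move=> delta delta0 D1 D2; have dd := dmax _ D1 D2.
  apply: supp_subset; first exact: closed_box.
  move=> p rp np; case: (out p rp) => // -[]; rewrite !in_itv /= => /andP[t1 t2] /andP[x1 x2].
  apply: np; rewrite !in_itv /= (le_trans dd t1) (le_trans t2) ?lerD2l ?lerN2//.
  by rewrite (le_trans _ x1) ?(le_trans x2) ?lerD2l ?lerN2.
- apply: (Ck2_norm_expands T_gt0 L_gt0 Tt' Tx') => p.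
  + exact: le2e HTh.
  + exact: le2e HTt.
  + exact: le2e HTx.
exists y.
have sol : solution T L lambda1 lambda2 f1 f2 Th y0 y.
  split.
  - apply: (CkL2_expands T_gt0 L_gt0 yt' yx').
    + exact: continuous_vec2 (cont _ _ _ Hw) (cont _ _ _ (Hz 1)).
    + exact: continuous_vec2 (cont _ _ _ Hwt) (cont _ _ _ Hvt).
    + exact: continuous_vec2 (cont _ _ _ Hwx) (cont _ _ _ Hvx).
    + by move=> t; rewrite /y (per0 _ pw) (per0 _ (pz 1)).
    + by move=> t; rewrite /yx (per0 _ pwx) (per0 _ pvx).
  - move=> p rp; rewrite ytE// yxE//; apply/equation_coord.
    apply: ord2P; rewrite /pair_coeff /= ?mulr1 ?mulr0.
      by rewrite /yt /yx !vec2_0 eq1.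
    by rewrite /yt /yx !vec2_1 eq2.
  - by move=> t _; rewrite /y (per0 _ pw) (per0 _ (pz 1)).
  - move=> x xL; have wx0 : w (0, x) = z 0 (0, x).
      case: (out (0, x)) => //; last by rewrite /= in_itv /= leNgt d0 => -[].
      by split=> //; rewrite /segment /= in_itv /= lexx ltW.
    rewrite /y wx0; apply/colP; apply: ord2P; rewrite ?vec2_0 ?vec2_1 -u0E//.
      by case: (z01 0 x).
    by case: (z01 1 x).
split.
- by split=> // z' solz'; apply: solution_unique sol solz'.
- move=> x xL; have wxT : w (T, x) = z 0 (T, x).
    case: (out (T, x)) => //; last first.
      by rewrite /= in_itv /= lerBrDl gerDr [d <= 0]leNgt d0 andbF => -[].
    by split=> //; rewrite /segment /= in_itv /= lexx ltW.
  rewrite /y wxT; apply/colP; apply: ord2P; rewrite ?vec2_0 ?vec2_1 -u1E//.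
    by case: (z01 0 x).
  by case: (z01 1 x).
- apply: (Ck2_norm_expands T_gt0 L_gt0 yt' yx') => p; apply: norm_vec2.
  + exact: le2e Hw.
  + exact: le1e (Hz 1).
  + exact: le2e Hwt.
  + exact: le1e Hvt.
  + exact: le2e Hwx.
  + exact: le1e Hvx.
Qed.
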